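(* Let $T\subset\mathbb{R}^n$ be either the set $\mathbb{Z}^n$ of lattice points with $n\ge1$, or the set of primitive lattice points in $\mathbb{Z}^n$ with $n\ge2$. Then $T$ satisfies the angular equidistribution condition and the radial growth condition (both defined in the context), and for every $\lambda\in[0,2]$, $$\lim_{R\to\infty}\frac{\#\{(\mathbf a,\mathbf b)\in T\times T:\ |\mathbf a|\le R,\ |\mathbf b|\le R,\ |\mathbf a-\mathbf b|\le\lambda R\}}{\#\{(\mathbf a,\mathbf b)\in T\times T:\ |\mathbf a|\le R,\ |\mathbf b|\le R\}}=\int_0^\lambda P_n(s)\,ds,\qquad P_n(s)=n s^{n-1}I_{1-\frac{s^2}{4}}\left(\tfrac{n+1}{2},\tfrac12\right).$$
   Context: A lattice point $(x_1,\dots,x_n)\in\mathbb{Z}^n\setminus\{\mathbf 0\}$ is primitive if $\gcd(x_1,\dots,x_n)=1$. $|\cdot|$ is the Euclidean norm on $\mathbb{R}^n$; $B_n(r)$ is the closed ball of radius $r$ centered at $\mathbf 0$; $\mathbb S^{n-1}=\partial B_n(1)$; $\mu_P$ is the Lebesgue (uniform, rotation-invariant) probability measure on $\mathbb S^{n-1}$; $\hat{\mathbf x}=\mathbf x/|\mathbf x|$ for $\mathbf x\ne\mathbf 0$; $N(r)$ is the number of $\mathbf x\in T$ with $|\mathbf x|<r$. Angular condition: for every continuous $f:\mathbb S^{n-1}\to\mathbb{R}$, extended to $\mathbb{R}^n\setminus\{\mathbf 0\}$ by $f(\mathbf x)=f(\hat{\mathbf x})$ (with an arbitrary value at $\mathbf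 0$), $$\lim_{r\to\infty}\frac{1}{|T\cap B_n(r)|}\sum_{\mathbf x\in T\cap B_n(r)}f(\mathbf x)=\int_{\mathbb S^{n-1}}f\,d\mu_P.$$ Radial (growth) condition: for every fixed $\lambda>0$, $\lim_{r\to\infty}N(r\lambda)/N(r)=\lambda^n$. For $a,b>0$ and $0\le x\le 1$, $I_x(a,b)=\dfrac{\int_0^x t^{a-1}(1-t)^{b-1}\,dt}{\int_0^1 t^{a-1}(1-t)^{b-1}\,dt}$ is the regularized incomplete Beta function. *)

(* Defs.v *)
From HB Require Import structures.
From mathcomp Require Import all_boot all_order all_algebra finmap.
From mathcomp Require Import all_classical all_reals all_analysis.
From mathcomp Require Import measurable_realfun.

Set Implicit Arguments.
Unset Strict Implicit.
Unset Printing Implicit Defensive.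
Import Order.TTheory GRing.Theory Num.Theory.
Import numFieldNormedType.Exports.

Local Open Scope classical_set_scope.
Local Open Scope ring_scope.

(* The norm that the library puts on 'rV[R]_n is the sup norm; it induces the
   same topology as the Euclidean norm below. *)
Section euclidean_space.
Context {R : realType} {n : nat}.
Implicit Types x : 'rV[R]_n.

Definition enorm x : R := Num.sqrt (\sum_(i < n) x 0 i ^+ 2).

Definition eball (r : R) : set 'rV[R]_n := [set x | enorm x <= r].

Definition esphere : set 'rV[R]_n := [set x | enorm x = 1].

Definition normalize x : 'rV[R]_n := (enorm x)^-1 *: x.

End euclidean_space.

Section measurable_rV.
Context (R : realType) (n : nat).

Let coord (i : 'I_n) (x : 'rV[R]_n) : R := x 0 i.

Let rV_set0 : g_sigma_preimage coord set0.
Proof. exact: sigma_algebra0. Qed.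

Let rV_setC A : g_sigma_preimage coord A -> g_sigma_preimage coord (~` A).
Proof. exact: sigma_algebraC. Qed.

Let rV_bigcup (F : _^nat) : (forall i, g_sigma_preimage coord (F i)) ->
  g_sigma_preimage coord (\bigcup_i (F i)).
Proof. exact: sigma_algebra_bigcup. Qed.

(* The product sigma-algebra, as for [n.-tuple R]. *)
HB.instance Definition _ := @isMeasurable.Build default_measure_display
  'rV[R]_n (g_sigma_preimage coord) rV_set0 rV_setC rV_bigcup.

Lemma measurable_coord (i : 'I_n) :
  measurable_fun [set: 'rV[R]_n] (fun x : 'rV[R]_n => x 0 i).
Proof.
move=> _ Y mY; rewrite setTI; apply: sub_sigma_algebra => /=.
rewrite -bigcup_seq/=; exists i => /=; first by rewrite mem_index_enum.
by exists Y => //; rewrite setTI.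
Qed.

Lemma measurable_fun_coordP d (T : measurableType d) (f : T -> 'rV[R]_n) :
  measurable_fun [set: T] f <->
  forall i, measurable_fun [set: T] (fun t => f t 0 i).
Proof.
apply: (@iff_trans _ (g_sigma_preimage
    (fun i => coord i \o f) `<=` measurable)).
  rewrite g_sigma_preimage_comp; split=> [mf A [/= C preC <-]|prefS].
    exact: mf.
  by move=> _ A mA; apply: prefS; exists A.
split=> [tnthfS i|mf].
- move=> _ A mA.
  apply: tnthfS; apply: sub_sigma_algebra => /=.
  rewrite -bigcup_seq/=; exists i => /=; first by rewrite mem_index_enum.
  by exists A.
- apply: smallest_sub; first exact: sigma_algebra_measurable.
  rewrite -bigcup_seq/=; apply: bigcup_sub => i Ii.
  by move=> A [B mB <-]; exact: mf.
Qed.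

Lemma measurable_enorm : measurable_fun [set: 'rV[R]_n] enorm.
Proof.
apply: (@measurableT_comp _ _ _ _ _ _ (@Num.sqrt R) _
  (fun x : 'rV[R]_n => \sum_(i < n) x 0 i ^+ 2)).
  exact: (continuous_measurable_fun (@sqrt_continuous R)).
apply: measurable_sum => i; apply: measurable_funX.
exact: measurable_coord.
Qed.

Lemma measurable_normalize : measurable_fun [set: 'rV[R]_n] normalize.
Proof.
apply/measurable_fun_coordP => i.
rewrite (_ : (fun t => _) =
    (fun t : 'rV[R]_n => (enorm t) `^ (-1) * t 0 i)); last first.
  by apply/funext => x; rewrite mxE powRN powRr1// sqrtr_ge0.
apply: measurable_funM; last exact: measurable_coord.
exact: (measurableT_comp (measurable_powR _) measurable_enorm).
Qed.

Lemma measurable_eball r : measurable (eball r : set 'rV[R]_n).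
Proof.
rewrite (_ : eball r = enorm @^-1` `]-oo, r]); last first.
  by apply/seteqP; split => x /=; rewrite in_itv.
by rewrite -[X in measurable X]setTI; exact: measurable_enorm.
Qed.

Lemma measurable_enorm_gt0 : measurable [set x : 'rV[R]_n | 0 < enorm x].
Proof.
rewrite (_ : mkset _ = enorm @^-1` `]0, +oo[); last first.
  by apply/seteqP; split => x /=; rewrite in_itv/= andbT.
by rewrite -[X in measurable X]setTI; exact: measurable_enorm.
Qed.

End measurable_rV.

Section lebesgue_measure_rV.
Context (R : realType).
Local Open Scope ereal_scope.

Definition rV_cons (n : nat) (p : R * 'rV[R]_n) : 'rV[R]_n.+1 :=
  row_mx p.1%:M p.2.

Fixpoint lebesgue_rV (n : nat) : set 'rV[R]_n -> \bar R :=
  match n with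
  | 0%N => dirac (0%R : 'rV[R]_0)
  | m.+1 => pushforward (lebesgue_measure \x @lebesgue_rV m) (@rV_cons m)
  end.

Lemma measurable_rV_cons n : measurable_fun [set: R * 'rV[R]_n] (@rV_cons n).
Proof.
apply/measurable_fun_coordP => i; rewrite /rV_cons.
case: (@splitP 1 n i) => j ij.
- have -> : i = lshift n j by apply/val_inj.
  under eq_fun do rewrite (@row_mxEl _ 1 1 n) mxE ord1 eqxx.
  exact: measurable_fst.
- have -> : i = rshift 1 j by apply/val_inj.
  under eq_fun do rewrite (@row_mxEr _ 1 1 n).
  exact: (measurableT_comp (measurable_coord j) measurable_snd).
Qed.

Definition rV_uncons n (x : 'rV[R]_n.+1) : R * 'rV[R]_n :=
  (x 0%R 0%R, @rsubmx _ 1 1 n x).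

Lemma rV_consK n : cancel (@rV_cons n) (@rV_uncons n).
Proof.
move=> [a x]; rewrite /rV_uncons /rV_cons/= (@row_mxKr _ 1 1 n); congr (_, _).
have -> : (0%R : 'I_n.+1) = lshift n (0%R : 'I_1) by apply/val_inj.
by rewrite (@row_mxEl _ 1 1 n) mxE eqxx.
Qed.

Lemma rV_unconsK n : cancel (@rV_uncons n) (@rV_cons n).
Proof.
move=> x; rewrite /rV_uncons /rV_cons/= -[RHS](@hsubmxK _ 1 1 n x).
congr (@row_mx _ 1 1 n _ _); apply/rowP => i; rewrite !ord1 !mxE/= mulr1n.
by congr (x _ _); apply/val_inj.
Qed.

Lemma measurable_rV_uncons n : measurable_fun [set: 'rV[R]_n.+1] (@rV_uncons n).
Proof.
apply/measurable_fun_pairP; split; first exact: measurable_coord.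
apply/measurable_fun_coordP => i.
under eq_fun do rewrite /= mxE.
exact: measurable_coord.
Qed.

Let bundle_sigma_finite n (mu : set 'rV[R]_n -> \bar R) :
  mu set0 = 0 -> (forall A, 0 <= mu A) -> semi_sigma_additive mu ->
  sigma_finite setT mu ->
  exists m : {sigma_finite_measure set 'rV[R]_n -> \bar R}, mu = m.
Proof.
move=> mu0 mu_ge0 mu_sadd sf.
pose i0 := isMeasure.Build _ _ _ mu mu0 mu_ge0 mu_sadd.
pose mm : {measure set 'rV[R]_n -> \bar R} := HB.pack mu i0.
have sfm : sfinite_measure mm by exact: sfinite_measure_sigma_finite.
pose i1 := @isSFinite.Build _ _ R mu sfm.
pose i2 := @isSigmaFinite.Build _ _ R mu sf.
pose m : {sigma_finite_measure set 'rV[R]_n -> \bar R} :=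
  HB.pack mu i0 i1 i2.
by exists m.
Qed.

Lemma lebesgue_rV_sigma_finite_measure n :
  exists m : {sigma_finite_measure set 'rV[R]_n -> \bar R},
    @lebesgue_rV n = m.
Proof.
elim: n => [|n [m mE]].
  by exists (dirac (0%R : 'rV[R]_0)).
rewrite /= mE.
pose mu : {measure set 'rV[R]_n.+1 -> \bar R} :=
  measure_function_pushforward__canonical__measure_function_Measure
    (lebesgue_measure \x m) (@measurable_rV_cons n).
have sf : sigma_finite setT mu.
  have /sigma_finiteP[F [TF ndF Foo]] := sigma_finiteT (@lebesgue_measure R).
  have /sigma_finiteP[G [TG ndG Goo]] := sigma_finiteT m.
  exists (fun k => @rV_uncons n @^-1` (F k `*` G k)).
    rewrite -preimage_bigcup (_ : \bigcup_k _ = setT) ?preimage_setT//.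
    rewrite -subTset => -[x y] _.
    have [k _ Fkx] : (\bigcup_k F k) x by rewrite -TF.
    have [l _ Gly] : (\bigcup_k G k) y by rewrite -TG.
    exists (maxn k l) => //; split.
    - by move: x Fkx; exact/subsetPset/ndF/leq_maxl.
    - by move: y Gly; exact/subsetPset/ndG/leq_maxr.
  move=> k; have [mF Fk] := Foo k; have [mG Gk] := Goo k; split.
    rewrite -[X in measurable X]setTI; apply: measurable_rV_uncons => //.
    exact: measurableX.
  rewrite /mu/= /pushforward -comp_preimage.
  rewrite (_ : @rV_uncons n \o _ = id) ?preimage_id; last first.
    by apply/funext => p /=; rewrite rV_consK.
  by rewrite product_measure1E// lte_mul_pinfty// ge0_fin_numE.
have [m' m'E] := bundle_sigma_finite (measure0 mu) (measure_ge0 mu)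
  (@measure_semi_sigma_additive _ _ _ mu) sf.
by exists m'.
Qed.

HB.instance Definition _ n := isMeasure.Build _ _ _ (@lebesgue_rV n)
  (let: ex_intro m mE := lebesgue_rV_sigma_finite_measure n in
   eq_ind_r (fun f => f set0 = 0) (measure0 m) mE)
  (fun A => let: ex_intro m mE := lebesgue_rV_sigma_finite_measure n in
   eq_ind_r (fun f => 0 <= f A) (measure_ge0 m A) mE)
  (let: ex_intro m mE := lebesgue_rV_sigma_finite_measure n in
   eq_ind_r (fun f => semi_sigma_additive f)
     (@measure_semi_sigma_additive _ _ _ m) mE).

HB.instance Definition _ n :=
  Measure_isSigmaFinite.Build _ _ _ (@lebesgue_rV n)
  (let: ex_intro m mE := lebesgue_rV_sigma_finite_measure n in
   eq_ind_r (fun f => sigma_finite setT f) (sigma_finiteT m) mE).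

Lemma measurable_cube n (a b : R) :
  measurable [set x : 'rV[R]_n | forall i, (a <= x 0 i <= b)%R].
Proof.
rewrite (_ : mkset _ = \bigcap_(i in [set: 'I_n])
    ((fun x : 'rV[R]_n => x 0%R i) @^-1` `[a, b])); last first.
  apply/seteqP; split => [x /= H i _ /=|x /= H i].
    by rewrite in_itv/=; exact: H.
  by have /= := H i I; rewrite in_itv.
apply: fin_bigcap_measurable => // i _.
by rewrite -[X in measurable X]setTI; exact: measurable_coord.
Qed.

Lemma lebesgue_rV_cube n (a b : R) : (a <= b)%R ->
  lebesgue_rV [set x : 'rV[R]_n | forall i, (a <= x 0 i <= b)%R] =
  ((b - a) ^+ n)%:E.
Proof.
move=> ab; elim: n => [|n ih].
  by rewrite /= diracE mem_set// => -[].
rewrite /= /pushforward.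
rewrite (_ : _ @^-1` _ = `[a, b]%classic `*`
    [set x : 'rV[R]_n | forall i, (a <= x 0 i <= b)%R]); last first.
  apply/seteqP; split => -[u x] /=.
  - move=> H; split.
      move: (H (lshift n (0%R : 'I_1))).
      by rewrite /rV_cons (@row_mxEl _ 1 1 n) mxE eqxx in_itv.
    by move=> i; move: (H (rshift 1 i)); rewrite /rV_cons (@row_mxEr _ 1 1 n).
  - rewrite in_itv/= => -[uab H] i; rewrite /rV_cons.
    case: (@splitP 1 n i) => j ij.
    + have -> : i = lshift n j by apply/val_inj.
      by rewrite (@row_mxEl _ 1 1 n) mxE ord1 eqxx.
    + have -> : i = rshift 1 j by apply/val_inj.
      by rewrite (@row_mxEr _ 1 1 n).
rewrite product_measure1E//; last exact: measurable_cube.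
transitivity (lebesgue_measure (`[a, b]%classic : set R) *
    lebesgue_rV [set x : 'rV[R]_n | forall i, (a <= x 0%R i <= b)%R]) => //.
rewrite ih lebesgue_measure_itv/= lte_fin; case: ltP => [_|ba].
  by rewrite -EFinB -EFinM exprS.
have -> : b = a by apply/eqP; rewrite eq_le ab ba.
by rewrite subrr mul0e exprS mul0r.
Qed.

End lebesgue_measure_rV.

Section sphere_measure.
Context (R : realType) (n : nat).
Local Open Scope ereal_scope.

(* The uniform probability measure on the unit sphere, as the cone measure:
   the measure of A is the proportion of the unit ball filled by the cone
   { x | x / |x| \in A }. *)
Definition sphere_measure (A : set 'rV[R]_n) : \bar R :=
  ((fine (lebesgue_rV (@eball R n 1)))^-1)%:E *
  lebesgue_rV [set x : 'rV[R]_n |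
    [/\ (0 < enorm x)%R, (enorm x <= 1)%R & A (normalize x)]].

Let D : set 'rV[R]_n := eball 1 `&` [set x | (0 < enorm x)%R].

Let mD : measurable D.
Proof.
apply: measurableI; first exact: measurable_eball.
exact: measurable_enorm_gt0.
Qed.

Let c_ge0 : (0 <= (fine (lebesgue_rV (@eball R n 1)))^-1)%R.
Proof. by rewrite invr_ge0 fine_ge0. Qed.

Let mu : {measure set 'rV[R]_n -> \bar R} := mscale (NngNum c_ge0)
  (measure_function_pushforward__canonical__measure_function_Measure
    (mrestr (@lebesgue_rV R n) mD) (@measurable_normalize R n)).

Let muE : sphere_measure = mu.
Proof.
apply/funext => A; rewrite /mu/= /mscale/= /pushforward /mrestr.
congr (_ * lebesgue_rV _); apply/seteqP; split => x /=.
  by move=> [? ? ?].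
by move=> [? [? ?]].
Qed.

HB.instance Definition _ := isMeasure.Build _ _ _ sphere_measure
  (eq_ind_r (fun f => f set0 = 0) (measure0 mu) muE)
  (fun A => eq_ind_r (fun f => 0 <= f A) (measure_ge0 mu A) muE)
  (eq_ind_r (fun f => semi_sigma_additive f)
     (@measure_semi_sigma_additive _ _ _ mu) muE).

Lemma sphere_measure_esphere : (0 < n)%N -> sphere_measure esphere = 1.
Proof.
move=> n0; rewrite /sphere_measure.
have norm1 x : (0 < enorm x)%R -> enorm (normalize x : 'rV[R]_n) = 1%R.
  move=> x0; rewrite [LHS]/enorm.
  under eq_bigr do rewrite mxE exprMn.
  rewrite -mulr_sumr sqrtrM ?exprn_ge0// ?invr_ge0 ?ltW//.
  by rewrite sqrtr_sqr ger0_norm ?invr_ge0 ?ltW// mulVf// gt_eqF.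
have -> : [set x : 'rV[R]_n | [/\ (0 < enorm x)%R, (enorm x <= 1)%R &
    esphere (normalize x)]] = D.
  apply/seteqP; split => x /=; first by move=> [? ? ?].
  by move=> [? ?]; split => //; exact: norm1.
have le_coord (x : 'rV[R]_n) i : (`|x 0%R i| <= enorm x)%R.
  rewrite -sqrtr_sqr ler_sqrt; last by apply: sumr_ge0 => j _; exact: sqr_ge0.
  by rewrite (bigD1 i)//= lerDl sumr_ge0// => j _; exact: sqr_ge0.
have mcube (a b : R) :
    measurable [set x : 'rV[R]_n | forall i, (a <= x 0%R i <= b)%R].
  exact: measurable_cube.
have B_lty : lebesgue_rV (@eball R n 1) < +oo.
  apply: (@le_lt_trans _ _ (((1 - -1) ^+ n)%:E)); last exact: ltry.
  rewrite -lebesgue_rV_cube; last exact: le_trans (lerN10 _) ler01.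
  apply: le_measure; rewrite ?inE//; first exact: measurable_eball.
  by move=> x /= x1 i; rewrite -ler_norml (le_trans (le_coord _ _)).
have DE : lebesgue_rV D = lebesgue_rV (@eball R n 1).
  have -> : @eball R n 1 =
      D `|` [set x : 'rV[R]_n | forall i, (0 <= x 0%R i <= 0)%R].
    apply/seteqP; split => x /=.
      move=> x1; have [x0|x0] := ltP 0%R (enorm x); [by left|right => i].
      by rewrite -eq_le eq_sym -normr_le0 (le_trans (le_coord _ _)).
    move=> [[]//|x0]; rewrite /eball/= /enorm big1 ?sqrtr0 ?ler01// => i _.
    by move: (x0 i); rewrite -eq_le => /eqP <-; rewrite expr0n.
  apply/esym; apply: measureU0; [exact: mD|exact: mcube|].
  apply: (eq_trans (lebesgue_rV_cube n (lexx 0%R))).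
  by rewrite subrr expr0n gtn_eqF.
rewrite DE.
have B_gt0 : 0 < lebesgue_rV (@eball R n 1).
  pose e : R := (n%:R^-1)%R.
  have e0 : (0 < e)%R by rewrite invr_gt0 ltr0n.
  apply: (@lt_le_trans _ _ (((e - 0) ^+ n)%:E)).
    by rewrite lte_fin exprn_gt0// subr0.
  rewrite -(lebesgue_rV_cube n (ltW e0)).
  apply: le_measure; rewrite ?inE; [exact: mcube|exact: measurable_eball|].
  move=> x /= xe; rewrite /eball/= -sqrtr1 ler_sqrt// /=.
  apply: (@le_trans _ _ (\sum_(i < n) e)%R); last first.
    by rewrite sumr_const card_ord /e -[leLHS]mulr_natr mulVf// pnatr_eq0 -lt0n.
  apply: ler_sum => i _; have /andP[x0 xie] := xe i.
  rewrite (le_trans (_ : _ <= e ^+ 2)%R)// ?lerXn2r ?nnegrE ?(ltW e0)//.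
  by rewrite expr2 ler_piMl ?(ltW e0)// /e invf_le1 ?ltr0n// ler1n.
rewrite -[X in _ * X]fineK; last by rewrite ge0_fin_numE.
rewrite -EFinM mulVf// gt_eqF// fine_gt0// B_gt0.
exact: B_lty.
Qed.

End sphere_measure.

(* [fset_set A] is empty when A is infinite; [ncard] is only meaningful on
   finite sets. *)
Definition ncard {U : choiceType} (A : set U) : nat := #|` fset_set A|.

Section point_sets.
Context {R : realType} {n : nat}.
Implicit Types T : set 'rV[R]_n.

Definition lattice_points : set 'rV[R]_n :=
  [set map_mx intr v | v in [set: 'rV[int]_n]].

Definition primitive_points : set 'rV[R]_n :=
  [set map_mx intr v | v in
    [set v : 'rV[int]_n | v != 0 /\ \big[gcdz/0]_(i < n) v 0 i = 1]].

(* The extension of f : S^{n-1} -> R to R^n, with value c at 0; it does not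
   depend on the values of f outside the sphere. *)
Definition radial_extension (f : 'rV[R]_n -> R) (c : R) (x : 'rV[R]_n) : R :=
  if x == 0 then c else f (normalize x).

Definition angular_condition T : Prop :=
  forall (f : 'rV[R]_n -> R) (c : R), {within esphere, continuous f} ->
    (ncard (T `&` eball r))%:R^-1 *
      (\sum_(x \in T `&` eball r) radial_extension f c x) @[r --> +oo] -->
    \int[@sphere_measure R n]_(x in esphere) f x.

Definition radial_count T (r : R) : nat :=
  ncard (T `&` [set x | enorm x < r]).

Definition radial_condition T : Prop :=
  forall lambda : R, 0 < lambda ->
    (radial_count T (r * lambda))%:R / (radial_count T r)%:R
      @[r --> +oo] --> lambda ^+ n.

Definition ball_pairs T (r : R) : set ('rV[R]_n * 'rV[R]_n) :=
  [set p | [/\ T p.1, T p.2, enorm p.1 <= r & enorm p.2 <= r]].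

Definition close_ball_pairs T (lambda r : R) : set ('rV[R]_n * 'rV[R]_n) :=
  ball_pairs T r `&` [set p | enorm (p.1 - p.2) <= lambda * r].

End point_sets.

Section distance_density.
Context {R : realType}.

Definition inc_beta (a b x : R) : R :=
  \int[lebesgue_measure]_(t in `[0, x]) (t `^ (a - 1) * (1 - t) `^ (b - 1)).

Definition reg_inc_beta (a b x : R) : R := inc_beta a b x / inc_beta a b 1.

Definition distance_density (n : nat) (s : R) : R :=
  n%:R * s ^+ n.-1 * reg_inc_beta (n.+1%:R / 2) (1 / 2) (1 - s ^+ 2 / 4).

End distance_density.

(* Main.v *)
Require Import Defs.
From mathcomp Require Import all_boot all_order all_algebra.
From mathcomp Require Import all_classical all_reals all_analysis.
From mathcomp Require Import measurable_realfun.
From mathcomp Require Import ring lra zify.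
Import Order.TTheory GRing.Theory Num.Theory.
Import numFieldNormedType.Exports.
Local Open Scope classical_set_scope.
Local Open Scope ring_scope.

Set Implicit Arguments.
Unset Strict Implicit.
Unset Printing Implicit Defensive.

(** The set T, shrunk by the factor 1/r and with every point weighted by
    c / r^n (c = 1 for all lattice points, c = zeta(n) for the primitive ones),
    converges to Lebesgue measure. All three assertions are instances of this
    one fact, followed by the evaluation of a volume.

    Convergence. A function is called equidistributed ([equid]) when its
    weighted sums over T/r tend to its integral. It is enough to know this for
    the indicators of the cubes of all grids of mesh 1/(k+1) that meet the
    window [-2,2)^n: rounding and uniform continuity give continuous functions
    that vanish off the window ([equid_continuous]), and the sublevel sets of a
    homogeneous continuous gauge follow by sandwiching ([equid_gauge]).
    Equidistribution of products of cubes is automatic, so the same argument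
    applies on pairs of points ([equid_continuous2]). The gauge |x| gives the
    number of points in a ball, hence the radial condition; the gauge
    max(|a|, |b|, |a - b| / lambda) gives the number of close pairs
    ([close_pairs_limit]); cutting off f(x/|x|) near the origin and near the unit
    sphere gives the angular condition ([equid_radial_extension]). For
    lambda = 0 the close pairs are the diagonal, which is negligible.

    The cubes. For all lattice points the count in a cube is a product of n
    counts of integers in an interval. For primitive points, every nonzero
    vector is d times a primitive one for a unique d >= 1, so that the
    normalized counts S of nonzero vectors and P of primitive vectors satisfy
    S(r) = sum_d d^(-n) P(r/d). If S tends to L, then E = P - L / zeta(n)
    satisfies |E(r)| <= o(1) + sum_(d >= 2) d^(-n) |E(r/d)|. Since
    sum_(d >= 2) d^(-2) <= 3/4 < 1, any eventual bound on |E| can be multiplied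
    by 7/8, so E tends to 0 ([cvg_contraction]).

    The volume. The limit for close pairs is the volume of
    { (a, b) : |a|, |b| <= 1, |a - b| <= lambda } divided by V^2, where V is the
    volume of the unit ball B. Substituting b = a + z, it is the integral over
    |z| <= lambda of the volume of the lens of all x with x and x + z in B.
    Lebesgue measure is invariant under rotations, here written as products of
    three shears ([scales_rotation]), so the lens may be placed along the first
    axis, where slicing gives its volume
    2 kappa int_(|z|/2)^1 (1 - t^2)^((n-1)/2) dt, kappa being the volume of the
    unit ball of dimension n - 1 ([lens_axis]). Exchanging integrals, the
    volume of pairs is 2 kappa V int_0^1 (1 - t^2)^((n-1)/2) min(lambda, 2t)^n dt
    ([pair_volume_chord]). With u = 1 - t^2 the incomplete beta integral at
    1 - s^2/4 becomes 2 int_(s/2)^1 (1 - t^2)^((n-1)/2) dt, and a second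
    exchange brings the integral of the distance density to the same form
    ([chord_integral_density], [distance_density_integral]). *)

(** * Maps that multiply a measure by a constant *)

Definition scales d (X : measurableType d) (R : realType)
    (m : set X -> \bar R) (c : R) (S : X -> X) : Prop :=
  measurable_fun setT S /\
  forall A, measurable A -> m (S @^-1` A) = (c%:E * m A)%E.

Section scales.
Context d (X : measurableType d) (R : realType).
Variable m : {measure set X -> \bar R}.
Local Open Scope ereal_scope.

Lemma ge0_integral_scales c S (f : X -> \bar R) : (0 <= c)%R ->
  scales m c S -> measurable_fun setT f -> (forall x, 0 <= f x) ->
  \int[m]_x f (S x) = c%:E * \int[m]_x f x.
Proof.
move=> c0 [mS SE] mf f0.
transitivity (\int[pushforward m S]_(x in setT) f x).
  by rewrite (ge0_integral_pushforward mS).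
rewrite (eq_measure_integral (m1 := pushforward m S)
  (mscale (NngNum c0) m)); last first.
  by move=> A mA _; exact: SE.
by rewrite ge0_integral_mscale.
Qed.

Lemma scales_comp c c' S S' : scales m c S -> scales m c' S' ->
  scales m (c * c')%R (S' \o S).
Proof.
move=> [mS SE] [mS' SE']; split; first exact: measurableT_comp.
move=> A mA; rewrite comp_preimage SE; last first.
  by rewrite -[X in measurable X]setTI; exact: mS'.
by rewrite SE'// muleA EFinM.
Qed.

End scales.

Section scales_prod.
Context d1 d2 (X : measurableType d1) (Y : measurableType d2) (R : realType).
Variables (m1 : {sigma_finite_measure set X -> \bar R})
          (m2 : {sigma_finite_measure set Y -> \bar R}).
Local Open Scope ereal_scope.

(** By Fubini, a map that acts on the second coordinate in a way depending on
    the first one multiplies each section by c2 and then the base by c1. Shears,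
    dilations and the substitution b = a + z are all of this form. *)
Lemma scales_prod_skewl c1 c2 (S1 : X -> X) (S2 : X -> Y -> Y) :
  (0 <= c1)%R -> (0 <= c2)%R ->
  scales m1 c1 S1 -> (forall x, scales m2 c2 (S2 x)) ->
  measurable_fun setT (fun p : X * Y => (S1 p.1, S2 p.1 p.2)) ->
  scales (m1 \x m2) (c1 * c2)%R (fun p => (S1 p.1, S2 p.1 p.2)).
Proof.
move=> c10 c20 sS1 sS2 mS; split => // A mA.
rewrite /product_measure1 /=.
under eq_integral => x _.
  rewrite (_ : xsection _ x = S2 x @^-1` xsection A (S1 x)); last first.
    by apply/seteqP; split => y; rewrite /xsection/= !inE.
  rewrite (sS2 x).2; last exact: measurable_xsection.
  over.
rewrite (ge0_integral_scales (f := fun x => c2%:E * m2 (xsection A x)) c10 sS1)//.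
- rewrite ge0_integralZl//; first by rewrite muleA EFinM.
  exact: measurable_fun_xsection.
- apply: measurable_funeM; exact: measurable_fun_xsection.
- by move=> x; rewrite mule_ge0.
Qed.

Lemma product_measure1_2 A : measurable A -> (m1 \x m2) A = (m1 \x^ m2) A.
Proof.
apply: (product_measure_unique (m' := m1 \x^ m2)) => B C mB mC.
exact: product_measure2E.
Qed.

Lemma scales_prod_skewr c1 c2 (S1 : Y -> X -> X) (S2 : Y -> Y) :
  (0 <= c1)%R -> (0 <= c2)%R ->
  (forall y, scales m1 c1 (S1 y)) -> scales m2 c2 S2 ->
  measurable_fun setT (fun p : X * Y => (S1 p.2 p.1, S2 p.2)) ->
  scales (m1 \x m2) (c1 * c2)%R (fun p => (S1 p.2 p.1, S2 p.2)).
Proof.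
move=> c10 c20 sS1 sS2 mS; split => // A mA.
rewrite !product_measure1_2//; last first.
  by rewrite -[X in measurable X]setTI; exact: mS.
rewrite /product_measure2 /=.
under eq_integral => y _.
  rewrite (_ : ysection _ y = S1 y @^-1` ysection A (S2 y)); last first.
    by apply/seteqP; split => x; rewrite /ysection/= !inE.
  rewrite (sS1 y).2; last exact: measurable_ysection.
  over.
rewrite (ge0_integral_scales (f := fun y => c1%:E * m1 (ysection A y)) c20 sS2)//.
- rewrite ge0_integralZl//; first by rewrite muleA -EFinM mulrC.
  by apply: measurable_fun_ysection.
- apply: measurable_funeM; exact: measurable_fun_ysection.
- by move=> x; rewrite mule_ge0.
Qed.

End scales_prod.

Section affine.
Context {R : realType}.
Local Open Scope ereal_scope.

(** Lebesgue measure on the line is determined by the intervals, on which the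
    claim is a computation. *)
Lemma scales_lebesgue_affine (t u : R) : (0 < t)%R ->
  scales (@lebesgue_measure R) t^-1 (fun x => t * x + u)%R.
Proof.
move=> t0; set S := (fun x => _).
have mS : measurable_fun setT (S : measurableTypeR R -> measurableTypeR R).
  by apply: measurable_funD => //; exact: mulrl_measurable.
split => // A mA.
have tt : t != 0%R by rewrite gt_eqF.
suff -> : lebesgue_measure A = t%:E * lebesgue_measure (S @^-1` A).
  by rewrite muleA -EFinM mulVf// mul1e.
pose m' : {measure set (measurableTypeR R) -> \bar R} := mscale (NngNum (ltW t0))
  (measure_function_pushforward__canonical__measure_function_Measure
     (@lebesgue_measure R) mS).
rewrite -[RHS]/(m' A); apply: (@lebesgue_measure_unique R m') => // _ [[a b] _ <-] /=.
rewrite /m' /mscale/= /pushforward/=.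
rewrite (_ : S @^-1` _ = `](a - u) / t, (b - u) / t]%classic)%R; last first.
  apply/seteqP; split => x; rewrite /S/= !in_itv/=.
    by move=> /andP[ax xb]; rewrite ltr_pdivrMr// ler_pdivlMr// ltrBlDr lerBrDr ![(x * t)%R]mulrC ax.
  by rewrite ltr_pdivrMr// ler_pdivlMr// ltrBlDr lerBrDr ![(x * t)%R]mulrC.
rewrite !lebesgue_measure_itv/= !lte_fin ltr_pM2r ?invr_gt0// ltrD2r.
case: ifPn => _; last by rewrite mule0.
by rewrite -!EFinB -EFinM; congr EFin; field.
Qed.

Lemma scales_rV_cons n c (P : R * 'rV[R]_n -> R * 'rV[R]_n) S :
  scales (lebesgue_measure \x @lebesgue_rV R n) c P ->
  measurable_fun setT S ->
  (forall p, S (rV_cons p) = rV_cons (P p)) ->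
  scales (@lebesgue_rV R n.+1) c S.
Proof.
move=> [mP PE] mS SP; split => // A mA.
rewrite /= /pushforward -PE; last first.
  by rewrite -[X in measurable X]setTI; exact: measurable_rV_cons.
by congr (product_measure1 _ _ _); apply/seteqP; split => p /=; rewrite SP.
Qed.

Lemma measurable_rV_affine n (t : R) (u : 'rV[R]_n) :
  measurable_fun setT (fun x : 'rV[R]_n => t *: x + u)%R.
Proof.
apply/measurable_fun_coordP => i.
under eq_fun do rewrite !mxE.
by apply: measurable_funD => //; apply: measurable_funM => //; exact: measurable_coord.
Qed.

Lemma scales_rV_affine n (t : R) (u : 'rV[R]_n) : (0 < t)%R ->
  scales (@lebesgue_rV R n) (t^-1 ^+ n)%R (fun x => t *: x + u)%R.
Proof.
move=> t0; elim: n u => [|n ih] u; (split; first exact: measurable_rV_affine).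
  move=> A mA; rewrite expr0 mul1e.
  rewrite (_ : (fun x => _) = id) ?preimage_id//.
  by apply/funext => x; apply/rowP => -[].
suff [] : scales (@lebesgue_rV R n.+1) (t^-1 ^+ n.+1)%R
  (fun x => t *: x + u)%R by [].
pose p := @rV_uncons R n u.
apply: (scales_rV_cons (P := (fun x => (t * x.1 + p.1, t *: x.2 + p.2))%R)).
- rewrite exprS; apply: (scales_prod_skewl (m1 := @lebesgue_measure R)
    (m2 := @lebesgue_rV R n) (S1 := (fun x => t * x + p.1)%R)
    (S2 := (fun _ y => t *: y + p.2)%R)) => //.
  + by rewrite invr_ge0 ltW.
  + by rewrite exprn_ge0// invr_ge0 ltW.
  + exact: scales_lebesgue_affine.
  + apply/measurable_fun_pairP; split => /=.
      apply: measurable_funD => //.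
      by apply: measurable_funM => //; exact: measurable_fst.
    exact: (measurableT_comp (measurable_rV_affine t p.2) measurable_snd).
- exact: measurable_rV_affine.
- move=> [a x]; rewrite -(@rV_unconsK R n u) -/p; case: p => b v /=.
  rewrite /rV_cons/= (@scale_row_mx _ 1 1 n) (@add_row_mx _ 1 1 n) //.
  by rewrite scale_scalar_mx -raddfD.
Qed.

End affine.

(** * Rotations as products of three shears *)

Definition dotv (R : realType) n (u v : 'rV[R]_n) : R :=
  \sum_(i < n) u 0 i * v 0 i.

Section dotv.
Context {R : realType} {n : nat}.
Implicit Types u v w : 'rV[R]_n.

Lemma dotvDl u v w : dotv (u + v) w = dotv u w + dotv v w.
Proof. by rewrite -big_split; apply: eq_bigr => i _; rewrite mxE mulrDl. Qed.

Lemma dotvZl a u w : dotv (a *: u) w = a * dotv u w.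
Proof. by rewrite mulr_sumr; apply: eq_bigr => i _; rewrite mxE mulrA. Qed.

Lemma dotvBl u v w : dotv (u - v) w = dotv u w - dotv v w.
Proof. by rewrite dotvDl -(scaleN1r v) dotvZl mulN1r. Qed.

Lemma dotvC u v : dotv u v = dotv v u.
Proof. by apply: eq_bigr => i _; rewrite mulrC. Qed.

Lemma dotvDr u v w : dotv w (u + v) = dotv w u + dotv w v.
Proof. by rewrite dotvC dotvDl ![dotv w _]dotvC. Qed.

Lemma dotvZr a u w : dotv w (a *: u) = a * dotv w u.
Proof. by rewrite dotvC dotvZl dotvC. Qed.

Lemma enormE u : enorm u = Num.sqrt (dotv u u).
Proof. by congr Num.sqrt; apply: eq_bigr => i _; rewrite expr2. Qed.

Lemma dotv_ge0 u : 0 <= dotv u u.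
Proof. by apply: sumr_ge0 => i _; rewrite -expr2 sqr_ge0. Qed.

Lemma enorm_sqr u : enorm u ^+ 2 = dotv u u.
Proof. by rewrite enormE sqr_sqrtr// dotv_ge0. Qed.

Lemma enorm_ge0 u : 0 <= enorm u.
Proof. exact: sqrtr_ge0. Qed.

Lemma enormZ a u : enorm (a *: u) = `|a| * enorm u.
Proof.
by rewrite !enormE dotvZl dotvZr mulrA -expr2 sqrtrM ?sqr_ge0// sqrtr_sqr.
Qed.

Lemma enormN u : enorm (- u) = enorm u.
Proof. by rewrite -scaleN1r enormZ normrN1 mul1r. Qed.

Lemma enorm0 : enorm (0 : 'rV[R]_n) = 0.
Proof. by rewrite -(scale0r 0) enormZ normr0 mul0r. Qed.

Lemma coord_le_enorm u i : `|u 0 i| <= enorm u.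
Proof.
rewrite -sqrtr_sqr ler_sqrt; last by apply: sumr_ge0 => j _; exact: sqr_ge0.
by rewrite (bigD1 i)//= lerDl sumr_ge0// => j _; exact: sqr_ge0.
Qed.

Lemma enorm_eq0 u : (enorm u == 0) = (u == 0).
Proof.
apply/eqP/eqP => [u0|->]; last exact: enorm0.
apply/rowP => i; rewrite mxE; apply/eqP.
by rewrite -normr_le0 -u0 coord_le_enorm.
Qed.

Lemma enorm_gt0 u : (0 < enorm u) = (u != 0).
Proof. by rewrite lt_neqAle enorm_ge0 andbT eq_sym enorm_eq0. Qed.

End dotv.

Lemma dotv_rV_cons (R : realType) n (p q : R * 'rV[R]_n) :
  dotv (rV_cons p) (rV_cons q) = p.1 * q.1 + dotv p.2 q.2.
Proof.
rewrite /dotv (@big_split_ord _ _ _ 1 n) big_ord1 /=; congr (_ + _).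
  by rewrite /rV_cons !(@row_mxEl _ 1 1 n) !mxE eqxx.
by apply: eq_bigr => i _; rewrite /rV_cons !(@row_mxEr _ 1 1 n).
Qed.

Lemma rV_consB (R : realType) n (p q : R * 'rV[R]_n) :
  rV_cons p - rV_cons q = rV_cons (p.1 - q.1, p.2 - q.2).
Proof.
rewrite /rV_cons (@opp_row_mx _ 1 1 n) (@add_row_mx _ 1 1 n).
by rewrite -raddfB.
Qed.

Lemma rV_cons0 (R : realType) n : rV_cons (0, 0) = 0 :> 'rV[R]_n.+1.
Proof. by rewrite -(subrr (@rV_cons R n (0, 0))) rV_consB !subrr. Qed.

Lemma measurable_dotvr (R : realType) n (v : 'rV[R]_n) :
  measurable_fun setT (fun u => dotv u v).
Proof.
apply: measurable_sum => i; apply: measurable_funM => //.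
exact: measurable_coord.
Qed.

(** The rotation taking the first basis vector to the unit vector (c, v). In the
    plane spanned by both vectors it is the rotation of angle theta with
    c = cos theta and |v| = sin theta; the factorization
    [[1, -tau], [0, 1]] [[1, 0], [sin theta, 1]] [[1, -tau], [0, 1]] with
    tau = tan (theta / 2) = sin theta / (1 + cos theta) extends to dimension n by
    replacing the coordinate along v by the inner product with v. Shears
    visibly preserve Lebesgue measure. *)
Section rotation.
Context {R : realType} {n : nat}.
Variables (c : R) (v : 'rV[R]_n).
Hypotheses (c_ge0 : 0 <= c) (cv : c ^+ 2 + dotv v v = 1).

Let m := (@lebesgue_measure R \x @lebesgue_rV R n)%E.

Let shear1 (p : R * 'rV[R]_n) := (p.1 - (1 + c)^-1 * dotv p.2 v, p.2).
Let shear2 (p : R * 'rV[R]_n) := (p.1, p.2 + p.1 *: v).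

Definition rotation := shear1 \o shear2 \o shear1.

Let c1_neq0 : 1 + c != 0.
Proof. by rewrite gt_eqF// ltr_wpDr. Qed.

Let scales_shear1 : scales m 1 shear1.
Proof.
rewrite /shear1 -[1%R in X in scales _ X]mulr1.
apply: (scales_prod_skewr (m1 := @lebesgue_measure R) (m2 := @lebesgue_rV R n)
  (S1 := fun y x => x - (1 + c)^-1 * dotv y v) (S2 := id)) => //.
- move=> y; have := @scales_lebesgue_affine R 1 (- ((1 + c)^-1 * dotv y v)) ltr01.
  by rewrite invr1; under eq_fun do rewrite mul1r.
- by split => // A mA; rewrite preimage_id mul1e.
- apply/measurable_fun_pairP; split; last exact: measurable_snd.
  apply: measurable_funB; first exact: measurable_fst.
  apply: measurable_funM => //.
  exact: (measurableT_comp (measurable_dotvr v) measurable_snd).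
Qed.

Let scales_shear2 : scales m 1 shear2.
Proof.
rewrite /shear2 -[1%R in X in scales _ X]mulr1.
apply: (scales_prod_skewl (m1 := @lebesgue_measure R) (m2 := @lebesgue_rV R n)
  (S1 := id) (S2 := fun x y => y + x *: v)) => //.
- by split => // A mA; rewrite preimage_id mul1e.
- move=> x; have := @scales_rV_affine R n 1 (x *: v) ltr01.
  by rewrite invr1 expr1n; under eq_fun do rewrite scale1r.
- apply/measurable_fun_pairP; split; first exact: measurable_fst.
  apply/measurable_fun_coordP => i; under eq_fun do rewrite !mxE.
  apply: measurable_funD.
    exact: (measurableT_comp (measurable_coord i) measurable_snd).
  by apply: measurable_funM => //; exact: measurable_fst.
Qed.

Lemma scales_rotation : scales m 1 rotation.
Proof.
have := scales_comp (m := m) (scales_comp (m := m) scales_shear1 scales_shear2)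
  scales_shear1.
by rewrite !mulr1.
Qed.

Lemma rotationE p : rotation p =
  (c * p.1 - dotv p.2 v, p.2 + (p.1 - (1 + c)^-1 * dotv p.2 v) *: v).
Proof.
case: p => a x; rewrite /rotation /shear1 /shear2 /=; congr (_, _).
rewrite dotvDl dotvZl.
have -> : dotv v v = 1 - c ^+ 2 by rewrite -cv; ring.
by field.
Qed.

Lemma measurable_rotation : measurable_fun setT rotation.
Proof.
rewrite (_ : rotation = fun p : R * 'rV[R]_n =>
    (c * p.1 - dotv p.2 v, p.2 + (p.1 - (1 + c)^-1 * dotv p.2 v) *: v));
  last first.
  by apply/funext => p; exact: rotationE.
have mfst : measurable_fun setT (@fst R 'rV[R]_n) by exact: measurable_fst.
have mdot : measurable_fun setT (fun p : R * 'rV[R]_n => dotv p.2 v).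
  exact: (measurableT_comp (measurable_dotvr v) measurable_snd).
apply/measurable_fun_pairP; split => /=.
  by apply: measurable_funB => //; exact: measurable_funM.
apply/measurable_fun_coordP => i; under eq_fun do rewrite !mxE.
apply: measurable_funD.
  exact: (measurableT_comp (measurable_coord i) measurable_snd).
apply: measurable_funM => //; apply: measurable_funB => //.
exact: measurable_funM.
Qed.

Lemma rotation_isometry p q :
  enorm (rV_cons (rotation p) - rV_cons (rotation q)) =
  enorm (rV_cons p - rV_cons q).
Proof.
rewrite !rV_consB !enormE !dotv_rV_cons !rotationE.
case: p q => [a x] [b y] /=; congr Num.sqrt.
set w := x - y.
have -> : c * a - dotv x v - (c * b - dotv y v) = c * (a - b) - dotv w v.
  by rewrite /w dotvBl; ring.
have -> : x + (a - (1 + c)^-1 * dotv x v) *: v -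
    (y + (b - (1 + c)^-1 * dotv y v) *: v) =
    w + ((a - b) - (1 + c)^-1 * dotv w v) *: v.
  rewrite /w opprD addrACA -scalerBl; congr (_ + _ *: _).
  by rewrite dotvBl; ring.
clearbody w; set e := _ - _ * dotv w v.
have -> : dotv (w + e *: v) (w + e *: v) =
    dotv w w + 2 * e * dotv w v + e ^+ 2 * dotv v v.
  rewrite dotvDl dotvZl !dotvDr !dotvZr [dotv v w]dotvC.
  ring.
have -> : dotv v v = 1 - c ^+ 2 by rewrite -cv; ring.
by rewrite /e; field.
Qed.

Lemma rotation_axis s : rotation (s, 0) = (c * s, s *: v).
Proof.
rewrite rotationE /=.
have -> : dotv 0 v = 0 by rewrite -(scale0r 0) dotvZl mul0r.
by rewrite mulr0 !subr0 add0r.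
Qed.

End rotation.

(** The sign condition keeps 1 + cos theta away from 0. Vectors with a negative
    first coordinate are handled by passing to the opposite vector. *)
Lemma rotation_exists (R : realType) n (z : 'rV[R]_n.+1) : 0 <= z 0 0 ->
  exists L : 'rV[R]_n.+1 -> 'rV[R]_n.+1,
    [/\ scales (@lebesgue_rV R n.+1) 1 L,
        forall x y, enorm (L x - L y) = enorm (x - y),
        L 0 = 0 &
        L (rV_cons (enorm z, 0)) = z].
Proof.
move=> z0; have [->|zn0] := eqVneq z 0.
  exists id; split => //; last by rewrite enorm0 rV_cons0.
  by split => // A mA; rewrite preimage_id mul1e.
pose r := enorm z; have r0 : 0 < r by rewrite enorm_gt0.
have rn0 : r != 0 by rewrite gt_eqF.
case zE : (@rV_uncons R n z) => [a x].
have {zE} zE : z = rV_cons (a, x) by rewrite -zE rV_unconsK.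
have az : a = z 0 0.
  rewrite zE /rV_cons (_ : (0 : 'I_n.+1) = lshift n (0 : 'I_1)); last exact/val_inj.
  by rewrite (@row_mxEl _ 1 1 n) mxE eqxx.
pose c := r^-1 * a; pose v := r^-1 *: x.
have c0 : 0 <= c by rewrite mulr_ge0 ?invr_ge0 ?(ltW r0)// az.
have cv : c ^+ 2 + dotv v v = 1.
  rewrite /c /v dotvZl dotvZr.
  have -> : dotv x x = r ^+ 2 - a * a.
    by rewrite /r enorm_sqr zE dotv_rV_cons /= addrAC subrr add0r.
  by field.
pose L := @rV_cons R n \o rotation c v \o @rV_uncons R n.
have LE p : L (rV_cons p) = rV_cons (rotation c v p) by rewrite /L /= rV_consK.
exists L; split.
- apply: (scales_rV_cons (P := rotation c v)) => //.
    exact: scales_rotation.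
  apply: measurableT_comp; last exact: measurable_rV_uncons.
  apply: measurableT_comp; first exact: measurable_rV_cons.
  exact: measurable_rotation.
- move=> y w; rewrite -(rV_unconsK y) -(rV_unconsK w) !LE.
  exact: rotation_isometry.
- have := LE (0, 0); rewrite rotation_axis// mulr0 scale0r.
  by rewrite rV_cons0.
- rewrite LE rotation_axis// -/r [RHS]zE; congr rV_cons.
  by rewrite /c /v scalerA mulfV// scale1r mulrAC mulVf// mul1r.
Qed.

(** * Equidistribution with respect to a measure *)

Section equidistribution.
Context d (X : measurableType d) (R : realType).
Variable mu : {measure set X -> \bar R}.
Variables (w : R -> R) (s : R -> seq X).
Hypothesis w_ge0 : \forall r \near +oo, 0 <= w r.

Definition avg (g : X -> R) (r : R) : R := w r * \sum_(x <- s r) g x.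

Definition equid (g : X -> R) : Prop :=
  mu.-integrable setT (EFin \o g) /\ avg g r @[r --> +oo] --> \int[mu]_x g x.

Lemma equid0 : equid (cst 0).
Proof.
split; first exact: integrable0.
rewrite (_ : avg _ = cst 0); last first.
  by apply/funext => r; rewrite /avg big1// mulr0.
rewrite Rintegral_cst// mul0r; exact: cvg_cst.
Qed.

Lemma equidD f g : equid f -> equid g -> equid (fun x => f x + g x).
Proof.
move=> [If lf] [Ig lg]; split.
  exact: (integrableD measurableT If Ig).
rewrite RintegralD// (_ : avg _ = fun r => avg f r + avg g r).
  exact: cvgD lf lg.
by apply/funext => r; rewrite /avg big_split mulrDr.
Qed.

Lemma equidZ a g : equid g -> equid (fun x => a * g x).
Proof.
move=> [Ig lg]; split; first exact: (integrableZl measurableT a Ig).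
rewrite RintegralZl// (_ : avg _ = fun r => a * avg g r).
  exact: cvgMl_tmp lg.
by apply/funext => r; rewrite /avg -mulr_sumr mulrCA.
Qed.

Lemma equidB f g : equid f -> equid g -> equid (fun x => f x - g x).
Proof.
move=> ef eg; under [X in equid X]eq_fun do rewrite -mulN1r.
by apply: equidD => //; exact: equidZ.
Qed.

Lemma equid_sum (I : Type) (cs : seq I) (P : pred I) (F : I -> X -> R) :
  (forall i, P i -> equid (F i)) -> equid (fun x => \sum_(i <- cs | P i) F i x).
Proof.
move=> eF; elim: cs => [|i cs ih].
  by under [X in equid X]eq_fun do rewrite big_nil; exact: equid0.
have [Pi|nPi] := boolP (P i).
  under [X in equid X]eq_fun do rewrite big_cons Pi.
  by apply: equidD => //; exact: eF.
by under [X in equid X]eq_fun do rewrite big_cons (negbTE nPi).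
Qed.

Lemma equid_sandwich (g : X -> R) : measurable_fun setT g ->
  (forall e, 0 < e -> exists g1 g2, [/\ equid g1, equid g2,
     forall x, g1 x <= g x <= g2 x &
     \int[mu]_x g2 x - \int[mu]_x g1 x <= e]) ->
  equid g.
Proof.
move=> mg sand.
have Ig : mu.-integrable setT (EFin \o g).
  have [g1 [g2 [[I1 _] [I2 _] g12 _]]] := sand _ ltr01.
  apply: (@le_integrable _ _ _ _ _ measurableT _
    (fun x => (`|g1 x| + `|g2 x|)%:E)).
  - exact/measurable_EFinP.
  - move=> x _; rewrite lee_fin [X in _ <= X]ger0_norm ?addr_ge0//.
    have /andP[a b] := g12 x.
    have h1 := ler_norm (- g1 x); have h2 := ler_norm (g2 x).
    have h3 := normr_ge0 (g1 x); have h4 := normr_ge0 (g2 x).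
    rewrite normrN in h1; rewrite ler_norml; apply/andP; split; lra.
  - exact: (integrableD measurableT (integrable_norm I1) (integrable_norm I2)).
split => //; apply/cvgrPdist_le => e e0.
have e2 : 0 < e / 2 by rewrite divr_gt0.
have [g1 [g2 [[I1 l1] [I2 l2] g12 H]]] := sand _ e2.
have le1 : \int[mu]_x g1 x <= \int[mu]_x g x.
  by apply: le_Rintegral => // x _; have /andP[] := g12 x.
have le2 : \int[mu]_x g x <= \int[mu]_x g2 x.
  by apply: le_Rintegral => // x _; have /andP[] := g12 x.
move/cvgrPdist_le : l1 => /(_ _ e2) l1; move/cvgrPdist_le : l2 => /(_ _ e2) l2.
near=> r.
have wr : 0 <= w r by near: r.
have a1 : avg g1 r <= avg g r.
  by rewrite ler_wpM2l// ler_sum// => x _; have /andP[] := g12 x.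
have a2 : avg g r <= avg g2 r.
  by rewrite ler_wpM2l// ler_sum// => x _; have /andP[] := g12 x.
have : `|\int[mu]_x g1 x - avg g1 r| <= e / 2 by near: r.
have : `|\int[mu]_x g2 x - avg g2 r| <= e / 2 by near: r.
rewrite !ler_norml => /andP[b1 b2] /andP[b3 b4].
by apply/andP; split; lra.
Unshelve. all: by end_near. Qed.

Lemma equid_unif (C : set X) (g : X -> R) : equid \1_C -> measurable_fun setT g ->
  (forall e, 0 < e -> exists2 h, equid h &
    forall x, `|g x - h x| <= e * \1_C x) -> equid g.
Proof.
move=> eC mg approx; apply: equid_sandwich => // e e0.
pose V := \int[mu]_x \1_C x.
have V0 : 0 <= V by apply: Rintegral_ge0 => x _; rewrite indicE.
pose e' := e / (2 * (V + 1)).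
have e'0 : 0 < e' by rewrite divr_gt0// mulr_gt0// ltr_wpDl.
have [h eh hg] := approx _ e'0.
have eC' := equidZ e' eC.
exists (fun x => h x - e' * \1_C x), (fun x => h x + e' * \1_C x); split.
- exact: equidB.
- exact: equidD.
- move=> x; have := hg x; rewrite ler_norml => /andP[a b]; apply/andP; split; lra.
- rewrite RintegralD//; [|exact: eh.1|exact: eC'.1].
  rewrite RintegralB//; [|exact: eh.1|exact: eC'.1].
  rewrite RintegralZl//; last exact: eC.1.
  rewrite -/V (_ : _ - _ = e * (V / (V + 1))); last first.
    by rewrite /e'; field; rewrite gt_eqF// ltr_wpDl.
  rewrite ler_piMr ?(ltW e0)// ler_pdivrMr ?ltr_wpDl//; lra.
Qed.

(** A function that is constant on cells is a finite combination of indicators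
    of cells; [c] picks the point of a cell at which it is evaluated, and [C] is
    a union of cells outside of which it vanishes. *)
Lemma equid_step (I : eqType) (idx : X -> I) (c : I -> X) (cs : seq I)
    (C : set X) (g : X -> R) :
  uniq cs -> (forall x, C x -> idx x \in cs) ->
  (forall x, C (c (idx x)) -> C x) ->
  (forall i, C (c i) -> equid \1_[set x | idx x = i]) ->
  (forall x, ~ C x -> g x = 0) ->
  equid (fun x => g (c (idx x))).
Proof.
move=> ucs Ccs cC eI g0.
have -> : (fun x => g (c (idx x))) =
    fun x => \sum_(i <- cs | `[< C (c i) >]) g (c i) * \1_[set x | idx x = i] x.
  apply/funext => x.
  have [xcs|xcs] := boolP (idx x \in cs); last first.
    rewrite big1_seq; last first.
      move=> i /andP[_ ics]; rewrite indicE memNset ?mulr0//= => xi.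
      by move: xcs; rewrite xi ics.
    by apply: g0 => /cC/Ccs; apply/negP.
  rewrite big_mkcond/= (bigD1_seq _ xcs ucs)/= big1 ?addr0; last first.
    move=> i ix; case: ifPn => // _.
    by rewrite indicE memNset ?mulr0//= => /esym/eqP; rewrite (negbTE ix).
  case: asboolP => [_|/g0//].
  by rewrite indicE mem_set// mulr1.
by apply: equid_sum => i /asboolP Ci; apply: equidZ; exact: eI.
Qed.

End equidistribution.

Lemma cvg_exprn (R : realType) (T : Type) (F : set_system T) (FF : Filter F)
    (f : T -> R) (a : R) (n : nat) :
  f @ F --> a -> f x ^+ n @[x --> F] --> a ^+ n.
Proof.
move=> fa; elim: n => [|n ih]; first exact: cvg_cst.
by rewrite exprS; under eq_fun do rewrite exprS; exact: cvgM.
Qed.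

Section ramp.
Context {R : realType}.
Implicit Types a e t : R.

(** The continuous function equal to 1 up to a - e, to 0 from a on, and affine
    in between. *)
Definition ramp a e t : R := Num.min 1 (Num.max 0 ((a - t) / e)).

Lemma continuous_ramp a e : continuous (ramp a e).
Proof.
rewrite (_ : ramp a e = (cst 1) \min ((cst 0) \max (fun t => (a - t) / e)))//.
move=> t; apply: continuous_min; first exact: cvg_cst.
apply: continuous_max; first exact: cvg_cst.
by apply: cvgMr_tmp; apply: cvgB; [exact: cvg_cst|exact: cvg_id].
Qed.

Lemma ramp01 a e t : 0 <= ramp a e t <= 1.
Proof. by rewrite /ramp le_min ler01 /= le_max lexx /= ge_min lexx. Qed.

Lemma ramp_eq0 a e t : 0 < e -> a <= t -> ramp a e t = 0.
Proof.
move=> e0 at_; rewrite /ramp max_l ?min_r ?ler01//.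
by rewrite ler_pdivrMr// mul0r subr_le0.
Qed.

Lemma ramp_eq1 a e t : 0 < e -> t <= a - e -> ramp a e t = 1.
Proof.
move=> e0 at_; rewrite /ramp min_l// le_max; apply/orP; right.
rewrite ler_pdivlMr// mul1r; lra.
Qed.

End ramp.

Section gauge.
Context d (X : measurableType d) (R : realType).
Variable mu : {measure set X -> \bar R}.
Variables (w : R -> R) (s : R -> seq X).
Hypothesis w_ge0 : \forall r \near +oo, 0 <= w r.
Variables (N : X -> R) (m : nat) (V : R).
Hypotheses (mN : measurable_fun setT N)
  (NV : forall t : R, 0 < t -> mu [set x | N x <= t] = (t ^+ m * V)%:E)
  (Nramp : forall a e : R, a <= 3 / 2 -> 0 < e ->
    equid mu w s (fun x => ramp a e (N x))).

Let measurable_le t : measurable [set x | N x <= t].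
Proof.
rewrite (_ : mkset _ = N @^-1` `]-oo, t]); last first.
  by apply/seteqP; split => x /=; rewrite in_itv.
by rewrite -[X in measurable X]setTI; exact: mN.
Qed.

Let integrable_le t : 0 < t ->
  mu.-integrable setT (EFin \o \1_[set x | N x <= t]).
Proof.
move=> t0; apply/integrableP; split; first exact/measurable_EFinP.
under eq_integral do rewrite /= ger0_norm ?indicE//.
have := integral_indic mu measurableT (measurable_le t); rewrite setIT => h.
have := NV t0; rewrite -h => {}h.
under eq_integral do rewrite -indicE.
by rewrite h ltry.
Qed.

Let Rintegral_le t : 0 < t ->
  \int[mu]_x \1_[set x | N x <= t] x = t ^+ m * V.
Proof. by move=> t0; rewrite /Rintegral integral_indic// setIT NV. Qed.

(** The ramps of N going down on [1 - t, 1] and on [1, 1 + t] enclose [g]. Their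
    integrals differ by at most the volume of the shell
    1 - t < N <= 1 + t, which is ((1 + t)^m - (1 - t)^m) V and tends to 0. The
    bound 3/2 on the ramps keeps them inside the window. Leaving [g] free between
    the open and the closed sublevel set covers both kinds of balls at once. *)
Lemma equid_gauge (g : X -> R) : measurable_fun setT g ->
  (forall x, \1_[set x | N x < 1] x <= g x <= \1_[set x | N x <= 1] x) ->
  equid mu w s g.
Proof.
move=> mg gN; apply: equid_sandwich => // e e0.
have [t [t0 t1 te]] : exists t : R, [/\ 0 < t, t < 1 / 2 &
    ((1 + t) ^+ m - (1 - t) ^+ m) * V <= e].
  have : ((1 + t) ^+ m - (1 - t) ^+ m) * V @[t --> (0 : R)] -->
      ((1 + 0) ^+ m - (1 - 0) ^+ m) * V.
    apply: cvgMr_tmp; apply: cvgB.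
      by apply: cvg_exprn; apply: cvgD; [exact: cvg_cst|exact: cvg_id].
    by apply: cvg_exprn; apply: cvgB; [exact: cvg_cst|exact: cvg_id].
  rewrite addr0 subr0 subrr mul0r.
  move=> /cvgrPdist_le/(_ _ e0) [/= z z0 zP].
  exists (Num.min (z / 2) (1 / 4)).
  have h0 : 0 < Num.min (z / 2) (1 / 4) by rewrite lt_min !divr_gt0.
  split => //; first by rewrite gt_min; apply/orP; right; lra.
  rewrite (le_trans (ler_norm _))//.
  rewrite -normrN -sub0r; apply: zP => /=.
  rewrite sub0r normrN gtr0_norm// gt_min; apply/orP; left; lra.
exists (fun x => ramp 1 t (N x)), (fun x => ramp (1 + t) t (N x)); split.
- by apply: Nramp => //; lra.
- by apply: Nramp => //; lra.
- move=> x; have /andP[g1 g2] := gN x; apply/andP; split.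
    apply: le_trans g1; rewrite indicE.
    have [xN|xN] := ltP (N x) 1.
      by rewrite mem_set//; have /andP[] := ramp01 1 t (N x).
    rewrite ramp_eq0//.
  apply: (le_trans g2); rewrite indicE.
  have [xN|xN] := leP (N x) 1; first by rewrite ramp_eq1 ?mem_set//; lra.
  by rewrite memNset /=; [have /andP[] := ramp01 (1 + t) t (N x)|
    apply/negP; rewrite -ltNge].
- apply: le_trans te; rewrite mulrBl; apply: lerB.
  + rewrite -Rintegral_le; last lra.
    apply: le_Rintegral => //.
    * by apply: (Nramp _ _).1 => //; lra.
    * by apply: integrable_le; lra.
    * move=> x _; rewrite indicE; have [xN|xN] := leP (N x) (1 + t).
        by rewrite mem_set//; have /andP[] := ramp01 (1 + t) t (N x).
      by rewrite ramp_eq0// ltW.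
  + rewrite -Rintegral_le; last lra.
    apply: le_Rintegral => //.
    * by apply: integrable_le; lra.
    * by apply: (Nramp _ _).1 => //; lra.
    * move=> x _; rewrite indicE; have [xN|xN] := leP (N x) (1 - t).
        by rewrite ramp_eq1// mem_set.
      rewrite memNset /=; first by have /andP[] := ramp01 1 t (N x).
      by apply/negP; rewrite -ltNge.
Qed.

End gauge.

(** * From grid cells to continuous functions *)

Section round.
Context d (X : measurableType d) (R : realType).
Variable mu : {measure set X -> \bar R}.
Variables (w : R -> R) (s : R -> seq X).
Hypothesis w_ge0 : \forall r \near +oo, 0 <= w r.

(** The maps [q k] send a point to a representative of its cell, so that the
    functions constant on cells are those of the form f \o q k. *)
Lemma equid_round (q : nat -> X -> X) (C : set X) (g : X -> R) :
  (forall k f, (forall x, ~ C x -> f x = 0) -> equid mu w s (f \o q k)) ->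
  (forall k x, C (q k x) <-> C x) ->
  measurable_fun setT g -> (forall x, ~ C x -> g x = 0) ->
  (forall e, 0 < e -> exists k, forall x, C x -> `|g x - g (q k x)| <= e) ->
  equid mu w s g.
Proof.
move=> eq qC mg g0 approx.
have eC : equid mu w s \1_C.
  rewrite (_ : \1_C = \1_C \o q 0); last first.
    apply/funext => x /=; rewrite !indicE; congr (nat_of_bool _)%:R.
    by apply/idP/idP; rewrite !inE => /qC.
  by apply: eq => x nCx; rewrite indicE memNset.
apply: (equid_unif w_ge0 eC mg) => e e0.
have [k kP] := approx e e0; exists (g \o q k); first exact: eq.
move=> x; rewrite indicE; have [Cx|nCx] := pselect (C x).
  by rewrite mem_set// mulr1 kP.
rewrite memNset// mulr0 normr_le0 /= g0// sub0r oppr_eq0 g0//.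
by move/qC.
Qed.

End round.

Lemma compact_uniform (R : realType) (X : pseudoMetricType R) (K : set X)
    (g : X -> R) : compact K -> continuous g ->
  forall e, 0 < e -> exists2 dl, 0 < dl &
    forall x y, K x -> ball x dl y -> `|g x - g y| <= e.
Proof.
move=> /compact_near_coveringP Kc cg e e0.
have e2 : 0 < e / 2 by rewrite divr_gt0.
have := Kc R (0^'+) (fun dl x => forall y, ball x dl y -> `|g x - g y| <= e) _.
case.
  move=> x Kx.
  have /cvgrPdist_le/(_ _ e2) := cg x.
  move=> /nbhs_ballP[dl /= dl0 dlP].
  exists (ball x (dl / 2), [set t | t < dl / 2]).
    split => /=; first by apply/nbhs_ballP; exists (dl / 2) => //=; rewrite divr_gt0.
    by apply: nbhs_right_lt; rewrite divr_gt0.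
  move=> [x' t] /= [xx' tdl] y xy.
  have xdx' : ball x dl x' by apply: le_ball xx'; lra.
  have xdy : ball x dl y.
    rewrite (_ : dl = dl / 2 + dl / 2); last by field.
    apply: ball_triangle xx' _; apply: le_ball xy; exact: ltW.
  have h1 := dlP _ xdx'; have h2 := dlP _ xdy.
  rewrite (_ : g x' - g y = (g x - g y) - (g x - g x')); last by ring.
  apply: (le_trans (ler_normB _ _)); lra.
move=> t /= t0 tP; exists (t / 2) => /=; first by rewrite divr_gt0.
move=> x y Kx; apply: tP => //=; last by rewrite divr_gt0.
by rewrite sub0r normrN gtr0_norm ?divr_gt0//; lra.
Qed.

Lemma exists_invn_lt (R : realType) (e : R) : 0 < e ->
  exists k : nat, k.+1%:R^-1 < e.
Proof.
move=> e0; exists (Num.truncn e^-1).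
have ev0 : 0 < e^-1 by rewrite invr_gt0.
rewrite invf_plt ?posrE ?ltr0n//.
by have /andP[] := truncn_itv (ltW ev0).
Qed.

Section ibox.
Context {n : nat}.

(** The integer vectors with all coordinates in [-M, M], enumerated through
    functions to an ordinal, so that a sum of products of functions of the
    coordinates factors by distributivity. *)
Definition ibox (M : nat) : seq 'rV[int]_n :=
  [seq (\row_i ((f i : nat)%:Z - M%:Z)) | f : {ffun 'I_n -> 'I_(M + M).+1}].

Lemma ibox_uniq M : uniq (ibox M).
Proof.
rewrite map_inj_uniq ?enum_uniq// => f g fg; apply/ffunP => i.
by move/rowP: fg => /(_ i); rewrite !mxE => /addIr[] /val_inj.
Qed.

Lemma mem_ibox M v : (v \in ibox M) = [forall i, `|v 0%R i| <= M]%N.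
Proof.
apply/mapP/forallP => [[f _ ->] i|vM].
  by rewrite mxE; move: (nat_of_ord (f i)) (ltn_ord (f i)) => k; lia.
have h i : (`|(v 0 i + M%:Z)%R| < (M + M).+1)%N by have := vM i; lia.
exists [ffun i => Ordinal (h i)]; first by rewrite mem_enum.
by apply/rowP => i; rewrite !mxE ffunE /=; have := vM i; move: (v 0 i) => z; lia.
Qed.

End ibox.

Section grid.
Context {R : realType} {n : nat}.

Definition cell_index (k : nat) (x : 'rV[R]_n) : 'rV[int]_n :=
  map_mx (fun t => Num.floor (k.+1%:R * t)) x.

Definition cell_corner (k : nat) (p : 'rV[int]_n) : 'rV[R]_n :=
  map_mx (fun z : int => z%:~R / k.+1%:R) p.

(** A half-open cube with integer endpoints is a union of cells of each grid;
    the half-side 2 leaves room for the functions that approximate the indicator of the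
    unit ball from outside. *)
Definition window : set 'rV[R]_n := [set x | forall i, -2 <= x 0 i < 2].

(** Since -2 and 2 are multiples of the mesh, a point is in the window exactly
    when the corner of its cell is. *)
Lemma window_corner k x : window (cell_corner k (cell_index k x)) <-> window x.
Proof.
have k0 : 0 < k.+1%:R :> R by rewrite ltr0n.
have key (t : R) : (-2 <= ((Num.floor (k.+1%:R * t))%:~R : R) / k.+1%:R < 2) = (-2 <= t < 2).
  rewrite ler_pdivlMr// ltr_pdivrMr//.
  rewrite (_ : -2 * k.+1%:R = (- 2 * k.+1%:Z)%:~R :> R); last first.
    by rewrite intrM.
  rewrite (_ : 2 * k.+1%:R = (2 * k.+1%:Z)%:~R :> R); last first.
    by rewrite intrM.
  rewrite ler_int ltr_int floor_ge_int_tmp floor_lt_int !intrM.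
  by rewrite ![_ * k.+1%:~R]mulrC ler_pM2l// ltr_pM2l.
by split => h i; have := h i; rewrite !mxE key.
Qed.

Lemma cell_index_window k x : window x -> cell_index k x \in ibox (k.+1 + k.+1).
Proof.
move=> wx; rewrite mem_ibox; apply/forallP => i; rewrite mxE.
have /andP[h1 h2] := wx i; set f := Num.floor _.
have k0 : 0 < k.+1%:R :> R by rewrite ltr0n.
have f1 : - (2 * k.+1%:Z) <= f.
  rewrite floor_ge_int_tmp -mulNr intrM intrN mulrC.
  by rewrite (_ : k.+1%:Z%:~R = k.+1%:R :> R)// ler_pM2l.
have f2 : f < 2 * k.+1%:Z.
  rewrite floor_lt_int intrM mulrC [ltRHS]mulrC mulrC.
  by rewrite (_ : k.+1%:Z%:~R = k.+1%:R :> R)// ltr_pM2l.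
lia.
Qed.

Lemma measurable_cell k p : measurable [set x | cell_index k x = p].
Proof.
rewrite (_ : mkset _ = \bigcap_(i in [set: 'I_n])
  ((fun x : 'rV[R]_n => x 0 i) @^-1`
    [set t | (p 0 i)%:~R <= k.+1%:R * t < (p 0 i + 1)%:~R])); last first.
  apply/seteqP; split => [x /= <- i _ /=|x /= H].
    by rewrite !mxE; exact: floor_itv.
  by apply/rowP => i; rewrite mxE; apply: floor_def; exact: H.
apply: fin_bigcap_measurable => // i _.
rewrite -[X in measurable X]setTI; apply: measurable_coord => //.
rewrite (_ : [set t | _] = ( *%R k.+1%:R) @^-1`
    `[(p 0 i)%:~R, (p 0 i + 1)%:~R[%classic); last first.
  by apply/seteqP; split => t /=; rewrite in_itv.
by rewrite -[X in measurable X]setTI; exact: mulrl_measurable.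
Qed.

Lemma ball_corner k x e : k.+1%:R^-1 < e ->
  ball x e (cell_corner k (cell_index k x)).
Proof.
move=> ke; have k0 : 0 < k.+1%:R :> R by rewrite ltr0n.
split; first by rewrite (lt_trans _ ke)// invr_gt0.
move=> i j; rewrite /ball/= !mxE ord1.
have /andP[h1 h2] := floor_itv (k.+1%:R * x 0 j).
rewrite intrD in h2.
set f := (Num.floor _)%:~R in h1 h2 *.
rewrite ger0_norm ?subr_ge0 ?ler_pdivrMr// 1?mulrC//.
apply: le_lt_trans ke; rewrite -(ler_pM2l k0) mulrBr.
by rewrite mulVKf ?gt_eqF// mulfV ?gt_eqF//; lra.
Qed.

Lemma window_compact : compact [set x : 'rV[R]_n | forall i, `[-2, 2]%classic (x 0 i)].
Proof.
exact: (@rV_compact R n (fun=> `[-2, 2]%classic) (fun=> @segment_compact R _ _)).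
Qed.

End grid.

Section equid_rV.
Context {R : realType} {n : nat}.
Variables (w : R -> R) (s : R -> seq 'rV[R]_n).
Hypothesis w_ge0 : \forall r \near +oo, 0 <= w r.
Hypothesis cell_equid : forall k p,
  window (cell_corner k p : 'rV[R]_n) ->
  equid (@lebesgue_rV R n) w s \1_[set x | cell_index k x = p].

Lemma equid_continuous (g : 'rV[R]_n -> R) : continuous g ->
  measurable_fun setT g -> (forall x, ~ window x -> g x = 0) ->
  equid (@lebesgue_rV R n) w s g.
Proof.
move=> cg mg g0.
apply: (equid_round w_ge0
  (q := fun k x => cell_corner k (cell_index k x)) (C := window)) => //.
- move=> k f f0.
  apply: (equid_step (idx := cell_index k) (c := cell_corner k)
    (cs := ibox (k.+1 + k.+1)) (C := window)) => //.
  + exact: ibox_uniq.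
  + exact: cell_index_window.
  + by move=> x /window_corner.
  + exact: cell_equid.
- by move=> k x; exact: window_corner.
- move=> e e0; have [dl dl0 dlP] := compact_uniform window_compact cg e0.
  have [k kdl] := exists_invn_lt dl0.
  exists k => x wx; apply: dlP; last exact: ball_corner.
  by move=> i; have /andP[a b] := wx i; rewrite /= in_itv/= a ltW.
Qed.

Let mu := @lebesgue_rV R n.
Let w2 r := w r * w r.
Let s2 r := [seq (x, y) | x <- s r, y <- s r].

(** Both the weighted sum over pairs and the measure of a rectangle are
    products. *)
Lemma equid_indic_setX (A B : set 'rV[R]_n) : measurable A -> measurable B ->
  equid mu w s \1_A -> equid mu w s \1_B ->
  equid (mu \x mu)%E w2 s2 \1_(A `*` B).
Proof.
move=> mA mB [IA lA] [IB lB].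
have finA : mu A \is a fin_num.
  have := integrable_fin_num measurableT IA.
  by rewrite /= integral_indic// setIT.
have finB : mu B \is a fin_num.
  have := integrable_fin_num measurableT IB.
  by rewrite /= integral_indic// setIT.
have mAB : measurable (A `*` B) by exact: measurableX.
have EAB : (\int[(mu \x mu)]_x (\1_(A `*` B) x)%:E = mu A * mu B)%E.
  by rewrite integral_indic// setIT; exact: product_measure1E.
split.
  apply/integrableP; split; first exact/measurable_EFinP.
  under eq_integral do rewrite /= ger0_norm ?indicE//.
  under eq_integral do rewrite -indicE.
  by rewrite EAB ltey_eq fin_numM.
rewrite {1}/Rintegral EAB fineM//.
have -> : avg w2 s2 \1_(A `*` B) = avg w s \1_A \* avg w s \1_B.
  apply/funext => r; rewrite /avg /s2 big_allpairs /w2 /= mulrACA; congr (_ * _).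
  rewrite mulr_suml; apply: eq_bigr => x _.
  rewrite mulr_sumr; apply: eq_bigr => y _.
  by rewrite !indicE in_setX -mulnb natrM.
have := cvgM lA lB; rewrite /Rintegral.
by rewrite !integral_indic// !setIT => h; exact: h.
Qed.

Lemma equid_continuous2 (g : 'rV[R]_n * 'rV[R]_n -> R) : continuous g ->
  measurable_fun setT g ->
  (forall x, ~ (window x.1 /\ window x.2) -> g x = 0) ->
  equid (mu \x mu)%E w2 s2 g.
Proof.
move=> cg mg g0.
have w2_ge0 : \forall r \near +oo, 0 <= w2 r.
  by apply: filterS w_ge0 => r wr; rewrite mulr_ge0.
pose q k (x : 'rV[R]_n * 'rV[R]_n) : 'rV[R]_n * 'rV[R]_n :=
  (cell_corner k (cell_index k x.1), cell_corner k (cell_index k x.2)).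
apply: (equid_round (mu := (mu \x mu)%E) w2_ge0 (q := q) (C := window `*` window)) => //.
- move=> k f f0.
  apply: (equid_step (idx := fun x => (cell_index k x.1, cell_index k x.2))
    (c := fun p => (cell_corner k p.1, cell_corner k p.2))
    (cs := [seq (x, y) | x <- ibox (k.+1 + k.+1), y <- ibox (k.+1 + k.+1)])
    (C := window `*` window)) => //.
  + by rewrite allpairs_uniq ?ibox_uniq// => -[? ?] [? ?].
  + by move=> x [w1 w2']; apply: allpairs_f; exact: cell_index_window.
  + by move=> x [/= /window_corner ? /window_corner ?].
  + move=> [p p'] [/= wp wp'].
    rewrite (_ : [set x | _] = [set x | cell_index k x = p] `*`
        [set x | cell_index k x = p']); last first.
      by apply/seteqP; split=> [[x y] /= [-> ->]|[x y] /= [-> ->]].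
    by apply: equid_indic_setX; [exact: measurable_cell|exact: measurable_cell|
      exact: cell_equid|exact: cell_equid].
- move=> k x; split=> -[/= h1 h2]; split => /=; try exact/(window_corner k);
    exact/window_corner.
- move=> e e0.
  have := compact_uniform (compact_setX window_compact window_compact) cg e0.
  move=> [dl dl0 dlP].
  have [k kdl] := exists_invn_lt dl0.
  exists k => -[x y] [/= wx wy]; apply: dlP.
    by split=> i; [have /andP[a b] := wx i|have /andP[a b] := wy i];
      rewrite /= in_itv/= a ltW.
  by split; exact: ball_corner.
Qed.

End equid_rV.

(** * Recovering a function from its sums over dilates *)

Section contraction.
Context {R : realType}.

(** Telescoping: 1 / (d+1)^2 <= 1/d - 1/(d+1). *)
Lemma inv_sqr_tail (a N : nat) : (0 < a)%N ->
  \sum_(a <= d < N) (d.+1%:R^-1 : R) ^+ 2 <= a%:R^-1.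
Proof.
move=> a0; have [aN|Na] := leqP a N; last first.
  by rewrite big_geq ?invr_ge0 ?ler0n// ltnW.
apply: (@le_trans _ _ (a%:R^-1 - N%:R^-1)); last by rewrite gerBl invr_ge0.
elim: N aN => [|N ih]; first by rewrite leqn0 => /eqP ->; rewrite big_geq// subrr.
rewrite leq_eqVlt => /predU1P[->|]; first by rewrite big_geq// subrr.
rewrite ltnS => aN; rewrite big_nat_recr//=.
have N0 : 0 < N%:R :> R by rewrite ltr0n (leq_trans a0).
apply: (@le_trans _ _ ((a%:R^-1 - N%:R^-1) + (N%:R^-1 - N.+1%:R^-1))); last first.
  by rewrite addrA subrK.
apply: lerD; first exact: ih.
have -> : N%:R^-1 - N.+1%:R^-1 = N%:R^-1 * N.+1%:R^-1 :> R.
  by rewrite -natr1; field; rewrite !gt_eqF// ltr_wpDl.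
rewrite expr2 ler_wpM2r ?invr_ge0// lef_pV2 ?posrE ?ltr0n ?(leq_trans a0 aN)//.
by rewrite ler_nat.
Qed.

Lemma inv_exp_le (n d : nat) : (2 <= n)%N ->
  (d.+1%:R^-1 : R) ^+ n <= d.+1%:R^-1 ^+ 2.
Proof.
move=> n2; apply: ler_wiXn2l => //.
by rewrite invf_le1 ?ltr0n// ler1n.
Qed.

Lemma inv_exp_ge0 (n d : nat) : 0 <= (d.+1%:R^-1 : R) ^+ n.
Proof. by rewrite exprn_ge0// invr_ge0. Qed.

Lemma inv_exp_tail (n a N : nat) : (2 <= n)%N -> (0 < a)%N ->
  \sum_(a <= d < N) (d.+1%:R^-1 : R) ^+ n <= a%:R^-1.
Proof.
move=> n2 a0; apply: le_trans (inv_sqr_tail N a0).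
by apply: ler_sum => d _; exact: inv_exp_le.
Qed.

(** The first term is at most 1/4 and the remaining ones add up to at most
    1/2. That the bound is below 1 is what makes the contraction work. *)
Lemma inv_exp_sum (n N : nat) : (2 <= n)%N ->
  \sum_(1 <= d < N) (d.+1%:R^-1 : R) ^+ n <= 3 / 4.
Proof.
move=> n2; case: N => [|[|N]]; [by rewrite big_geq//; lra|by rewrite big_geq//; lra|].
rewrite big_ltn//.
apply: (@le_trans _ _ (2^-1 ^+ 2 + 2^-1)); last by rewrite expr2; lra.
by apply: lerD; [exact: inv_exp_le|exact: inv_exp_tail].
Qed.

Definition zeta_partial (n N : nat) : R := \sum_(0 <= d < N) d.+1%:R^-1 ^+ n.

Definition zeta_nat (n : nat) : R := limn (zeta_partial n).

Lemma cvg_zeta n : (2 <= n)%N -> zeta_partial n @ \oo --> zeta_nat n.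
Proof.
move=> n2; apply: nondecreasing_is_cvgn.
  apply/nondecreasing_seqP => N; rewrite /zeta_partial big_nat_recr//=.
  by rewrite lerDl inv_exp_ge0.
exists 2 => _ [N _ <-]; case: N => [|N]; first by rewrite /zeta_partial big_geq.
rewrite /zeta_partial big_ltn//.
have := @inv_exp_sum n N.+1 n2; rewrite invr1 expr1n => h.
by apply: (@le_trans _ _ (1 + 3 / 4)); [rewrite lerD2l|lra].
Qed.

Lemma zeta_gt0 n : (2 <= n)%N -> 0 < zeta_nat n.
Proof.
move=> n2; apply: (@lt_le_trans _ _ 1) => //.
apply: limr_ge; first by apply/cvg_ex; exists (zeta_nat n); exact: cvg_zeta.
near=> N; have N0 : (0 < N)%N by near: N; exists 1%N.
rewrite /zeta_partial big_ltn// invr1 expr1n lerDl.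
by apply: sumr_ge0 => d _; exact: inv_exp_ge0.
Unshelve. all: by end_near. Qed.

Variables (n : nat) (P S : R -> R) (M : R -> nat) (K L : R).
Hypotheses (n2 : (2 <= n)%N)
  (SP : forall r, 0 < r ->
     S r = \sum_(0 <= d < M r) d.+1%:R^-1 ^+ n * P (r / d.+1%:R))
  (PK : forall r, 0 < r -> `|P r| <= K)
  (SL : S r @[r --> +oo] --> L)
  (Moo : forall m, \forall r \near +oo, (m <= M r)%N).

Let c := L / zeta_nat n.
Let E r := P r - c.
Let K0 := K + `|c|.

Let E_bounded r : 0 < r -> `|E r| <= K0.
Proof. by move=> r0; rewrite (le_trans (ler_normB _ _))// lerD2r PK. Qed.

Let K0_ge0 : 0 <= K0.
Proof. exact: le_trans (normr_ge0 _) (E_bounded ltr01). Qed.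

Let defect r := S r - c * zeta_partial n (M r).

Let cvg_defect : defect r @[r --> +oo] --> 0.
Proof.
have z0 := zeta_gt0 n2.
rewrite (_ : 0 = L - c * zeta_nat n); last first.
  by rewrite /c divfK ?subrr// gt_eqF.
apply: cvgB => //; apply: cvgMl_tmp.
apply: (@cvg_comp _ _ _ M (zeta_partial n) _ \oo); last exact: cvg_zeta.
move=> A [m _ mA]; have := Moo m; apply: filterS => r mr.
exact: mA.
Qed.

(** In the sum over d, split at D: for d <= D the argument r/d is still large,
    so that the terms contribute at most (3/4) k; the terms beyond D contribute
    at most K0 / D <= k / 16 by the global bound. *)
Let E_step k : 0 < k -> (\forall r \near +oo, `|E r| <= k) ->
  \forall r \near +oo, `|E r| <= 7 / 8 * k.
Proof.
move=> k0 [r1 [_ r1P]]; pose r0 := Num.max r1 0.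
have r00 : 0 <= r0 by rewrite le_max lexx orbT.
have r0P r : r0 < r -> `|E r| <= k by rewrite gt_max => /andP[/r1P].
pose D := (Num.truncn (16 * K0 / k)).+1.
have D0 : 0 < D%:R :> R by rewrite ltr0n.
have KD : K0 * D%:R^-1 <= k / 16.
  have h0 : 0 <= 16 * K0 / k by rewrite divr_ge0 ?mulr_ge0// ltW.
  have /andP[_ h] := truncn_itv h0.
  rewrite ler_pdivrMr// mulrC; rewrite ltr_pdivrMr// in h.
  move: h; rewrite -/D; nra.
have k16 : 0 < k / 16 by lra.
have dk : \forall r \near +oo, `|defect r| <= k / 16.
  move/cvgrPdist_le : cvg_defect => /(_ _ k16); apply: filterS => r.
  by rewrite sub0r normrN.
near=> r.
have r_gt0 : 0 < r by near: r; exact: nbhs_pinfty_gt.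
have rD : r0 * D%:R < r by near: r; apply: nbhs_pinfty_gt; exact: num_real.
have drk : `|defect r| <= k / 16 by near: r.
have DM : (D < M r)%N by near: r; exact: Moo.
have M0 : (0 < M r)%N by exact: leq_ltn_trans DM.
(* The term d = 1 of the sum, at index 0, is E r itself. *)
have -> : E r = defect r -
    \sum_(1 <= d < M r) d.+1%:R^-1 ^+ n * E (r / d.+1%:R).
  rewrite /defect SP// /zeta_partial mulr_sumr -sumrB big_ltn//.
  rewrite invr1 expr1n !mul1r !mulr1 /E.
  rewrite -[RHS]addrA -sumrB big1 ?addr0// => d _; ring.
apply: (le_trans (ler_normB _ _)).
rewrite (_ : 7 / 8 * k = k / 16 + (3 / 4 * k + k / 16)); last by field.
apply: lerD => //; apply: (le_trans (ler_norm_sum _ _ _)).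
rewrite (big_cat_nat _ (n := D)) ?(ltnW DM)//=; apply: lerD.
  apply: (@le_trans _ _ (\sum_(1 <= d < D) d.+1%:R^-1 ^+ n * k)); last first.
    by rewrite -mulr_suml ler_wpM2r ?(ltW k0)// inv_exp_sum.
  rewrite big_nat [leRHS]big_nat; apply: ler_sum => d /andP[d1 dD].
  rewrite normrM ger0_norm ?inv_exp_ge0// ler_wpM2l ?inv_exp_ge0//.
  apply: r0P; rewrite ltr_pdivlMr ?ltr0n//.
  apply: le_lt_trans rD.
  by rewrite ler_wpM2l// ler_nat.
apply: le_trans KD.
apply: (@le_trans _ _ (\sum_(D <= d < M r) d.+1%:R^-1 ^+ n * K0)); last first.
  by rewrite -mulr_suml mulrC ler_wpM2l// inv_exp_tail.
apply: ler_sum => d _.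
rewrite normrM ger0_norm ?inv_exp_ge0// ler_wpM2l ?inv_exp_ge0//.
by apply: E_bounded; rewrite divr_gt0// ltr0n.
Unshelve. all: by end_near. Qed.

(** Here S(r) = sum_d d^(-n) P(r/d) is known to converge to L, and P is bounded.
    Iterating the gain of a factor 7/8 in an eventual bound of
    P - L / zeta(n) shows that this difference tends to 0. *)
Lemma cvg_contraction : P r @[r --> +oo] --> L / zeta_nat n.
Proof.
have Ek j : \forall r \near +oo, `|E r| <= (7 / 8) ^+ j * (K0 + 1).
  elim: j => [|j ih].
    rewrite expr0 mul1r; near=> r.
    have r_gt0 : 0 < r by near: r; exact: nbhs_pinfty_gt.
    by rewrite (le_trans (E_bounded r_gt0))// lerDl.
  rewrite exprS -mulrA; apply: E_step => //.
  by rewrite mulr_gt0 ?exprn_gt0 ?divr_gt0// ltr_wpDl.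
apply/cvgrPdist_le => e e0.
have : ((7 / 8) ^+ j * (K0 + 1)) @[j --> \oo] --> (0 : R).
  rewrite -(mul0r (K0 + 1)); apply: cvgMr_tmp; apply: cvg_expr.
  by rewrite ger0_norm; lra.
move=> /cvgrPdist_le/(_ _ e0)[j _ /(_ j (leqnn j))] /=.
rewrite sub0r normrN => je; have := Ek j; apply: filterS => r Er.
rewrite distrC (le_trans Er)//.
exact: le_trans (ler_norm _) je.
Unshelve. all: by end_near. Qed.

End contraction.

(** * Primitive vectors and the decomposition of lattice sums *)

Section gcdv.
Context {n : nat}.
Implicit Types v w : 'rV[int]_n.

Definition gcdv v : int := \big[gcdz/0]_(i < n) v 0 i.

Definition primitive v : bool := (v != 0) && (gcdv v == 1).

Lemma gcdv_ge0 v : 0 <= gcdv v.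
Proof. by rewrite /gcdv; elim/big_rec: _. Qed.

Lemma gcdv_dvd v i : (gcdv v %| v 0%R i)%Z.
Proof.
rewrite /gcdv; have := mem_index_enum i; elim: (index_enum _) => // j s ih.
rewrite inE big_cons => /predU1P[->|/ih]; first exact: dvdz_gcdl.
by apply: dvdz_trans; exact: dvdz_gcdr.
Qed.

Lemma gcdvZ (d : nat) v : gcdv (d%:Z *: v) = d%:Z * gcdv v.
Proof.
rewrite /gcdv; under eq_bigr do rewrite mxE.
rewrite (big_morph (fun x => d%:Z * x) (id1 := 0) (op1 := gcdz)) ?mulr0// => x y.
by rewrite -(mulz_gcdr d%:Z).
Qed.

Lemma gcdv_eq0 v : (gcdv v == 0) = (v == 0).
Proof.
apply/eqP/eqP => [g0|->]; last first.
  by rewrite -(scale0r 0) (gcdvZ 0) mul0r.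
apply/rowP => i; rewrite mxE; apply/eqP.
by have := gcdv_dvd v i; rewrite g0 dvd0z.
Qed.

Lemma primitive_gcdv v : v != 0 ->
  exists2 w, primitive w & v = (`|gcdv v|%N)%:Z *: w.
Proof.
move=> v0; have g0 : gcdv v != 0 by rewrite gcdv_eq0.
have gE : (`|gcdv v|%N)%:Z = gcdv v by rewrite gez0_abs// gcdv_ge0.
pose w := \row_i (v 0%R i %/ gcdv v)%Z.
have vE : v = (`|gcdv v|%N)%:Z *: w.
  by apply/rowP => i; rewrite !mxE gE mulrC divzK// gcdv_dvd.
exists w => //.
have : gcdv v = gcdv v * gcdv w by rewrite {1}vE gcdvZ gE.
rewrite -[LHS]mulr1 => /(mulfI g0) w1.
rewrite /primitive -w1 eqxx andbT -gcdv_eq0 -w1 oner_eq0//.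
Qed.

Lemma gcdv_primitiveZ (d : nat) w : primitive w -> gcdv (d%:Z *: w) = d%:Z.
Proof. by move=> /andP[_ /eqP w1]; rewrite gcdvZ w1 mulr1. Qed.

End gcdv.

(** Lattice sums are finite only through the support of the summand, so that
    the enumerated range can be changed as long as it covers the support. *)
Lemma eq_big_support (R : nmodType) (I : eqType) (s1 s2 : seq I) (F : I -> R) :
  uniq s1 -> uniq s2 -> (forall i, F i != 0 -> (i \in s1) = (i \in s2)) ->
  \sum_(i <- s1) F i = \sum_(i <- s2) F i.
Proof.
move=> u1 u2 s12.
have supp s : \sum_(i <- s) F i = \sum_(i <- [seq i <- s | F i != 0]) F i.
  rewrite big_filter [LHS](bigID (fun i => F i != 0))/= [X in _ + X]big1 ?addr0//.
  by move=> i /negPn/eqP.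
rewrite supp [RHS]supp; apply: perm_big; apply: uniq_perm; rewrite ?filter_uniq//.
move=> i; rewrite !mem_filter; have [//|Fi] := eqVneq (F i) 0.
by rewrite s12.
Qed.

Section lattice_sums.
Context {R : realType} {n : nat}.
Implicit Types (P : pred 'rV[int]_n) (g : 'rV[R]_n -> R) (r : R).

Definition scaled r (v : 'rV[int]_n) : 'rV[R]_n := r^-1 *: map_mx intr v.

(** A vector v with v/r in the window has coordinates bounded by 2r. *)
Definition radius (r : R) : nat := (Num.truncn (2 * r)).+1.

Lemma lt_radius r : 0 < r -> 2 * r < (radius r)%:R.
Proof.
by move=> r0; have /andP[] := truncn_itv (ltW (mulr_gt0 (ltr0Sn R 1) r0)).
Qed.

Lemma radius_le r : 0 < r -> (radius r)%:R <= 2 * r + 1.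
Proof.
move=> r0; rewrite /radius -[leLHS]natr1 lerD2r.
by have /andP[] := truncn_itv (ltW (mulr_gt0 (ltr0Sn R 1) r0)).
Qed.

Lemma radius_oo m : \forall r \near +oo, (m <= radius r)%N.
Proof.
near=> r; have r0 : 0 < r by near: r; exact: nbhs_pinfty_gt.
have mr : m%:R < r by near: r; apply: nbhs_pinfty_gt; exact: num_real.
by rewrite -(ler_nat R) (le_trans _ (ltW (lt_radius r0)))//; lra.
Unshelve. all: by end_near. Qed.

Definition lattice_sum P g r : R := \sum_(v <- ibox (radius r) | P v) g (scaled r v).

Lemma scaled_window r v (M : nat) : 0 < r -> 2 * r <= M%:R ->
  window (scaled r v) -> v \in ibox M.
Proof.
move=> r0 rM wv; rewrite mem_ibox; apply/forallP => i.
have := wv i; rewrite !mxE mulrC ler_pdivlMr// ltr_pdivrMr// => /andP[h1 h2].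
have : - M%:Z <= v 0 i <= M%:Z.
  rewrite -!(ler_int R) rmorphN /=; apply/andP; split.
    by apply: le_trans h1; rewrite mulNr lerN2.
  by apply: (le_trans (ltW h2)).
move: (v 0 i) => z; lia.
Qed.

Lemma lattice_sum_widen P g r (M : nat) : 0 < r -> 2 * r <= M%:R ->
  (forall x, ~ window x -> g x = 0) ->
  lattice_sum P g r = \sum_(v <- ibox M | P v) g (scaled r v).
Proof.
move=> r0 rM g0; rewrite /lattice_sum -big_filter -[RHS]big_filter.
apply: eq_big_support; rewrite ?filter_uniq ?ibox_uniq// => v gv.
have wv : window (scaled r v).
  by apply: contrapT => /g0 g00; rewrite g00 eqxx in gv.
by rewrite !mem_filter !(scaled_window r0 _ wv)// ltW// lt_radius.
Qed.

(** Nonzero vectors are grouped by their gcd d: dividing by d identifies those of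
    gcd d at scale r with the primitive vectors at scale r/d. Indices are shifted
    by one, d.+1 running over the possible gcds. *)
Lemma lattice_sum_decomposition g r : 0 < r -> (forall x, ~ window x -> g x = 0) ->
  lattice_sum (fun v => v != 0) g r =
  \sum_(0 <= d < radius r) lattice_sum primitive g (r / d.+1%:R).
Proof.
move=> r0 g0; set M := radius r.
have step d : lattice_sum primitive g (r / d.+1%:R) =
    \sum_(v <- ibox M | (v != 0) && (gcdv v == d.+1%:Z)) g (scaled r v).
  have rd0 : 0 < r / d.+1%:R by rewrite divr_gt0.
  rewrite (@lattice_sum_widen _ _ _ M)//; last first.
    apply: le_trans (ltW (lt_radius r0)); rewrite ler_pM2l//.
    by rewrite ler_pdivrMr// ler_peMr ?ler1n// ltW.
  have sE w : scaled (r / d.+1%:R) w = scaled r (d.+1%:Z *: w).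
    rewrite /scaled map_mxZ scalerA; congr (_ *: _).
    by rewrite invf_div mulrC.
  have inj : injective (fun w : 'rV[int]_n => d.+1%:Z *: w).
    move=> x y /rowP xy; apply/rowP => i.
    by have := xy i; rewrite !mxE => /mulfI; apply.
  rewrite -big_filter -[RHS]big_filter.
  under eq_bigr do rewrite sE.
  rewrite -(big_map (fun w : 'rV[int]_n => d.+1%:Z *: w) xpredT
    (fun v => g (scaled r v))).
  apply: eq_big_support.
  - by rewrite map_inj_uniq// filter_uniq// ibox_uniq.
  - by rewrite filter_uniq// ibox_uniq.
  move=> v gv.
  have wv : window (scaled r v).
    by apply: contrapT => /g0 g00; rewrite g00 eqxx in gv.
  have vM : v \in ibox M by apply: (scaled_window r0 _ wv); rewrite ltW// lt_radius.
  rewrite mem_filter vM andbT; apply/mapP/andP => [[w]|[v0 /eqP vd]].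
    rewrite mem_filter => /andP[pw _] ->; rewrite gcdv_primitiveZ// eqxx; split => //.
    by rewrite -gcdv_eq0 gcdv_primitiveZ.
  have [w pw vE] := primitive_gcdv v0.
  rewrite vd in vE; exists w => //.
  rewrite mem_filter pw /= mem_ibox; apply/forallP => i.
  move: vM; rewrite mem_ibox => /forallP/(_ i); rewrite vE mxE.
  by rewrite abszM; apply: leq_trans; rewrite leq_pmull.
under eq_bigr do rewrite step.
rewrite /lattice_sum.
under [RHS]eq_bigr do rewrite big_mkcondr.
rewrite exchange_big /= big_seq_cond [RHS]big_seq_cond.
apply: eq_bigr => v /andP[vM v0].
have [w _ vE] := primitive_gcdv v0.
pose d := `|gcdv v|%N.
have dE : gcdv v = d%:Z by rewrite /d gez0_abs// gcdv_ge0.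
have d0 : (0 < d)%N by rewrite absz_gt0 gcdv_eq0.
have dM : (d <= M)%N.
  have /existsP[i vi] : [exists i, v 0 i != 0].
    rewrite -negb_forall; apply: contra v0 => /forallP h; apply/eqP/rowP => i.
    by rewrite mxE; exact/eqP.
  move: vM; rewrite mem_ibox => /forallP/(_ i); apply: leq_trans.
  apply: dvdn_leq; first by rewrite absz_gt0.
  exact: gcdv_dvd.
have dM' : (d.-1 < M)%N by rewrite prednK.
rewrite big_mkord (bigD1 (Ordinal (dM' : d.-1 < M)%N))//= prednK// dE eqxx.
rewrite big1 ?addr0// => j jd.
case: eqP => // -[djd]; case/eqP: jd; apply/val_inj => /=; lia.
Qed.

End lattice_sums.

(** * Counting integers in an interval *)

Lemma sum_nat_interval (R : nmodType) (c : R) (a b N : nat) : (a <= b <= N)%N ->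
  \sum_(0 <= j < N) (if (a <= j < b)%N then c else 0) = c *+ (b - a).
Proof.
move=> /andP[ab bN].
rewrite (big_cat_nat _ (n := a)) ?(leq_trans ab)//=.
rewrite big_nat big1 ?add0r; last by move=> j /andP[_ ja]; rewrite leqNgt ja.
rewrite (big_cat_nat _ (n := b))//= [X in _ + X]big_nat [X in _ + X]big1 ?addr0.
  rewrite big_nat (eq_bigr (fun=> c)) => [|j ->//].
  by rewrite -big_nat sumr_const_nat.
by move=> j /andP[bj _]; rewrite ltnNge bj andbF.
Qed.

Lemma cvg_prod (R : realType) (T I : Type) (F : set_system T) (FF : Filter F)
    (s : seq I) (f : I -> T -> R) (a : I -> R) :
  (forall i, f i x @[x --> F] --> a i) ->
  \prod_(i <- s) f i x @[x --> F] --> \prod_(i <- s) a i.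
Proof.
move=> fa; elim: s => [|i s ih].
  by rewrite big_nil; under eq_fun do rewrite big_nil; exact: cvg_cst.
by rewrite big_cons; under eq_fun do rewrite big_cons; exact: cvgM.
Qed.

Lemma cvgV_pinfty (R : realType) : (r^-1 : R) @[r --> +oo] --> (0 : R).
Proof.
apply/cvgrPdist_le => e e0; near=> r.
have r0 : 0 < r by near: r; exact: nbhs_pinfty_gt.
have er : e^-1 < r by near: r; apply: nbhs_pinfty_gt; exact: num_real.
by rewrite sub0r normrN gtr0_norm ?invr_gt0// invf_ple ?posrE// ltW.
Unshelve. all: by end_near. Qed.

Section count.
Context {R : realType}.

Definition count1 (k : nat) (p : int) (r : R) : R :=
  \sum_(j < (radius r + radius r).+1)
    (Num.floor (k.+1%:R * (r^-1 * (j%:Z - (radius r)%:Z)%:~R)) == p)%:R.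

(** The integers j with floor ((k+1) j / r) = p are those of the interval
    [r p / (k+1), r (p+1) / (k+1)), whose number differs from the length
    r / (k+1) by at most 1. The condition on p ensures that this interval is
    inside the range of summation. *)
Lemma cvg_count1 (k : nat) (p : int) : -2 <= (p%:~R : R) / k.+1%:R < 2 ->
  r^-1 * count1 k p r @[r --> +oo] --> (k.+1%:R^-1 : R).
Proof.
move=> pk; apply/cvgrPdist_le => e e0; near=> r.
have r0 : 0 < r by near: r; exact: nbhs_pinfty_gt.
have er : r^-1 <= e.
  rewrite invf_ple ?posrE//; near: r; apply: nbhs_pinfty_ge; exact: num_real.
set M := radius r.
have Mr : 2 * r < M%:R by exact: lt_radius.
have k0 : 0 < k.+1%:R :> R by rewrite ltr0n.
pose A := Num.ceil (r * (p%:~R / k.+1%:R)).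
pose B := Num.ceil (r * ((p + 1)%:~R / k.+1%:R)).
have /andP[A1 A2] := ceil_itv (r * (p%:~R / k.+1%:R)).
have /andP[B1 B2] := ceil_itv (r * ((p + 1)%:~R / k.+1%:R)).
rewrite -/A in A1 A2; rewrite -/B in B1 B2.
have AM : - M%:Z <= A.
  rewrite -(ler_int R) (le_trans _ A2)// intrN -pmulrn.
  have /andP[h _] := pk; have := ler_wpM2l (ltW r0) h.
  by move: Mr; set x := r * (_ / _); set y : R := M%:R => h1 h2; lra.
have pp : (p + 1)%:~R / k.+1%:R <= 2 :> R.
  have /andP[_ h] := pk; rewrite ler_pdivrMr//; rewrite ltr_pdivrMr// in h.
  have -> : 2 * k.+1%:R = (2 * k.+1%:Z)%:~R :> R by rewrite intrM.
  rewrite ler_int -ltzD1 ltrD2r -(ltr_int R) intrM//.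
have AB : A <= B.
  apply: le_ceil; rewrite ler_pM2l// ler_pM2r ?invr_gt0// ler_int lerDl//.
have BM : B <= M%:Z.
  rewrite /B ceil_le_int_tmp (le_trans _ (ltW Mr))// mulrC ler_pM2r//.
have cnt : count1 k p r = (B - A)%:~R.
  rewrite /count1 -/M.
  have -> : (B - A)%:~R = 1 *+ (`|(B + M%:Z)%R| - `|(A + M%:Z)%R|)%N :> R.
    rewrite -[RHS]/((_%:Z)%:~R); congr (_ %:~R); lia.
  rewrite -(@sum_nat_interval _ (1 : R) _ _ (M + M).+1); last by lia.
  rewrite big_mkord; apply: eq_bigr => j _.
  rewrite floor_eq.
  have -> : (p%:~R <= k.+1%:R * (r^-1 * (j%:Z - M%:Z)%:~R) < (p + 1)%:~R) =
    (A <= j%:Z - M%:Z < B).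
    rewrite /A ceil_le_int_tmp [in RHS]ltNge /B ceil_le_int_tmp -ltNge.
    rewrite [k.+1%:R * _]mulrCA ler_pdivlMl// ltr_pdivrMl//.
    by rewrite !mulrA ler_pdivrMr// ltr_pdivlMr// ![_ * k.+1%:R]mulrC.
  rewrite (_ : (A <= j%:Z - M%:Z < B) = (`|(A + M%:Z)%R| <= j < `|(B + M%:Z)%R|)%N).
    by case: ifP.
  lia.
rewrite cnt; apply: le_trans er.
rewrite intrB -(ler_pM2l r0) mulfV ?gt_eqF//.
rewrite -{1}(gtr0_norm r0) -normrM mulrBr mulrA mulfV ?gt_eqF// mul1r.
have E : r * ((p + 1)%:~R / k.+1%:R) = r * (p%:~R / k.+1%:R) + r * k.+1%:R^-1 :> R.
  by rewrite intrD; ring.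
rewrite E in B1 B2; rewrite !intrB in A1 B1.
move: A1 A2 B1 B2; set x := r * (p%:~R / _); set y := r * k.+1%:R^-1.
move=> A1 A2 B1 B2.
by rewrite ler_norml; apply/andP; split; lra.
Unshelve. all: by end_near. Qed.

End count.

(** * Equidistribution of lattice and primitive points on cells *)

Section cell_measure.
Context {R : realType}.
Local Open Scope ereal_scope.

Lemma lebesgue_rV_box n (J : 'I_n -> set R) (h : R) :
  (forall i, measurable (J i)) -> (forall i, lebesgue_measure (J i) = h%:E) ->
  lebesgue_rV [set x : 'rV[R]_n | forall i, J i (x 0%R i)] = (h ^+ n)%:E.
Proof.
have mbox m (J' : 'I_m -> set R) : (forall i, measurable (J' i)) ->
    measurable [set x : 'rV[R]_m | forall i, J' i (x 0%R i)].
  move=> mJ; rewrite (_ : mkset _ = \bigcap_(i in [set: 'I_m])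
    ((fun x : 'rV[R]_m => x 0%R i) @^-1` J' i)); last first.
    apply/seteqP; split => [x /= H i _ /=|x /= H i]; first exact: H.
    exact: H.
  apply: fin_bigcap_measurable => // i _.
  by rewrite -[X in measurable X]setTI; exact: measurable_coord.
elim: n J => [|n ih] J mJ Jh.
  by rewrite /= diracE mem_set// => -[].
rewrite /= /pushforward.
rewrite (_ : _ @^-1` _ = J (lshift n (0%R : 'I_1)) `*`
    [set x : 'rV[R]_n | forall i, J (rshift 1 i) (x 0%R i)]); last first.
  apply/seteqP; split => -[u x] /=.
  - move=> H; split.
      move: (H (lshift n (0%R : 'I_1))).
      by rewrite /rV_cons (@row_mxEl _ 1 1 n) mxE eqxx.
    by move=> i; move: (H (rshift 1 i)); rewrite /rV_cons (@row_mxEr _ 1 1 n).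
  - move=> [uab H] i; rewrite /rV_cons.
    case: (@splitP 1 n i) => j ij.
    + have -> : i = lshift n j by apply/val_inj.
      by rewrite (@row_mxEl _ 1 1 n) mxE ord1 eqxx.
    + have -> : i = rshift 1 j by apply/val_inj.
      by rewrite (@row_mxEr _ 1 1 n).
rewrite product_measure1E; [|exact: mJ|]; last first.
  by apply: (mbox n (fun i => J (rshift 1 i))) => i.
transitivity (lebesgue_measure (J (lshift n (0%R : 'I_1))) *
    lebesgue_rV [set x : 'rV[R]_n | forall i, J (rshift 1 i) (x 0%R i)]) => //.
rewrite Jh (ih (fun i => J (rshift 1 i)))//.
by rewrite -EFinM exprS.
Qed.

Lemma lebesgue_cell n k (p : 'rV[int]_n) :
  lebesgue_rV [set x : 'rV[R]_n | cell_index k x = p] = (k.+1%:R^-1 ^+ n)%:E.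
Proof.
have k0 : (0 < k.+1%:R :> R)%R by rewrite ltr0n.
pose J (i : 'I_n) : set R :=
  `[(p 0 i)%:~R / k.+1%:R, (p 0 i + 1)%:~R / k.+1%:R[%classic%R.
rewrite -(@lebesgue_rV_box n J).
- congr lebesgue_rV; apply/seteqP; split => x /=.
    move=> xp i; rewrite /J /= in_itv/= -xp !mxE.
    rewrite ler_pdivrMr// ltr_pdivlMr// mulrC; exact: floor_itv.
  move=> H; apply/rowP => i; rewrite mxE; apply: floor_def.
  have := H i; rewrite /J /= in_itv/=.
  by rewrite ler_pdivrMr// ltr_pdivlMr// mulrC.
- by move=> i; exact: measurable_itv.
- move=> i; rewrite lebesgue_measure_itv/= lte_fin ltr_pM2r ?invr_gt0//.
  rewrite ltr_int ltrDl ltr01 -EFinB; congr EFin.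
  by rewrite intrD; ring.
Qed.

End cell_measure.

Section lattice_equid.
Context {R : realType} {n : nat}.

Definition points (P : pred 'rV[int]_n) (r : R) : seq 'rV[R]_n :=
  [seq scaled r v | v <- ibox (radius r) & P v].

Definition weight (c r : R) : R := c * r^-1 ^+ n.

Lemma avg_points P c g r :
  avg (weight c) (points P) g r = c * (r^-1 ^+ n * lattice_sum P g r).
Proof. by rewrite /avg /weight /points big_map big_filter mulrA. Qed.

(** A vector is in the cell iff each coordinate is in the right interval, so the
    count of the cell is the product of the counts of its sides. *)
Lemma cvg_lattice_cell k (p : 'rV[int]_n) : window (cell_corner k p : 'rV[R]_n) ->
  r^-1 ^+ n * lattice_sum xpredT (\1_[set x : 'rV[R]_n | cell_index k x = p]) r
    @[r --> +oo] --> (k.+1%:R^-1 : R) ^+ n.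
Proof.
move=> wp.
have E r : r^-1 ^+ n * lattice_sum xpredT (\1_[set x : 'rV[R]_n | cell_index k x = p]) r =
    \prod_(i < n) (r^-1 * count1 k (p 0 i) r).
  rewrite big_split prodr_const card_ord; congr (_ * _).
  rewrite /count1 bigA_distr_bigA /lattice_sum /ibox big_map big_enum /=.
  apply: eq_bigr => f _; rewrite indicE.
  have -> : (scaled r (\row_i ((f i : nat)%:Z - (radius r)%:Z)) \in
      [set x : 'rV[R]_n | cell_index k x = p]) =
    [forall i, Num.floor (k.+1%:R * (r^-1 * ((f i : nat)%:Z - (radius r)%:Z)%:~R))
       == p 0 i].
    apply/idP/forallP => [|h].
      by rewrite inE /= => <- i; rewrite !mxE.
    by rewrite inE /=; apply/rowP => i; rewrite !mxE; apply/eqP; exact: h.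
  set b := [forall i, _]; have [/forallP h|/forallPn[i hi]] := boolP b.
    by rewrite big1// => i _; rewrite h.
  by rewrite (bigD1 i)//= (negbTE hi) mul0r.
under eq_fun do rewrite E.
rewrite (_ : k.+1%:R^-1 ^+ n = \prod_(i < n) k.+1%:R^-1); last first.
  by rewrite prodr_const card_ord.
apply: cvg_prod => i; apply: cvg_count1.
by have := wp i; rewrite mxE.
Qed.

Lemma lattice_cell_equid k (p : 'rV[int]_n) : window (cell_corner k p : 'rV[R]_n) ->
  equid (@lebesgue_rV R n) (weight 1) (points xpredT)
    \1_[set x : 'rV[R]_n | cell_index k x = p].
Proof.
move=> wp; have mC := @measurable_cell R n k p; split.
  apply/integrableP; split; first exact/measurable_EFinP.
  under eq_integral do rewrite /= ger0_norm ?indicE//.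
  under eq_integral do rewrite -indicE.
  by rewrite integral_indic// setIT [X in (X < _)%E]lebesgue_cell ltry.
rewrite /Rintegral integral_indic// setIT [X in fine X]lebesgue_cell /=.
under eq_fun do rewrite avg_points mul1r.
exact: cvg_lattice_cell.
Qed.

(** The a priori bound for the contraction, valid for all r > 0 and not only for
    large r because the scales r/d become small. For r < 1/2 the window
    contains no nonzero point of the scaled lattice; for r >= 1/2 the sum has at
    most (4r + 3)^n <= (10 r)^n terms. *)
Lemma primitive_bounded g K : (forall x, `|g x| <= K) ->
  (forall x : 'rV[R]_n, ~ window x -> g x = 0) ->
  forall r, 0 < r -> `|r^-1 ^+ n * lattice_sum primitive g r| <= 10 ^+ n * K.
Proof.
move=> gK g0 r r0.
have K0 : 0 <= K := le_trans (normr_ge0 _) (gK 0).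
have [r2|r2] := ltP r (1 / 2).
  rewrite /lattice_sum big_seq_cond big1 ?mulr0 ?normr0 ?mulr_ge0 ?exprn_ge0//.
  move=> v /andP[_ /andP[v0 _]]; apply: g0 => wv.
  have /existsP[i vi] : [exists i, v 0 i != 0].
    rewrite -negb_forall; apply: contra v0 => /forallP h; apply/eqP/rowP => i.
    by rewrite mxE; exact/eqP.
  have := wv i; rewrite !mxE mulrC ler_pdivlMr// ltr_pdivrMr// => /andP[h1 h2].
  have : v 0 i < 1 by rewrite -(ltr_int R); lra.
  have : -1 < v 0 i by rewrite -(ltr_int R) intrN; lra.
  by move: (v 0 i) vi => z; lia.
rewrite normrM ger0_norm ?exprn_ge0 ?invr_ge0 ?(ltW r0)//.
have Mr := radius_le r0.
apply: (@le_trans _ _ (r^-1 ^+ n * (((radius r + radius r).+1)%:R ^+ n * K))).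
  rewrite ler_wpM2l ?exprn_ge0 ?invr_ge0 ?(ltW r0)//.
  apply: (le_trans (ler_norm_sum _ _ _)).
  apply: (@le_trans _ _ (\sum_(v <- ibox (radius r)) K)).
    rewrite big_mkcond; apply: ler_sum => v _; by case: ifP.
  rewrite big_const_seq count_predT iter_addr_0 size_map -cardE card_ffun !card_ord.
  by rewrite -[leLHS]mulr_natl natrX.
rewrite mulrA -exprMn ler_wpM2r// lerXn2r ?nnegrE ?mulr_ge0 ?invr_ge0 ?(ltW r0)//.
rewrite mulrC ler_pdivrMr// -natr1 natrD; lra.
Qed.

(** The count of nonzero lattice points has the same limit as that of all
    lattice points, since the origin has weight r^(-n). *)
Lemma primitive_cell_equid k (p : 'rV[int]_n) : (2 <= n)%N ->
  window (cell_corner k p : 'rV[R]_n) ->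
  equid (@lebesgue_rV R n) (weight (zeta_nat n)) (points primitive)
    \1_[set x : 'rV[R]_n | cell_index k x = p].
Proof.
move=> n2 wp; split; first exact: (lattice_cell_equid wp).1.
have := (lattice_cell_equid wp).2.
set g := \1_ _; set L := (\int[_]_x _)%R => SL.
have g0 x : ~ window x -> g x = 0.
  move=> nwx; rewrite /g indicE memNset//= => xp; apply: nwx.
  by apply/(window_corner k); rewrite xp.
have z0 : 0 < zeta_nat n :> R by exact: zeta_gt0.
pose S r := r^-1 ^+ n * lattice_sum (fun v => v != 0) g r.
have SL' : S r @[r --> +oo] --> L.
  have -> : S = fun r => avg (weight 1) (points xpredT) g r - r^-1 ^+ n * g 0.
    apply/funext => r; rewrite avg_points mul1r -mulrBr /S; congr (_ * _).
    rewrite /lattice_sum [in RHS](bigD1_seq 0) ?ibox_uniq//=.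
      by rewrite /scaled map_mx0 scaler0 addrAC subrr add0r.
    by rewrite mem_ibox; apply/forallP => i; rewrite mxE.
  rewrite -[X in _ --> X]subr0; apply: cvgB => //.
  rewrite -(mul0r (g 0)); apply: cvgMr_tmp.
  have -> : 0 = 0 ^+ n :> R by rewrite expr0n gtn_eqF// (ltn_trans _ n2).
  by apply: cvg_exprn; exact: cvgV_pinfty.
have := @cvg_contraction R n (fun r => r^-1 ^+ n * lattice_sum primitive g r) S
  (@radius R) (10 ^+ n * 1) L n2 _ _ SL' (@radius_oo R).
have gb x : `|g x| <= 1 by rewrite /g indicE; case: (_ \in _); rewrite ?normr1 ?normr0.
move=> H; under eq_fun do rewrite avg_points.
rewrite (_ : L = zeta_nat n * (L / zeta_nat n)); last first.
  by rewrite mulrC divfK// gt_eqF.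
apply: cvgMl_tmp; apply: H; last exact: primitive_bounded.
move=> r r0; rewrite /S (lattice_sum_decomposition r0 g0) mulr_sumr.
apply: eq_bigr => d _; rewrite mulrA -exprMn invf_div.
by rewrite (mulrA d.+1%:R^-1) mulVf ?mul1r// pnatr_eq0.
Qed.

End lattice_equid.

(** * Balls and Borel sets *)

Lemma cvg_fin_sum (R : realType) (T I : Type) (F : set_system T)
    (FF : Filter F) (s : seq I) (f : I -> T -> R) (a : I -> R) :
  (forall i, f i x @[x --> F] --> a i) ->
  \sum_(i <- s) f i x @[x --> F] --> \sum_(i <- s) a i.
Proof.
move=> fa; elim: s => [|i s ih].
  by rewrite big_nil; under eq_fun do rewrite big_nil; exact: cvg_cst.
by rewrite big_cons; under eq_fun do rewrite big_cons; exact: cvgD.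
Qed.

Section topology_rV.
Context {R : realType} {n : nat}.

Lemma continuous_enorm : continuous (@enorm R n).
Proof.
move=> x; rewrite /enorm.
apply: (@continuous_comp _ _ _ (fun x : 'rV[R]_n => \sum_(i < n) x 0 i ^+ 2)
  (@Num.sqrt R)); last exact: sqrt_continuous.
apply: (@cvg_fin_sum R _ _ (nbhs x) _) => i.
by apply: (@cvg_exprn R _ (nbhs x) _); exact: coord_continuous.
Qed.

(** An open set is the union of the countably many cells that it contains.
    Rounding maps to nearby points, so that a cell of fine enough mesh fits inside
    any ball. *)
Lemma open_rV_measurable (U : set 'rV[R]_n) : open U -> measurable U.
Proof.
move=> oU.
pose F (kp : nat * 'rV[int]_n) : set 'rV[R]_n :=
  if `[< [set x | cell_index kp.1 x = kp.2] `<=` U >] then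
    [set x | cell_index kp.1 x = kp.2] else set0.
have -> : U = \bigcup_(kp in [set: nat * 'rV[int]_n]) F kp.
  apply/seteqP; split => [x Ux|x [kp _]]; last first.
    by rewrite /F; case: asboolP => // h; exact: h.
  have := oU; rewrite openE => /(_ _ Ux); rewrite /interior => /nbhs_ballP.
  move=> [e /= e0 eU]; have e2 : 0 < e / 2 by rewrite divr_gt0.
  have [k ke] := exists_invn_lt e2.
  exists (k, cell_index k x) => //; rewrite /F asboolT//= => y /= yx.
  apply: eU; rewrite (_ : e = e / 2 + e / 2); last by field.
  apply: (@ball_triangle _ _ (cell_corner k (cell_index k x))).
    exact: ball_corner.
  by apply: ball_sym; rewrite -yx; exact: ball_corner.
apply: countable_bigcupT_measurable => //.
move=> [k p]; rewrite /F; case: asboolP => _; last exact: measurable0.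
exact: measurable_cell.
Qed.

Lemma continuous_rV_measurable (g : 'rV[R]_n -> R) :
  continuous g -> measurable_fun setT g.
Proof.
move=> /continuousP cg; apply: (measurability _ (RGenOpens.measurableE R)).
move=> _ [_ [a [b ->] <-]]; rewrite setTI.
by apply: open_rV_measurable; apply: cg; exact: interval_open.
Qed.

Lemma enorm_window (x : 'rV[R]_n) : enorm x < 2 -> window x.
Proof.
move=> x2 i; have := le_lt_trans (coord_le_enorm x i) x2.
by rewrite ltr_norml => /andP[h1 h2]; rewrite (ltW h1) h2.
Qed.

End topology_rV.

Section ball_volume.
Context {R : realType} (n : nat).
Local Open Scope ereal_scope.

Definition ball_volume : R := fine (lebesgue_rV (@eball R n 1)).

Lemma lebesgue_eball1 : lebesgue_rV (@eball R n 1) = ball_volume%:E.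
Proof.
rewrite fineK// ge0_fin_numE//.
apply: (@le_lt_trans _ _ (((1 - -1) ^+ n)%:E)); last exact: ltry.
rewrite -lebesgue_rV_cube; last exact: le_trans (lerN10 _) ler01.
apply: le_measure; rewrite ?inE//.
- exact: measurable_eball.
- exact: measurable_cube.
- by move=> x /= x1 i; rewrite -ler_norml (le_trans (coord_le_enorm _ _)).
Qed.

Lemma ball_volume_ge0 : (0 <= ball_volume)%R.
Proof. exact: fine_ge0. Qed.

Lemma lebesgue_eball (t : R) : (0 < t)%R ->
  lebesgue_rV (@eball R n t) = (t ^+ n * ball_volume)%:E.
Proof.
move=> t0; have ti0 : (0 < t^-1)%R by rewrite invr_gt0.
have := (@scales_rV_affine R n t^-1 0%R ti0).2 _ (@measurable_eball R n 1).
rewrite lebesgue_eball1 invrK -EFinM => <-.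
congr lebesgue_rV; apply/seteqP; split => x; rewrite /eball/= addr0 enormZ;
  by rewrite gtr0_norm// ler_pdivrMl// mulr1.
Qed.

Lemma ball_volume_gt0 : (0 < n)%N -> (0 < ball_volume)%R.
Proof.
move=> n0; rewrite lt_neqAle ball_volume_ge0 andbT eq_sym; apply/eqP => v0.
have := sphere_measure_esphere R n0; rewrite /sphere_measure.
rewrite -[fine _]/ball_volume v0 invr0 mul0e => /eqP.
by rewrite eq_sym onee_eq0.
Qed.

End ball_volume.

(** * Radial functions and balls *)

Section radial_functions.
Context {R : realType} {n : nat}.
Variables (f : 'rV[R]_n -> R) (c : R).
Hypothesis cf : {within esphere, continuous f}.

Lemma enorm_normalize (x : 'rV[R]_n) : x != 0 -> enorm (normalize x) = 1.
Proof.
move=> x0; have xp : 0 < enorm x by rewrite enorm_gt0.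
by rewrite enormZ gtr0_norm ?invr_gt0// mulVf// gt_eqF.
Qed.

Lemma continuous_radial_extension (x : 'rV[R]_n) : x != 0 ->
  {for x, continuous (radial_extension f c)}.
Proof.
move=> x0; have xp : 0 < enorm x by rewrite enorm_gt0.
have near0 : \forall y \near x, y != 0.
  have : \forall y \near x, 0 < enorm y.
    exact: (cvgr_gt _ (@continuous_enorm R n x) _ xp).
  by apply: filterS => y; rewrite enorm_gt0.
have cn : {for x, continuous (@normalize R n)}.
  apply: (@continuousZ _ _ _ (fun y : 'rV[R]_n => (enorm y)^-1) id).
    by apply: continuousV; [rewrite gt_eqF|exact: continuous_enorm].
  exact: cvg_id.
move/subspace_continuousP : cf => /(_ (normalize x) (enorm_normalize x0)) cfx.
rewrite /prop_for /continuous_at /radial_extension (negbTE x0).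
move=> A /cfx fA; have nA := cn _ fA.
apply: (@filterS _ (nbhs x) _ _ _ _ (filterI near0 nA)) => y [y0 yA].
rewrite /preimage /= /radial_extension (negbTE y0); apply: yA.
exact: enorm_normalize.
Qed.

(** The preimage of an open interval is open away from the origin. *)
Lemma measurable_radial_extension :
  measurable_fun setT (radial_extension f c).
Proof.
apply: (measurability _ (RGenOpens.measurableE R)).
move=> _ [_ [a [b ->] <-]]; rewrite setTI.
set O := `]a, b[%classic.
have mne : measurable [set x : 'rV[R]_n | x != 0].
  rewrite (_ : mkset _ = [set x | 0 < enorm x]); first exact: measurable_enorm_gt0.
  by apply/seteqP; split => x /=; rewrite enorm_gt0.
rewrite -(setIT (_ @^-1` _)) -(setUv [set x : 'rV[R]_n | x != 0]) setIUr.
apply: measurableU.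
  apply: open_rV_measurable; rewrite openE => x [Ox x0]; rewrite /interior /=.
  apply: filterI.
    apply: continuous_radial_extension => //.
    by apply: open_nbhs_nbhs; split; [exact: interval_open|exact: Ox].
  have xp : 0 < enorm x by rewrite enorm_gt0.
  have : \forall y \near x, 0 < enorm y.
    exact: (cvgr_gt _ (@continuous_enorm R n x) _ xp).
  by apply: filterS => y /=; rewrite enorm_gt0.
have [Oc|nOc] := pselect (O c).
  rewrite (_ : _ `&` _ = ~` [set x | x != 0]); first exact: measurableC.
  apply/seteqP; split => x /=; first by move=> [].
  by move=> /negP/negPn/eqP ->; rewrite /radial_extension eqxx.
rewrite (_ : _ `&` _ = set0); first exact: measurable0.
by apply/seteqP; split => x //= [+ /negP/negPn/eqP x0];
  rewrite x0 /radial_extension eqxx.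
Qed.

Lemma radial_extension_bounded : exists2 K, 0 <= K &
  forall x, `|radial_extension f c x| <= K.
Proof.
have csph : compact (@esphere R n).
  apply: (subclosed_compact _ (@window_compact R n)).
    rewrite (_ : esphere = @enorm R n @^-1` [set 1])//.
    by apply: closed_comp; [move=> ? _; exact: continuous_enorm|exact: closed_eq].
  move=> x /= x1 i; rewrite in_itv/= -ler_norml.
  by apply: (le_trans (coord_le_enorm x i)); rewrite x1; lra.
have /compact_bounded[M [_ MP]] := continuous_compact cf csph.
pose K := Num.max (Num.max (M + 1) `|c|) 0.
exists K; first by rewrite le_max lexx orbT.
move=> x; rewrite /radial_extension; have [_|x0] := eqVneq x 0.
  by rewrite !le_max lexx orbT.
rewrite le_max le_max; apply/orP; left; apply/orP; left.
apply: (MP (M + 1)); first by rewrite ltrDl.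
by exists (normalize x) => //; exact: enorm_normalize.
Qed.

End radial_functions.

Section balls.
Context {R : realType} {n : nat}.
Variables (w : R -> R) (s : R -> seq 'rV[R]_n).
Hypothesis w_ge0 : \forall r \near +oo, 0 <= w r.
Hypothesis cell_equid : forall k p,
  window (cell_corner k p : 'rV[R]_n) ->
  equid (@lebesgue_rV R n) w s \1_[set x | cell_index k x = p].
Let mu := @lebesgue_rV R n.
Let V := @ball_volume R n.

Lemma equid_ramp_enorm (a e : R) : a <= 3 / 2 -> 0 < e ->
  equid mu w s (fun x => ramp a e (enorm x)).
Proof.
move=> a2 e0; have cr : continuous (fun x : 'rV[R]_n => ramp a e (enorm x)).
  move=> x; apply: (@continuous_comp _ _ _ (@enorm R n) (ramp a e)).
    exact: continuous_enorm.
  exact: continuous_ramp.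
apply: equid_continuous => //; first exact: continuous_rV_measurable.
move=> x nwx; apply: ramp_eq0 => //; rewrite leNgt; apply/negP => xa.
by apply: nwx; apply: enorm_window; lra.
Qed.

Let gauge := equid_gauge w_ge0 (@measurable_enorm R n) (@lebesgue_eball R n)
  equid_ramp_enorm.

Lemma equid_eball : equid mu w s \1_(eball 1).
Proof.
apply: gauge; first by apply: measurable_indic; exact: measurable_eball.
move=> x; rewrite lexx andbT !indicE ler_nat.
case: (x \in _) / idP => //; rewrite inE /= => x1.
by rewrite mem_set// /eball /= ltW.
Qed.

Lemma equid_open_ball : equid mu w s \1_[set x | enorm x < 1].
Proof.
apply: gauge.
  apply: measurable_indic.
  rewrite (_ : mkset _ = @enorm R n @^-1` `]-oo, 1[); last first.
    by apply/seteqP; split => x /=; rewrite in_itv.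
  by rewrite -[X in measurable X]setTI; exact: measurable_enorm.
move=> x; rewrite lexx /= !indicE ler_nat.
case: (x \in _) / idP => //; rewrite inE /= => x1.
by rewrite mem_set//= ltW.
Qed.

Lemma Rintegral_eball (t : R) : 0 < t ->
  \int[mu]_x \1_(eball t) x = t ^+ n * V.
Proof.
move=> t0; rewrite /Rintegral integral_indic//; last exact: measurable_eball.
by rewrite setIT [X in fine X](lebesgue_eball n t0).
Qed.

Lemma integrable_eball (t : R) : 0 < t ->
  mu.-integrable setT (EFin \o \1_(eball t)).
Proof.
move=> t0; have mB := @measurable_eball R n t.
apply/integrableP; split; first exact/measurable_EFinP.
under eq_integral do rewrite /= ger0_norm ?indicE//.
under eq_integral do rewrite -indicE.
by rewrite integral_indic// setIT [X in (X < _)%E](lebesgue_eball n t0) ltry.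
Qed.

(** The function x |-> f(x/|x|) has a discontinuity at the origin and its
    restriction to the ball has another at the sphere. The continuous cutoff
    [chi e] removes both: it is supported in e <= |x| <= 1 and equals 1 for
    2e <= |x| <= 1 - e. With K a bound of |f|, the error is at most
    K (1_B - chi e), where B is the unit ball and the integral of 1_B - chi e is
    at most (1 - (1 - e)^n + (2e)^n) V. *)
Lemma equid_radial_extension (f : 'rV[R]_n -> R) (c : R) : (0 < n)%N ->
  {within esphere, continuous f} ->
  equid mu w s (fun x => \1_(eball 1) x * radial_extension f c x).
Proof.
move=> n0 cf; set F := radial_extension f c.
have mF : measurable_fun setT F by exact: measurable_radial_extension.
have [K K0 FK] := radial_extension_bounded c cf; rewrite -/F in FK.
pose chi e (x : 'rV[R]_n) := ramp 1 e (enorm x) * (1 - ramp (2 * e) e (enorm x)).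
have cchi e : continuous (chi e).
  have cr a : continuous (fun x : 'rV[R]_n => ramp a e (enorm x)).
    move=> x; apply: (@continuous_comp _ _ _ (@enorm R n) (ramp a e)).
      exact: continuous_enorm.
    exact: continuous_ramp.
  move=> x; apply: (@continuousM R _ (fun x : 'rV[R]_n => ramp 1 e (enorm x))
    (fun x : 'rV[R]_n => 1 - ramp (2 * e) e (enorm x))); first exact: cr.
  apply: (@continuousB R R^o _ (cst 1)
    (fun x : 'rV[R]_n => ramp (2 * e) e (enorm x))); last exact: cr.
  exact: cst_continuous.
have chi0 e x : 0 < e -> enorm x <= e -> chi e x = 0.
  by move=> e0 xe; rewrite /chi [X in 1 - X]ramp_eq1// ?subrr ?mulr0//; lra.
have chi_out e x : 0 < e -> 1 <= enorm x -> chi e x = 0.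
  by move=> e0 x1; rewrite /chi ramp_eq0// mul0r.
have chi01 e x : 0 <= chi e x <= 1.
  have /andP[h1 h2] := ramp01 1 e (enorm x).
  have /andP[h3 h4] := ramp01 (2 * e) e (enorm x).
  by rewrite /chi; apply/andP; split; nra.
have chi1 e x : 0 < e -> 2 * e <= enorm x <= 1 - e -> chi e x = 1.
  by move=> e0 /andP[h1 h2]; rewrite /chi ramp_eq1// ramp_eq0// subr0 mulr1.
have chi_window e x : 0 < e -> ~ window x -> chi e x = 0.
  move=> e0 nwx; apply: chi_out => //; rewrite leNgt; apply/negP => xa.
  by apply: nwx; apply: enorm_window; lra.
have echi e : 0 < e -> equid mu w s (chi e).
  move=> e0; apply: equid_continuous => //; last by move=> x; exact: chi_window.
  exact: continuous_rV_measurable.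
have echiF e : 0 < e -> equid mu w s (fun x => chi e x * F x).
  move=> e0; apply: equid_continuous => //; last first.
  - by move=> x nwx; rewrite chi_window// mul0r.
  - apply: measurable_funM => //; exact: continuous_rV_measurable.
  move=> x; have [->|x0] := eqVneq x 0; last first.
    by apply: (@continuousM R _ (chi e) F); [exact: cchi|
      exact: continuous_radial_extension].
  rewrite /continuous_at chi0// ?enorm0 ?ltW// mul0r.
  apply: (@cvg_near_cst _ _ _ _ (nbhs (0 : 'rV[R]_n)) _).
  have small : \forall y \near (0 : 'rV[R]_n), enorm y < e.
    by apply: (cvgr_lt _ (@continuous_enorm R n 0)); rewrite enorm0.
  by apply: (@filterS _ (nbhs (0 : 'rV[R]_n)) _ _ _ _ small) => y ye; rewrite chi0 ?mul0r// ltW.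
have m1 : measurable_fun setT (\1_(@eball R n 1) : _ -> R).
  by apply: measurable_indic; exact: measurable_eball.
apply: equid_sandwich => //; first exact: measurable_funM.
move=> e e0.
have [t [t0 t4 te]] : exists t : R, [/\ 0 < t, t < 1 / 4 &
    2 * K * V * (1 - (1 - t) ^+ n + (2 * t) ^+ n) <= e].
  have : 2 * K * V * (1 - (1 - t) ^+ n + (2 * t) ^+ n) @[t --> (0 : R)] -->
      2 * K * V * (1 - (1 - 0) ^+ n + (2 * 0) ^+ n).
    apply: cvgMl_tmp; apply: cvgD.
      apply: cvgB; first exact: cvg_cst.
      by apply: cvg_exprn; apply: cvgB; [exact: cvg_cst|exact: cvg_id].
    by apply: cvg_exprn; apply: cvgMl_tmp; exact: cvg_id.
  rewrite subr0 expr1n subrr mulr0 expr0n gtn_eqF//= addr0 mulr0.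
  move=> /cvgrPdist_le/(_ _ e0) [/= z z0 zP].
  exists (Num.min (z / 2) (1 / 8)).
  have h0 : 0 < Num.min (z / 2) (1 / 8) by rewrite lt_min !divr_gt0.
  split => //; first by rewrite gt_min; apply/orP; right; lra.
  rewrite (le_trans (ler_norm _))//.
  rewrite -normrN -sub0r; apply: zP => /=.
  rewrite sub0r normrN gtr0_norm// gt_min; apply/orP; left; lra.
pose D x := \1_(eball 1) x - chi t x.
have eD : equid mu w s D by apply: equidB; [exact: equid_eball|exact: echi].
exists (fun x => chi t x * F x - K * D x), (fun x => chi t x * F x + K * D x).
have eKD := equidZ K eD.
split.
- by apply: equidB => //; exact: echiF.
- by apply: equidD => //; exact: echiF.
- move=> x; have D0 : 0 <= D x.
    rewrite /D indicE; have [xB|xB] := pselect (eball 1 x).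
      by rewrite mem_set//= mulr1n subr_ge0; have /andP[] := chi01 t x.
    rewrite memNset// chi_out// ?subrr//.
    by move/negP : xB; rewrite /eball/= -ltNge => /ltW.
  have -> : \1_(eball 1) x * F x = chi t x * F x + D x * F x by rewrite /D; ring.
  have := FK x; rewrite ler_norml => /andP[F1 F2].
  have h1 : 0 <= D x * (K + F x) by rewrite mulr_ge0//; lra.
  have h2 : 0 <= D x * (K - F x) by rewrite mulr_ge0//; lra.
  move: h1 h2; move: (D x) (F x) (chi t x) => u v y h1 h2.
  by apply/andP; split; lra.
- have Ichi := (echiF _ t0).1.
  rewrite RintegralD//; [|exact: eKD.1].
  rewrite RintegralB//; [|exact: eKD.1].
  rewrite (_ : _ - _ = 2 * \int[mu]_x (K * D x)); last by ring.
  rewrite RintegralZl//; last exact: eD.1.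
  apply: le_trans te; rewrite mulrA -[leRHS]mulrA ler_wpM2l ?mulr_ge0//.
  rewrite /D RintegralB//; [|exact: equid_eball.1|exact: (echi _ t0).1].
  rewrite Rintegral_eball// expr1n mul1r.
  suff : (1 - t) ^+ n * V - (2 * t) ^+ n * V <= \int[mu]_x chi t x by nra.
  rewrite -!Rintegral_eball; [|lra|lra].
  have I1 : mu.-integrable setT (EFin \o \1_(eball (1 - t))).
    by apply: integrable_eball; lra.
  have I2 : mu.-integrable setT (EFin \o \1_(eball (2 * t))).
    by apply: integrable_eball; lra.
  rewrite -RintegralB//; apply: le_Rintegral => //.
  + exact: (integrableB measurableT I1 I2).
  + exact: (echi _ t0).1.
  move=> x _; rewrite !indicE; have /andP[c0 c1] := chi01 t x.
  have [h1|h1] := leP (enorm x) (1 - t); last first.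
    rewrite (memNset (A := eball (1 - t)))//; first by case: (_ \in _); rewrite ?mulr0n ?mulr1n; lra.
    by apply/negP; rewrite -ltNge.
  have [h2|h2] := leP (enorm x) (2 * t).
    by rewrite (mem_set (A := eball (2 * t)))//; case: (_ \in _); rewrite ?mulr0n ?mulr1n; lra.
  by rewrite chi1 ?(ltW h2)//; case: (_ \in _); case: (_ \in _); rewrite ?mulr0n ?mulr1n; lra.
Qed.

End balls.

(** * The cone measure on the sphere *)

(** The measure on the sphere is the image under normalization of Lebesgue
    measure on the punctured ball, divided by V. The map [phi] is normalization,
    except that what lies outside the punctured ball is sent to 0, off the
    sphere; the integral over the sphere then becomes one over the punctured
    ball. *)
Section sphere_integral.
Context {R : realType} {n : nat}.
Hypothesis n_gt0 : (0 < n)%N.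
Let mu := @lebesgue_rV R n.
Let V := @ball_volume R n.
Local Open Scope ereal_scope.

Let punctured : set 'rV[R]_n := [set x | (0 < enorm x <= 1)%R].
Let phi (x : 'rV[R]_n) : 'rV[R]_n :=
  if (0 < enorm x <= 1)%R then normalize x else 0%R.

Let measurable_punctured : measurable punctured.
Proof.
rewrite (_ : punctured = eball 1 `&` [set x | (0 < enorm x)%R]).
  by apply: measurableI; [exact: measurable_eball|exact: measurable_enorm_gt0].
by apply/seteqP; split => x; rewrite /punctured /eball /=;
  [move=> /andP[? ?]|move=> [? ?]; apply/andP].
Qed.

Let measurable_phi : measurable_fun setT phi.
Proof.
apply: measurable_fun_ifT => //; last exact: measurable_normalize.
apply: (measurable_fun_bool true); rewrite setTI.
rewrite (_ : _ @^-1` _ = punctured)//.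
Qed.

Let phi_sphere : phi @^-1` esphere = punctured.
Proof.
apply/seteqP; split => x; rewrite /phi /punctured /esphere/=.
  by case: ifP => // _; rewrite enorm0 => /esym/eqP; rewrite oner_eq0.
by move=> h; rewrite h; apply: enorm_normalize; rewrite -enorm_gt0; case/andP: h.
Qed.

Let measurable_esphere : measurable (@esphere R n).
Proof.
rewrite (_ : esphere = @enorm R n @^-1` [set 1%R])//.
by rewrite -[X in measurable X]setTI; exact: measurable_enorm.
Qed.

Let ge0_sphere_integral (h : 'rV[R]_n -> \bar R) : measurable_fun setT h ->
  (forall x, 0 <= h x) ->
  \int[@sphere_measure R n]_(x in esphere) h x =
  (V^-1)%:E * \int[mu]_(x in punctured) h (phi x).
Proof.
move=> mh h0.
have Vi0 : (0 <= V^-1)%R by rewrite invr_ge0 ball_volume_ge0.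
pose m' := mscale (NngNum Vi0)
  (measure_function_pushforward__canonical__measure_function_Measure
    mu measurable_phi).
rewrite (eq_measure_integral m'); last first.
  move=> A mA Asph; rewrite /sphere_measure /m' /mscale/= /pushforward.
  congr (_ * lebesgue_rV _); apply/seteqP; split => x /=.
    by move=> [x0 x1 Ax]; rewrite /phi x0 x1.
  rewrite /phi; case: ifP => [/andP[x0 x1] Ax|_ /Asph]; first by split.
  by rewrite /esphere/= enorm0 => /esym/eqP; rewrite oner_eq0.
rewrite ge0_integral_mscale//; last exact: measurable_funTS.
congr (_ * _).
transitivity (\int[pushforward mu phi]_(x in esphere) h x) => //.
rewrite ge0_integral_pushforward//; last exact: measurable_funTS.
by rewrite phi_sphere.
Qed.

Lemma sphere_integral (f : 'rV[R]_n -> R) (c : R) :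
  {within esphere, continuous f} ->
  (\int[@sphere_measure R n]_(x in esphere) f x)%R =
  (V^-1 * \int[mu]_x (\1_(eball 1) x * radial_extension f c x))%R.
Proof.
move=> cf; set F := radial_extension f c.
have mF : measurable_fun setT F by exact: measurable_radial_extension.
have [K K0 FK] := radial_extension_bounded c cf; rewrite -/F in FK.
have mB := @measurable_eball R n 1.
have IB : mu.-integrable setT (fun x => (\1_(eball 1) x * F x)%:E).
  apply: (@le_integrable _ _ _ mu _ measurableT _
    (fun x => (K%:E * (\1_(eball 1) x)%:E))).
  - by apply/measurable_EFinP; apply: measurable_funM.
  - move=> x _; rewrite -EFinM lee_fin !normrM (ger0_norm K0) mulrC.
    by rewrite ler_wpM2r.
  - by apply: integrableZl => //; exact: integrable_eball.
have m0 : mu [set 0%R] = 0.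
  rewrite (_ : [set 0%R] = [set x : 'rV[R]_n | forall i, (0 <= x 0%R i <= 0)%R]).
    apply: (eq_trans (lebesgue_rV_cube n (lexx 0%R))).
    by rewrite subrr expr0n gtn_eqF.
  apply/seteqP; split => x /=; first by move=> -> i; rewrite mxE lexx.
  by move=> h; apply/rowP => i; apply/eqP; rewrite mxE eq_sym eq_le h.
have ms0 : measurable [set (0%R : 'rV[R]_n)].
  rewrite (_ : [set 0%R] = ~` [set x : 'rV[R]_n | (0 < enorm x)%R]).
    by apply: measurableC; exact: measurable_enorm_gt0.
  by apply/seteqP; split => x /=; rewrite enorm_gt0; [move=> ->; rewrite eqxx|
    move/negP/negPn/eqP].
have E : \int[mu]_x (\1_(eball 1) x * F x)%:E =
    \int[mu]_(x in punctured) (F (phi x))%:E.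
  rewrite (negligible_integral ms0 measurableT IB m0) setTD.
  rewrite integral_mkcond [RHS]integral_mkcond; apply: eq_integral => x _.
  rewrite /patch; have [->|x0] := eqVneq x 0%R.
    rewrite memNset; last by move=> /(_ erefl).
    by rewrite memNset// /punctured/= enorm0 ltxx.
  rewrite mem_set; last by apply/eqP.
  rewrite indicE; have [xB|xB] := pselect (eball 1 x).
    have xp : punctured x by rewrite /punctured/= enorm_gt0 x0.
    rewrite !mem_set// mul1r /phi ifT; last exact: xp.
    rewrite /F /radial_extension (negbTE x0).
    have nx1 := enorm_normalize x0.
    rewrite ifF; last by rewrite -enorm_eq0 nx1 oner_eq0.
    by rewrite {2}/normalize nx1 invr1 scale1r.
  rewrite memNset// mul0r memNset// /punctured/= => /andP[_ x1].
  exact: xB.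
rewrite /Rintegral E.
have -> : \int[@sphere_measure R n]_(x in esphere) (f x)%:E =
    \int[@sphere_measure R n]_(x in esphere) (F x)%:E.
  apply: eq_integral => x; rewrite inE /esphere /= => x1.
  rewrite /F /radial_extension ifF; last by rewrite -enorm_eq0 x1 oner_eq0.
  by rewrite /normalize x1 invr1 scale1r.
have IP : mu.-integrable punctured (fun x => (F (phi x))%:E).
  apply: (@eq_integrable _ _ _ mu _ measurable_punctured
    (fun x => (\1_(eball 1) x * F x)%:E)); last first.
    exact: (integrableS measurableT).
  move=> x; rewrite inE /punctured/= => xp; have /andP[x0 x1] := xp.
  rewrite indicE mem_set// mul1r /phi ifT//.
  rewrite enorm_gt0 in x0; have nx1 := enorm_normalize x0.
  rewrite /F /radial_extension (negbTE x0).
  rewrite ifF; last by rewrite -enorm_eq0 nx1 oner_eq0.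
  by rewrite {2}/normalize nx1 invr1 scale1r.
have Ipos := integrable_pos_fin_num measurable_punctured IP.
have Ineg := integrable_neg_fin_num measurable_punctured IP.
have pE : (fun x => (F (phi x))%:E)^\+ =
    (fun x => (fun y => (F y)%:E)^\+ (phi x)) by exact: (funepos_comp (EFin \o F) phi).
have nE : (fun x => (F (phi x))%:E)^\- =
    (fun x => (fun y => (F y)%:E)^\- (phi x)) by exact: (funeneg_comp (EFin \o F) phi).
rewrite pE in Ipos; rewrite nE in Ineg.
(* The change of variables is applied to the positive and negative parts. *)
rewrite integralE [in RHS]integralE pE nE !ge0_sphere_integral//; last 2 first.
- by apply: measurable_funeneg; exact/measurable_EFinP.
- by apply: measurable_funepos; exact/measurable_EFinP.
rewrite -muleBr; last 2 first.
- by [].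
- by apply: fin_num_adde_defr; exact: Ipos.
rewrite fineM; last 2 first.
- by [].
- by rewrite fin_numB; apply/andP; split; [exact: Ipos|exact: Ineg].
by [].
Qed.

End sphere_integral.

(** * Point counts as weighted sums *)

Lemma ncard_sum (R : pzSemiRingType) (U : choiceType) (s : seq U) : uniq s ->
  (ncard [set` s])%:R = \sum_(x <- s) 1 :> R.
Proof.
move=> us; rewrite fsbig_seq// fsbig_finite//=.
by rewrite big_const_seq count_predT iter_addr_0 /ncard.
Qed.

Lemma cvg_near_eq (R : realType) (f g : R -> R) (l : R) :
  f r @[r --> +oo] --> l -> (\forall r \near +oo, f r = g r) ->
  g r @[r --> +oo] --> l.
Proof.
move=> fl fg; apply: cvg_trans fl; apply: near_eq_cvg.
by apply: filterS fg => r ->.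
Qed.

Section point_set.
Context {R : realType} {n : nat}.
Variables (P : pred 'rV[int]_n) (T : set 'rV[R]_n).
Hypothesis TE : T = [set map_mx intr v | v in [set v | P v]].

Let intr_rV (v : 'rV[int]_n) : 'rV[R]_n := map_mx intr v.

Let intr_rV_inj : injective intr_rV.
Proof.
move=> u v /rowP uv; apply/rowP => i; have := uv i; rewrite !mxE => /eqP.
by rewrite eqr_int => /eqP.
Qed.

Definition region (Q : pred 'rV[R]_n) (r : R) : seq 'rV[R]_n :=
  [seq map_mx intr v | v <- ibox (radius r) & P v && Q (scaled r v)].

Lemma region_uniq Q r : uniq (region Q r).
Proof. by rewrite map_inj_uniq// filter_uniq// ibox_uniq. Qed.

Lemma set_region (Q : pred 'rV[R]_n) r : 0 < r ->
  (forall x, Q x -> window x) ->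
  T `&` [set x | Q (r^-1 *: x)] = [set` region Q r].
Proof.
move=> r0 Qw; rewrite TE; apply/seteqP; split => x /=.
  move=> [[v Pv <-] Qv]; apply/mapP; exists v => //.
  rewrite mem_filter Pv Qv /=; apply: (scaled_window r0 _ (Qw _ Qv)).
  by rewrite ltW// lt_radius.
move=> /mapP[v]; rewrite mem_filter => /andP[/andP[Pv Qv] _] ->.
by split => //; exists v.
Qed.

Lemma sum_region (Q : pred 'rV[R]_n) (F : 'rV[R]_n -> R) r :
  \sum_(x <- region Q r) F (r^-1 *: x) =
  lattice_sum P (fun x => (Q x)%:R * F x) r.
Proof.
rewrite /region big_map big_filter /lattice_sum big_mkcondr; apply: eq_bigr => v _.
by case: ifP => _; rewrite ?mul1r ?mul0r.
Qed.

Lemma ncard_region (Q : pred 'rV[R]_n) r : 0 < r ->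
  (forall x, Q x -> window x) ->
  (ncard (T `&` [set x | Q (r^-1 *: x)]))%:R = lattice_sum P (fun x => (Q x)%:R) r :> R.
Proof.
move=> r0 Qw; rewrite set_region// ncard_sum ?region_uniq//.
rewrite (sum_region Q (fun=> 1)); congr lattice_sum.
by apply/funext => x; rewrite mulr1.
Qed.

Lemma enorm_scale_le r (x : 'rV[R]_n) : 0 < r ->
  (enorm (r^-1 *: x) <= 1) = (enorm x <= r).
Proof.
by move=> r0; rewrite enormZ gtr0_norm ?invr_gt0// ler_pdivrMl// mulr1.
Qed.

Lemma enorm_scale_lt r (x : 'rV[R]_n) : 0 < r ->
  (enorm (r^-1 *: x) < 1) = (enorm x < r).
Proof.
by move=> r0; rewrite enormZ gtr0_norm ?invr_gt0// ltr_pdivrMl// mulr1.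
Qed.

Lemma radial_extensionZ (f : 'rV[R]_n -> R) c r x : 0 < r ->
  radial_extension f c (r^-1 *: x) = radial_extension f c x.
Proof.
move=> r0; rewrite /radial_extension scaler_eq0 invr_eq0 gt_eqF//=.
case: eqP => // _; congr f; rewrite /normalize enormZ gtr0_norm ?invr_gt0//.
by rewrite scalerA invfM invrK mulrAC mulfV ?mul1r// gt_eqF.
Qed.

Variable c : R.
Hypotheses (c_gt0 : 0 < c) (n_gt0 : (0 < n)%N).
Hypothesis cell_equid : forall k p,
  window (cell_corner k p : 'rV[R]_n) ->
  equid (@lebesgue_rV R n) (@weight R n c) (points P)
    \1_[set x | cell_index k x = p].

Let V := @ball_volume R n.
Let V_gt0 : 0 < V. Proof. exact: ball_volume_gt0. Qed.

Lemma weight_gt0 : \forall r \near +oo, 0 < @weight R n c r.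
Proof.
near=> r; have r0 : 0 < r by near: r; exact: nbhs_pinfty_gt.
by rewrite /weight mulr_gt0// exprn_gt0// invr_gt0.
Unshelve. all: by end_near. Qed.

Lemma weight_ge0 : \forall r \near +oo, 0 <= @weight R n c r.
Proof. by apply: filterS weight_gt0 => r /ltW. Qed.

(** The number of points of T of norm at most r is a sum over T/r of the
    indicator of the unit ball; the weight then cancels in all quotients of
    counts. *)
Lemma ncard_eball r : 0 < r ->
  @weight R n c r * (ncard (T `&` eball r))%:R =
  avg (@weight R n c) (points P) \1_(eball 1) r.
Proof.
move=> r0; rewrite avg_points /weight mulrA; congr (_ * _).
rewrite (_ : eball r = [set x | enorm (r^-1 *: x) <= 1]); last first.
  by apply/seteqP; split => x; rewrite /eball/= enorm_scale_le.
rewrite (@ncard_region (fun x => enorm x <= 1))//; last first.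
  by move=> x x1; apply: enorm_window; lra.
congr lattice_sum; apply/funext => x; rewrite indicE; congr (nat_of_bool _)%:R.
by apply/idP/idP; rewrite inE.
Qed.

Lemma angular_of_equid : angular_condition T.
Proof.
move=> f d cf.
have [_] := equid_radial_extension weight_ge0 cell_equid d n_gt0 cf.
have [_] := equid_eball weight_ge0 cell_equid.
rewrite (Rintegral_eball ltr01) expr1n mul1r -/V => lB lF.
rewrite (sphere_integral n_gt0 d cf).
have lim : (avg (@weight R n c) (points P) \1_(eball 1) r)^-1 *
    avg (@weight R n c) (points P)
      (fun x => \1_(eball 1) x * radial_extension f d x) r @[r --> +oo] -->
    V^-1 * \int[@lebesgue_rV R n]_x (\1_(eball 1) x * radial_extension f d x).
  by apply: cvgM => //; apply: cvgV => //; exact: lt0r_neq0.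
apply: (cvg_near_eq lim); near=> r.
have r0 : 0 < r by near: r; exact: nbhs_pinfty_gt.
have w0 : 0 < @weight R n c r by near: r; exact: weight_gt0.
rewrite -ncard_eball//.
suff -> : avg (@weight R n c) (points P)
    (fun x => \1_(eball 1) x * radial_extension f d x) r =
    @weight R n c r * \sum_(x \in T `&` eball r) radial_extension f d x.
  by rewrite invfM mulrACA mulVf ?mul1r// gt_eqF.
rewrite avg_points /weight mulrA; congr (_ * _).
rewrite (_ : eball r = [set x | enorm (r^-1 *: x) <= 1]); last first.
  by apply/seteqP; split => x; rewrite /eball/= enorm_scale_le.
rewrite (@set_region (fun x => enorm x <= 1))//; last first.
  by move=> x x1; apply: enorm_window; lra.
rewrite -fsbig_seq ?region_uniq//.
under [RHS]eq_bigr do rewrite -(radial_extensionZ f d _ r0).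
rewrite sum_region; congr lattice_sum; apply/funext => x; rewrite indicE.
congr (_ %:R * _); congr nat_of_bool.
by apply/idP/idP; rewrite inE.
Unshelve. all: by end_near. Qed.

(** Both counts have the same weighted limit L > 0, with weights c (r l)^(-n) and
    c r^(-n); the quotient of the weights is the factor l^n. *)
Lemma radial_of_equid : radial_condition T.
Proof.
move=> l l0.
have [Io] := equid_open_ball weight_ge0 cell_equid.
set L := (\int[_]_x _)%R => lB.
have L0 : L != 0.
  have h2 : 0 < 1 / 2 :> R by rewrite divr_gt0.
  apply: lt0r_neq0; apply: (@lt_le_trans _ _ ((1 / 2) ^+ n * V)).
    by rewrite mulr_gt0// exprn_gt0.
  rewrite -(Rintegral_eball h2); apply: le_Rintegral => //.
    exact: integrable_eball.
  move=> x _; rewrite !indicE ler_nat; case: (boolP (x \in eball _)) => //.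
  by rewrite inE /eball /= => xh; rewrite mem_set//=; lra.
have cnt r : 0 < r -> @weight R n c r * (radial_count T r)%:R =
    avg (@weight R n c) (points P) \1_[set x | enorm x < 1] r.
  move=> r0; rewrite avg_points /weight mulrA; congr (_ * _).
  rewrite /radial_count.
  rewrite (_ : [set x | enorm x < r] = [set x | enorm (r^-1 *: x) < 1]); last first.
    by apply/seteqP; split => x /=; rewrite enorm_scale_lt.
  rewrite (@ncard_region (fun x => enorm x < 1))//; last first.
    by move=> x x1; apply: enorm_window; lra.
  congr lattice_sum; apply/funext => x; rewrite indicE; congr (nat_of_bool _)%:R.
  by apply/idP/idP; rewrite inE.
have lB' : avg (@weight R n c) (points P) \1_[set x | enorm x < 1] (r * l)
    @[r --> +oo] --> L.
  move=> A /lB[M [_ MP]]; exists (M / l); split; first exact: num_real.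
  by move=> r Mr; apply: MP; rewrite -ltr_pdivrMr.
have lim : l ^+ n * (avg (@weight R n c) (points P) \1_[set x | enorm x < 1] (r * l)
    * (avg (@weight R n c) (points P) \1_[set x | enorm x < 1] r)^-1)
    @[r --> +oo] --> l ^+ n * (L * L^-1).
  by apply: cvgMl_tmp; apply: cvgM => //; apply: cvgV.
rewrite mulfV// mulr1 in lim.
apply: (cvg_near_eq lim); near=> r.
have r0 : 0 < r by near: r; exact: nbhs_pinfty_gt.
have rl0 : 0 < r * l by rewrite mulr_gt0.
rewrite -!cnt// /weight !invfM.
set a := (radial_count T (r * l))%:R; set b := (radial_count T r)%:R^-1.
rewrite exprMn !exprVn; field.
by rewrite !expf_eq0 !gt_eqF// !andbF.
Unshelve. all: by end_near. Qed.

End point_set.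

(** * Close pairs *)

Section pair_gauge.
Context {R : realType} {n : nat}.
Implicit Types (l t : R) (p : 'rV[R]_n * 'rV[R]_n).
Let mu := @lebesgue_rV R n.
Let V := @ball_volume R n.

(** The homogeneous function whose sublevel set at 1 is [close_pairs l]. *)
Definition pair_gauge l p : R :=
  Num.max (Num.max (enorm p.1) (enorm p.2)) (enorm (p.1 - p.2) / l).

Definition close_pairs l : set ('rV[R]_n * 'rV[R]_n) :=
  [set p | [/\ enorm p.1 <= 1, enorm p.2 <= 1 & enorm (p.1 - p.2) <= l]].

Definition pair_volume l : R := fine ((mu \x mu)%E (close_pairs l)).

Lemma pair_gauge_le l p : 0 < l -> (pair_gauge l p <= 1) =
  [&& enorm p.1 <= 1, enorm p.2 <= 1 & enorm (p.1 - p.2) <= l].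
Proof. by move=> l0; rewrite !ge_max ler_pdivrMr// mul1r andbA. Qed.

Lemma pair_gaugeZ l t p : 0 < t ->
  pair_gauge l (t *: p.1, t *: p.2) = t * pair_gauge l p.
Proof.
move=> t0; rewrite /pair_gauge /= -scalerBr !enormZ gtr0_norm// -mulrA.
by rewrite -!maxr_pMr// ltW.
Qed.

Lemma measurable_pair_dist :
  measurable_fun setT (fun p : 'rV[R]_n * 'rV[R]_n => enorm (p.1 - p.2)).
Proof.
apply: measurableT_comp; first exact: measurable_enorm.
apply/measurable_fun_coordP => i; under eq_fun do rewrite !mxE.
apply: measurable_funB.
  exact: (measurableT_comp (measurable_coord i) measurable_fst).
exact: (measurableT_comp (measurable_coord i) measurable_snd).
Qed.

Lemma measurable_pair_gauge l : measurable_fun setT (pair_gauge l).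
Proof.
have m1 : measurable_fun setT (fun p : 'rV[R]_n * 'rV[R]_n => enorm p.1).
  exact: (measurableT_comp (@measurable_enorm R n) measurable_fst).
have m2 : measurable_fun setT (fun p : 'rV[R]_n * 'rV[R]_n => enorm p.2).
  exact: (measurableT_comp (@measurable_enorm R n) measurable_snd).
apply: measurable_maxr; first exact: measurable_maxr.
by apply: measurable_funM => //; exact: measurable_pair_dist.
Qed.

Lemma measurable_close_pairs l : measurable (close_pairs l).
Proof.
rewrite (_ : close_pairs l = (eball 1 `*` eball 1) `&`
    (fun p : 'rV[R]_n * 'rV[R]_n => enorm (p.1 - p.2)) @^-1` `]-oo, l]).
  apply: measurableI; first by apply: measurableX; exact: measurable_eball.
  by rewrite -[X in measurable X]setTI; exact: measurable_pair_dist.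
by apply/seteqP; split=> p; rewrite /close_pairs /eball /= in_itv /=;
  [move=> [? ? ?]|move=> [[? ?] ?]].
Qed.

Lemma continuous_pair_gauge l : continuous (pair_gauge l).
Proof.
move=> p.
have c1 : {for p, continuous (fun q : 'rV[R]_n * 'rV[R]_n => enorm q.1)}.
  by apply: (@continuous_comp _ _ _ fst (@enorm R n));
    [exact: cvg_fst|exact: continuous_enorm].
have c2 : {for p, continuous (fun q : 'rV[R]_n * 'rV[R]_n => enorm q.2)}.
  by apply: (@continuous_comp _ _ _ snd (@enorm R n));
    [exact: cvg_snd|exact: continuous_enorm].
have c3 : {for p, continuous (fun q : 'rV[R]_n * 'rV[R]_n => enorm (q.1 - q.2) / l)}.
  apply: cvgMr_tmp.
  apply: (@continuous_comp _ _ _ (fun q : 'rV[R]_n * 'rV[R]_n => q.1 - q.2)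
    (@enorm R n)); last exact: continuous_enorm.
  by apply: continuousB; [exact: cvg_fst|exact: cvg_snd].
exact: (continuous_max (continuous_max c1 c2) c3).
Qed.

Lemma pair_gauge_volume l t : 0 < l -> 0 < t ->
  (mu \x mu)%E [set p | pair_gauge l p <= t] =
  (t ^+ (n + n) * pair_volume l)%:E.
Proof.
move=> l0 t0; have ti0 : 0 < t^-1 by rewrite invr_gt0.
have E1 : [set p | pair_gauge l p <= 1] = close_pairs l.
  apply/seteqP; split => p; rewrite /close_pairs/= pair_gauge_le//.
    by move=> /and3P[].
  by move=> [? ? ?]; apply/and3P.
have fin1 : (mu \x mu)%E (close_pairs l) = (pair_volume l)%:E.
  rewrite fineK// ge0_fin_numE//.
  apply: (@le_lt_trans _ _ ((mu \x mu)%E (eball 1 `*` eball 1))).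
    apply: le_measure; rewrite ?inE.
    - exact: measurable_close_pairs.
    - by apply: measurableX; exact: measurable_eball.
    - by move=> p [].
  rewrite product_measure1E; [|exact: measurable_eball|exact: measurable_eball].
  by rewrite [X in (X * X)%E](lebesgue_eball1 n) -EFinM ltry.
have sc : scales (mu \x mu)%E (t ^+ n * t ^+ n)
    (fun p : 'rV[R]_n * 'rV[R]_n => (t^-1 *: p.1 + 0, t^-1 *: p.2 + 0)).
  apply: (scales_prod_skewl (m1 := mu) (m2 := mu)
    (S1 := fun x => t^-1 *: x + 0) (S2 := fun _ x => t^-1 *: x + 0)).
  - by rewrite exprn_ge0// ltW.
  - by rewrite exprn_ge0// ltW.
  - by have := @scales_rV_affine R n t^-1 0 ti0; rewrite invrK.
  - by move=> _; have := @scales_rV_affine R n t^-1 0 ti0; rewrite invrK.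
  - apply/measurable_fun_pairP; split => /=.
      exact: (measurableT_comp (measurable_rV_affine _ _) measurable_fst).
    exact: (measurableT_comp (measurable_rV_affine _ _) measurable_snd).
have := sc.2 _ (measurable_close_pairs l).
rewrite fin1 -EFinM exprD => <-; congr (product_measure1 _ _ _).
rewrite -E1; apply/seteqP; split => p /=;
  by rewrite !addr0 pair_gaugeZ// ler_pdivrMl// mulr1.
Qed.

Variables (w : R -> R) (s : R -> seq 'rV[R]_n).
Hypothesis w_ge0 : \forall r \near +oo, 0 <= w r.
Hypothesis cell_equid : forall k (q : 'rV[int]_n),
  window (cell_corner k q : 'rV[R]_n) ->
  equid mu w s \1_[set x | cell_index k x = q].

Lemma equid_close_pairs l : 0 < l ->
  equid (mu \x mu)%E (fun r => w r * w r)
    (fun r => [seq (x, y) | x <- s r, y <- s r]) \1_(close_pairs l).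
Proof.
move=> l0.
have w2_ge0 : \forall r \near +oo, 0 <= w r * w r.
  by apply: filterS w_ge0 => r wr; rewrite mulr_ge0.
apply: (equid_gauge (mu := (mu \x mu)%E) w2_ge0 (N := pair_gauge l)
  (m := (n + n)%N) (V := pair_volume l)).
- exact: measurable_pair_gauge.
- by move=> t t0; exact: pair_gauge_volume.
- move=> a e a2 e0.
  apply: (equid_continuous2 w_ge0 cell_equid).
  + move=> p; apply: (@continuous_comp _ _ _ (pair_gauge l) (ramp a e)).
      exact: continuous_pair_gauge.
    exact: continuous_ramp.
  + apply: measurableT_comp; last exact: measurable_pair_gauge.
    by apply: continuous_measurable_fun; exact: continuous_ramp.
  + move=> p nwp; apply: ramp_eq0 => //; rewrite leNgt; apply/negP.
    rewrite !gt_max => /andP[/andP[h1 h2] _].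
    by apply: nwp; split; apply: enorm_window; lra.
- by apply: measurable_indic; exact: measurable_close_pairs.
- move=> p; rewrite !indicE !ler_nat; apply/andP; split.
    case: (boolP (p \in _)) => //; rewrite inE /= => /ltW.
    by rewrite pair_gauge_le// => /and3P[? ? ?]; rewrite mem_set.
  case: (boolP (p \in close_pairs l)) => //; rewrite inE => -[? ? ?].
  by rewrite mem_set//= pair_gauge_le//; apply/and3P.
Qed.

End pair_gauge.

Section pair_count.
Context {R : realType} {n : nat}.
Variables (P : pred 'rV[int]_n) (T : set 'rV[R]_n).
Hypothesis TE : T = [set map_mx intr v | v in [set v | P v]].
Variable c : R.
Hypotheses (c_gt0 : 0 < c) (n_gt0 : (0 < n)%N).
Hypothesis cell_equid : forall k p,
  window (cell_corner k p : 'rV[R]_n) ->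
  equid (@lebesgue_rV R n) (@weight R n c) (points P)
    \1_[set x | cell_index k x = p].
Let V := @ball_volume R n.
Let V_gt0 : 0 < V. Proof. exact: ball_volume_gt0. Qed.
Let ball_region r := @region R n P (fun x => enorm x <= 1) r.

Let set_ball_region r : 0 < r -> T `&` eball r = [set` ball_region r].
Proof.
move=> r0; rewrite /ball_region -(set_region TE r0).
  by congr (_ `&` _); apply/seteqP; split => x; rewrite /eball /= enorm_scale_le.
by move=> x x1; apply: enorm_window; lra.
Qed.

Let mem_ball_region r x : 0 < r ->
  (x \in ball_region r) <-> (T x /\ enorm x <= r).
Proof.
move=> r0; have := set_ball_region r0 => /seteqP[h1 h2]; split => [xr|h].
  by have := h2 x xr.
exact: (h1 x).
Qed.

Let ball_pairsE r : 0 < r -> ball_pairs T r =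
  [set` [seq (x, y) | x <- ball_region r, y <- ball_region r]].
Proof.
move=> r0; apply/seteqP; split => [[x y] /= [Tx Ty xr yr]|[x y] /=].
  by apply: allpairs_f; apply/(mem_ball_region _ r0).
case/allpairsP => -[u v] /= [/(mem_ball_region _ r0)[Tu ur]].
by move=> /(mem_ball_region _ r0)[Tv vr] [-> ->].
Qed.

Let close_ball_pairsE l r : 0 < r -> close_ball_pairs T l r =
  [set` [seq p <- [seq (x, y) | x <- ball_region r, y <- ball_region r] |
          enorm (p.1 - p.2) <= l * r]].
Proof.
move=> r0; rewrite /close_ball_pairs ball_pairsE//.
apply/seteqP; split => p /=; rewrite mem_filter; first by move=> [-> ->].
by move=> /andP[].
Qed.

Let uniq_pairs r : uniq [seq (x, y) | x <- ball_region r, y <- ball_region r].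
Proof. by rewrite allpairs_uniq ?region_uniq// => -[? ?] [? ?]. Qed.

Let ncard_ball_pairs r : 0 < r ->
  (ncard (ball_pairs T r))%:R = (ncard (T `&` eball r))%:R ^+ 2 :> R.
Proof.
move=> r0; rewrite ball_pairsE// set_ball_region//.
rewrite !ncard_sum ?uniq_pairs ?region_uniq// big_allpairs expr2 mulr_suml.
by apply: eq_bigr => x _; rewrite mul1r.
Qed.

Let ncard_close_ball_pairs l r : 0 < r ->
  (ncard (close_ball_pairs T l r))%:R = \sum_(x <- ball_region r)
     \sum_(y <- ball_region r) (enorm (x - y) <= l * r)%R%:R :> R.
Proof.
move=> r0; rewrite close_ball_pairsE// ncard_sum ?filter_uniq ?uniq_pairs//.
rewrite big_filter big_mkcond big_allpairs /=.
by apply: eq_bigr => x _; apply: eq_bigr => y _; case: ifP.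
Qed.

Let avg_close_pairs l r : 0 < r ->
  (@weight R n c r * @weight R n c r) * (ncard (close_ball_pairs T l r))%:R =
  avg (fun r => @weight R n c r * @weight R n c r)
    (fun r => [seq (x, y) | x <- points P r, y <- points P r])
    \1_(close_pairs l) r.
Proof.
move=> r0; rewrite ncard_close_ball_pairs// /avg; congr (_ * _).
rewrite big_allpairs /points /ball_region /region !big_map !big_filter.
rewrite big_mkcondr; apply: eq_bigr => u Pu.
rewrite !big_map !big_filter big_mkcondr /=.
have dE v : (enorm (map_mx intr u - map_mx intr v : 'rV[R]_n) <= l * r) =
    (enorm (scaled r u - scaled r v) <= l).
  by rewrite -scalerBr enormZ gtr0_norm ?invr_gt0// ler_pdivrMl// mulrC.
case: ifPn => [u1|u1].
  apply: eq_bigr => v _; rewrite dE indicE.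
  case: ifPn => [v1|v1].
    congr (nat_of_bool _)%:R; apply/idP/idP => [h|].
      by rewrite mem_set.
    by rewrite inE => -[].
  by rewrite memNset// => -[/= _ v1']; rewrite v1' in v1.
rewrite big1// => v _; rewrite indicE memNset//= => -[/= u1'].
by rewrite u1' in u1.
Qed.

Lemma close_pairs_limit l : 0 < l ->
  (ncard (close_ball_pairs T l r))%:R / (ncard (ball_pairs T r))%:R
    @[r --> +oo] --> @pair_volume R n l / V ^+ 2.
Proof.
move=> l0.
have [_ l2] := equid_close_pairs (weight_ge0 c_gt0) cell_equid l0.
have [_ l1] := equid_eball (weight_ge0 c_gt0) cell_equid.
rewrite (Rintegral_eball ltr01) expr1n mul1r -/V in l1.
rewrite /Rintegral integral_indic// in l2; last exact: measurable_close_pairs.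
rewrite setIT -/(@pair_volume R n l) in l2.
have V2 : V ^+ 2 != 0 by rewrite expf_neq0// gt_eqF.
have lim : avg (fun r => @weight R n c r * @weight R n c r)
    (fun r => [seq (x, y) | x <- points P r, y <- points P r])
    \1_(close_pairs l) r / avg (@weight R n c) (points P) \1_(eball 1) r ^+ 2
    @[r --> +oo] --> @pair_volume R n l / V ^+ 2.
  by apply: cvgM => //; apply: cvgV => //; exact: cvg_exprn.
apply: (cvg_near_eq lim); near=> r.
have r0 : 0 < r by near: r; exact: nbhs_pinfty_gt.
have w0 : 0 < @weight R n c r by near: r; exact: weight_gt0.
rewrite -avg_close_pairs// -(ncard_eball TE)// ncard_ball_pairs//.
rewrite exprMn -expr2 invfM mulrACA mulfV ?mul1r//.
by rewrite expf_neq0// gt_eqF.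
Unshelve. all: by end_near. Qed.

(** There are N(r) equal pairs among N(r)^2 pairs, and N(r) tends to infinity like
    r^n. *)
Lemma equal_pairs_limit :
  (ncard (close_ball_pairs T 0 r))%:R / (ncard (ball_pairs T r))%:R
    @[r --> +oo] --> (0 : R).
Proof.
have [_ l1] := equid_eball (weight_ge0 c_gt0) cell_equid.
rewrite (Rintegral_eball ltr01) expr1n mul1r -/V in l1.
have wl : @weight R n c r @[r --> +oo] --> (0 : R).
  rewrite -(mulr0 c); apply: cvgMl_tmp.
  have -> : 0 = 0 ^+ n :> R by rewrite expr0n gtn_eqF.
  by apply: cvg_exprn; exact: cvgV_pinfty.
have lim : @weight R n c r / avg (@weight R n c) (points P) \1_(eball 1) r
    @[r --> +oo] --> 0 / V.
  by apply: cvgM => //; apply: cvgV => //; exact: lt0r_neq0.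
rewrite mul0r in lim.
apply: (cvg_near_eq lim); near=> r.
have r0 : 0 < r by near: r; exact: nbhs_pinfty_gt.
have w0 : 0 < @weight R n c r by near: r; exact: weight_gt0.
rewrite -(ncard_eball TE)// ncard_ball_pairs//.
have -> : (ncard (close_ball_pairs T 0 r))%:R = (ncard (T `&` eball r))%:R :> R.
  rewrite ncard_close_ball_pairs// set_ball_region// ncard_sum ?region_uniq//.
  rewrite big_seq [RHS]big_seq; apply: eq_bigr => x xr.
  rewrite (bigD1_seq x)//= ?region_uniq// subrr enorm0 mul0r lexx big1 ?addr0//.
  move=> y yx; rewrite lt_geF// enorm_gt0 subr_eq0 eq_sym//.
set N := (ncard _)%:R; have [->|N0] := eqVneq N 0.
  by rewrite !mul0r mulr0 invr0 mulr0.
by field; rewrite N0 gt_eqF.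
Unshelve. all: by end_near. Qed.

End pair_count.

(** * The volume of a lens *)

Section reflection.
Context {R : realType}.
Local Open Scope ereal_scope.

Lemma scales_lebesgue_reflection (u : R) :
  scales (@lebesgue_measure R) 1 (fun x => u - x)%R.
Proof.
set S := (fun x => _).
have mS : measurable_fun setT (S : measurableTypeR R -> measurableTypeR R).
  by apply: measurable_funB.
split => // A mA; rewrite mul1e; apply/esym.
pose m' : {measure set (measurableTypeR R) -> \bar R} :=
  measure_function_pushforward__canonical__measure_function_Measure
     (@lebesgue_measure R) mS.
rewrite -[RHS]/(m' A).
apply: (@lebesgue_measure_unique R m') => // _ [[a b] _ <-] /=.
rewrite /pushforward/=.
rewrite (_ : S @^-1` _ = `[u - b, u - a[%classic)%R; last first.
  apply/seteqP; split => x; rewrite /S/= !in_itv/=.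
    by move=> /andP[ax xb]; apply/andP; split; lra.
  by move=> /andP[ax xb]; apply/andP; split; lra.
rewrite !lebesgue_measure_itv/= !lte_fin.
have -> : (u - b < u - a)%R = (a < b)%R by apply/idP/idP => ?; lra.
by case: ifPn => // _; rewrite -!EFinB; congr EFin; ring.
Qed.

(** The half-line u < 0 is moved onto t > c by t = c - u, and the half-line
    u >= 0 onto t >= c by t = u + c. *)
Lemma integral_symmetric_shift (H : R -> \bar R) (c : R) :
  measurable_fun setT H -> (forall t, 0 <= H t) ->
  \int[lebesgue_measure]_u H (`|u| + c)%R =
  2%:E * \int[lebesgue_measure]_(t in `[c, +oo[) H t.
Proof.
move=> mH H0.
have mHc : measurable_fun setT (fun u : R => H (`|u| + c)%R).
  apply: (measurableT_comp mH); apply: measurable_funD => //.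
have -> : [set: R] = `]-oo, 0%R[ `|` `[0%R, +oo[.
  by apply/seteqP; split => u //= _; rewrite !in_itv/= andbT; case: (ltP u 0%R);
    [left|right].
rewrite ge0_integral_setU//; last 2 first.
- exact: measurable_funTS.
- apply/disj_setPLR => u /=; rewrite !in_itv/= andbT; lra.
have half (b : bool) : \int[lebesgue_measure]_(t in [set` Interval (BSide b c) +oo%O]) H t
    = \int[lebesgue_measure]_(t in `[c, +oo[) H t.
  case: b => //; apply: integral_itv_obnd_cbnd; exact: measurable_funTS.
have E1 : \int[lebesgue_measure]_(u in `[0%R, +oo[) H (`|u| + c)%R =
    \int[lebesgue_measure]_(t in `[c, +oo[) H t.
  rewrite integral_mkcond [RHS]integral_mkcond.
  have sc := @scales_lebesgue_affine R 1 c ltr01.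
  rewrite invr1 in sc.
  rewrite -[RHS]mul1e -(ge0_integral_scales _ sc)//; last 2 first.
  - by apply/(measurable_restrictT _ _).1 => //; exact: measurable_funTS.
  - by move=> t; rewrite /patch; case: ifP.
  apply: eq_integral => u _; rewrite /patch !mem_setE !in_itv/= !andbT mul1r.
  rewrite lerDr; case: ifP => // u0; by rewrite ger0_norm.
have E2 : \int[lebesgue_measure]_(u in `]-oo, 0%R[) H (`|u| + c)%R =
    \int[lebesgue_measure]_(t in `[c, +oo[) H t.
  rewrite -(half false) integral_mkcond [RHS]integral_mkcond.
  rewrite -[RHS]mul1e -(ge0_integral_scales _ (scales_lebesgue_reflection c))//; last 2 first.
  - by apply/(measurable_restrictT _ _).1 => //; exact: measurable_funTS.
  - by move=> t; rewrite /patch; case: ifP.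
  apply: eq_integral => u _; rewrite /patch !mem_setE !in_itv/= !andbT.
  have -> : (c < c - u)%R = (u < 0)%R by apply/idP/idP => ?; lra.
  by case: ifP => // u0; rewrite ltr0_norm// addrC.
by rewrite E1 E2 mule_natl mule2n.
Qed.

End reflection.

Section lens.
Context {R : realType} (m : nat).
Let mu := @lebesgue_rV R m.+1.
Let kappa := @ball_volume R m.
Let V := @ball_volume R m.+1.
Local Open Scope ereal_scope.

(** Up to the volume of the unit ball of dimension m, the volume of the section
    of the unit ball of dimension m + 1 at height t. *)
Definition slice (t : R) : R := (Num.sqrt (1 - t ^+ 2) ^+ m)%R.

Lemma slice_ge0 t : (0 <= slice t)%R.
Proof. by rewrite exprn_ge0// sqrtr_ge0. Qed.

Lemma continuous_slice : continuous slice.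
Proof.
move=> t; apply: cvg_exprn.
apply: (@continuous_comp _ _ _ (fun t : R => 1 - t ^+ 2)%R (@Num.sqrt R)); last first.
  exact: sqrt_continuous.
by apply: cvgB; [exact: cvg_cst|apply: cvg_exprn; exact: cvg_id].
Qed.

Lemma measurable_slice : measurable_fun setT slice.
Proof. by apply: continuous_measurable_fun; exact: continuous_slice. Qed.

Lemma lebesgue_eball_ge0 k (t : R) : (0 <= t)%R ->
  lebesgue_rV (@eball R k t) = (t ^+ k * @ball_volume R k)%:E.
Proof.
rewrite le_eqVlt => /predU1P[<-|]; last exact: lebesgue_eball.
have -> : @eball R k 0 = [set x : 'rV[R]_k | forall i, (0 <= x 0%R i <= 0)%R].
  apply/seteqP; split => x; rewrite /eball/= => h.
    move=> i; rewrite -eq_le eq_sym -normr_le0.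
    exact: le_trans (coord_le_enorm _ _) h.
  have -> : x = 0%R.
    by apply/rowP => i; apply/eqP; rewrite mxE eq_sym eq_le h.
  by rewrite enorm0.
rewrite lebesgue_rV_cube// subrr; case: k => [|k]; last by rewrite expr0n/= mul0r.
rewrite expr0 mul1r /ball_volume.
rewrite (_ : eball 1 = [set x : 'rV[R]_0 | forall i, (0 <= x 0%R i <= 0)%R]).
  by rewrite lebesgue_rV_cube//= expr0.
by apply/seteqP; split => x //= _; [case|rewrite /eball/= /enorm big_ord0 sqrtr0].
Qed.

(** The intersection of the unit ball with its translate by - z. *)
Definition lens (z : 'rV[R]_m.+1) : set 'rV[R]_m.+1 :=
  [set x | (enorm x <= 1)%R /\ (enorm (x + z) <= 1)%R].

Lemma measurable_lens z : measurable (lens z).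
Proof.
have -> : lens z = eball 1 `&` (fun x => 1 *: x + z)%R @^-1` eball 1.
  by apply/seteqP; split => x; rewrite /lens /eball/= scale1r.
apply: measurableI; first exact: measurable_eball.
rewrite -[X in measurable X]setTI; apply: measurable_rV_affine => //.
exact: measurable_eball.
Qed.

Lemma lensN z : mu (lens (- z)) = mu (lens z).
Proof.
have sc := @scales_rV_affine R m.+1 1 z ltr01.
have := sc.2 _ (measurable_lens (- z)%R).
rewrite invr1 expr1n mul1e -/mu => <-; congr mu.
by apply/seteqP; split => x; rewrite /lens/= scale1r addrK => -[].
Qed.

(** An isometry fixing 0 carries the lens of an axial vector to the lens of its
    image. When z has a negative first coordinate it is replaced by - z, whose
    lens is a translate of that of z. *)
Lemma lens_rotation z : mu (lens z) = mu (lens (rV_cons (enorm z, 0%R))).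
Proof.
wlog z0 : z / (0 <= z 0 0)%R => [H|].
  have [/H//|zneg] := leP 0%R (z 0%R 0%R).
  by rewrite -lensN H ?enormN// mxE oppr_ge0 ltW.
have [L [scL isoL L0 Le]] := rotation_exists z0.
have nL x : enorm (L x) = enorm x by have := isoL x 0%R; rewrite L0 !subr0.
rewrite -lensN -[RHS]lensN.
have := scL.2 _ (measurable_lens (- z)%R).
rewrite mul1e -/mu => <-; congr mu; apply/seteqP; split => x; rewrite /lens/=.
  by move=> [h1 h2]; rewrite -nL -isoL Le.
by move=> [h1 h2]; rewrite nL -[X in (L x - X)%R]Le isoL.
Qed.

Definition slice_tail (c : R) : \bar R :=
  \int[lebesgue_measure]_(t in `[c, 1%R]) (slice t)%:E.

(** After centering, the lens is { (u, y) : |u| + s/2 <= 1 and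
    |y|^2 <= 1 - (|u| + s/2)^2 }, so that its sections are balls whose volume
    depends on |u| + s/2 only. *)
Lemma lens_axis (s : R) : (0 <= s)%R ->
  mu (lens (rV_cons (s, 0%R))) = (2 * kappa)%:E * slice_tail (s / 2).
Proof.
move=> s0; set c := (s / 2)%R; have c0 : (0 <= c)%R by rewrite divr_ge0.
set e := rV_cons (s, 0%R); pose d := (@rV_cons R m (- c, 0))%R.
have sc := @scales_rV_affine R m.+1 1 d ltr01.
have := sc.2 _ (measurable_lens e).
rewrite invr1 expr1n mul1e -/mu => <-.
pose H (t : R) : \bar R := if (0 <= t <= 1)%R then (kappa * slice t)%:E else 0.
have mH : measurable_fun setT H.
  apply: measurable_fun_ifT => //.
    apply: (measurable_fun_bool true); rewrite setTI.
    by rewrite (_ : _ @^-1` _ = `[0%R, 1%R]%classic)//; apply/seteqP; split.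
  apply/measurable_EFinP; apply: measurable_funM => //; exact: measurable_slice.
have H0 t : 0 <= H t.
  rewrite /H; case: ifP => // _.
  by rewrite lee_fin mulr_ge0 ?slice_ge0// ball_volume_ge0.
have enorm_cons a y : (enorm (@rV_cons R m (a, y)) <= 1)%R =
    (dotv y y <= 1 - a ^+ 2)%R.
  rewrite -(ler_pXn2r (n := 2))// ?nnegrE ?enorm_ge0//.
  rewrite enorm_sqr dotv_rV_cons expr1n /= -expr2.
  by apply/idP/idP => ?; lra.
have shifted a y : (1 *: @rV_cons R m (a, y) + d)%R = rV_cons (a - c, y)%R.
  rewrite scale1r /d -[(- c)%R]/(- (c, 0 : 'rV[R]_m).1)%R.
  have -> : rV_cons (- c, 0)%R = (rV_cons (0, 0) - @rV_cons R m (c, 0))%R.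
    by rewrite rV_consB /= sub0r subr0.
  by rewrite rV_cons0 sub0r rV_consB /= subr0.
(* Of the two conditions |u - c| and |u + c|, the larger absolute value is
   |u| + c. *)
have slab u y : lens e (1 *: @rV_cons R m (u, y) + d)%R <->
    (dotv y y <= 1 - (`|u| + c) ^+ 2)%R.
  rewrite /lens/= shifted.
  have -> : (rV_cons (u - c, y) + e)%R = @rV_cons R m (u + c, y)%R.
    rewrite -[X in (_ + X)%R]opprK.
    have -> : (- e)%R = @rV_cons R m (- s, 0)%R.
      by rewrite -[LHS]sub0r -rV_cons0 rV_consB /= sub0r subr0.
    by rewrite rV_consB /= subr0; congr (rV_cons (_, _)); rewrite /c; lra.
  rewrite !enorm_cons; case: (ger0P u) => u0.
    split=> [[_]//|h]; split => //; apply: (le_trans h); rewrite lerD2l lerN2.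
    have := mulr_ge0 u0 c0; nra.
  split=> [[h _]|h].
    apply: (le_trans h); rewrite (_ : (- u + c = - (u - c))%R) ?sqrrN//; ring.
  have Nu0 : (0 <= - u)%R by lra.
  have uc := mulr_ge0 Nu0 c0; split; apply: (le_trans h); rewrite lerD2l lerN2; nra.
have tail : \int[lebesgue_measure]_(t in `[c, +oo[) H t =
    kappa%:E * slice_tail c.
  rewrite /slice_tail -ge0_integralZl//; last 3 first.
  - by apply/measurable_EFinP; apply: measurable_funTS; exact: measurable_slice.
  - by move=> t _; rewrite lee_fin slice_ge0.
  - by rewrite lee_fin ball_volume_ge0.
  rewrite [LHS]integral_mkcond [RHS]integral_mkcond; apply: eq_integral => t _.
  rewrite /patch !mem_setE !in_itv/= andbT /H.
  have [ct|//] := leP c t; rewrite (le_trans c0 ct) /=.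
  by case: ifP.
rewrite /mu /= /pushforward /product_measure1.
transitivity (\int[lebesgue_measure]_u H (`|u| + c)%R); last first.
  by rewrite integral_symmetric_shift// EFinM -muleA tail.
apply: eq_integral => u _ /=.
set t := (`|u| + c)%R; have t0 : (0 <= t)%R by rewrite addr_ge0.
rewrite /H t0 /=; have [t1|t1] := leP t 1%R.
  have r0 : (0 <= 1 - t ^+ 2)%R by rewrite subr_ge0 expr_le1.
  rewrite (_ : xsection _ u = eball (Num.sqrt (1 - t ^+ 2)%R)).
    rewrite lebesgue_eball_ge0 ?sqrtr_ge0//.
    by rewrite /slice mulrC.
  apply/seteqP; split => y; rewrite /xsection /eball/= inE/= enormE ler_sqrt//.
    by move/slab.
  by move=> h; apply/slab.
rewrite (_ : xsection _ u = set0) ?measure0//.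
apply/seteqP; split => y //; rewrite /xsection/= inE => /slab.
rewrite -/t => h; have := dotv_ge0 y.
have : (1 < t ^+ 2)%R by rewrite exprn_egt1.
lra.
Qed.

Lemma ball_volume_slice : V%:E = (2 * kappa)%:E * slice_tail 0.
Proof.
have := lens_axis (lexx 0%R); rewrite mul0r => <-.
rewrite -lebesgue_eball1; congr lebesgue_rV; apply/seteqP; split => x;
  by rewrite /lens /eball/= rV_cons0 addr0; tauto.
Qed.

End lens.

(** * The volume of close pairs as a one-dimensional integral *)

#[local] Arguments lebesgue_rV : simpl never.

Section distance_integrals.
Context {R : realType} (m : nat).
Let n := m.+1.
Let mu := @lebesgue_rV R n.
Local Notation leb := (@lebesgue_measure R).
Let kappa := @ball_volume R m.
Let V := @ball_volume R n.
Local Open Scope ereal_scope.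

(** The one-dimensional integral to which both the volume of close pairs and the
    integral of the distance density reduce. *)
Definition chord_integral (l : R) : \bar R :=
  \int[leb]_(t in `[0%R, 1%R]) (slice m t * Num.min l (2 * t) ^+ n)%:E.

Lemma measurable_if_le d (X : measurableType d) (b : X -> bool) (f : X -> R) :
  measurable [set x | b x] -> measurable_fun setT f ->
  measurable_fun setT (fun x => if b x then (f x)%:E else 0).
Proof.
move=> mb mf; apply: measurable_fun_ifT => //.
  by apply: (measurable_fun_bool true); rewrite setTI.
exact/measurable_EFinP.
Qed.

Lemma measurable_le_fun d (X : measurableType d) (f g : X -> R) :
  measurable_fun setT f -> measurable_fun setT g ->
  measurable [set x | (f x <= g x)%R].
Proof.
move=> mf mg; have mh : measurable_fun setT (fun x => g x - f x)%R.
  exact: measurable_funB.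
rewrite (_ : mkset _ = (fun x => g x - f x)%R @^-1` `[0%R, +oo[); last first.
  by apply/seteqP; split => x /=; rewrite in_itv/= andbT subr_ge0.
by rewrite -[X in measurable X]setTI; exact: mh.
Qed.

Lemma lens_measure z : mu (lens z) = (2 * kappa)%:E * slice_tail m (enorm z / 2).
Proof. by rewrite /mu lens_rotation lens_axis ?enorm_ge0. Qed.

(** The measure-preserving substitution (b, z) |-> (b, z + b). *)
Lemma close_pairs_section (l : R) : (0 < l)%R ->
  (mu \x mu) (close_pairs l) =
  \int[mu]_z (if (enorm z <= l)%R then mu (lens z) else 0).
Proof.
move=> l0.
have sc : scales (mu \x mu) (1 * 1)%R
    (fun p : 'rV[R]_n * 'rV[R]_n => (p.1, 1 *: p.2 + p.1)%R).
  apply: (scales_prod_skewl (m1 := mu) (m2 := mu) (S1 := id)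
    (S2 := (fun b z => 1 *: z + b)%R)) => //.
  - by split => // A mA; rewrite preimage_id mul1e.
  - move=> b; have := @scales_rV_affine R n 1 b ltr01.
    by rewrite invr1 expr1n.
  - apply/measurable_fun_pairP; split => /=; first exact: measurable_fst.
    apply/measurable_fun_coordP => i; under eq_fun do rewrite !mxE mul1r.
    apply: measurable_funD.
      exact: (measurableT_comp (measurable_coord i) measurable_snd).
    exact: (measurableT_comp (measurable_coord i) measurable_fst).
have := sc.2 _ (measurable_close_pairs l).
rewrite mulr1 mul1e => <-.
rewrite product_measure1_2; last first.
  rewrite -[X in measurable X]setTI; apply: sc.1 => //.
  exact: measurable_close_pairs.
rewrite /product_measure2; apply: eq_integral => z _ /=.
have dz (b : 'rV[R]_n) : enorm (b - (1 *: z + b))%R = enorm z.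
  by rewrite scale1r opprD addrCA subrr addr0 enormN.
case: ifPn => zl.
  have -> // : ysection ((fun p : 'rV[R]_n * 'rV[R]_n => (p.1, 1 *: p.2 + p.1)%R)
      @^-1` close_pairs l) z = lens z.
  apply/seteqP; split => b; rewrite /ysection/= inE /close_pairs/lens/= dz.
    by rewrite scale1r addrC => -[].
  by rewrite scale1r addrC => -[].
rewrite (_ : ysection _ z = set0); first exact: (measure0 (@lebesgue_rV R n)).
apply/seteqP; split => b //; rewrite /ysection/= inE /close_pairs/= dz => -[_ _].
by rewrite (negbTE zl).
Qed.

(** Writing the constraints inside the integrand turns the iterated integrals
    over triangles into integrals over the whole plane. *)
Lemma slice_tail_if (l s : R) : (0 <= s)%R ->
  (if (s <= l)%R then slice_tail m (s / 2) else 0) =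
  \int[leb]_t (if [&& s <= l, s <= 2 * t & t <= 1]%R then (slice m t)%:E else 0).
Proof.
move=> s0; case: ifPn => sl /=; last by rewrite integral0.
rewrite /slice_tail integral_mkcond; apply: eq_integral => t _.
rewrite /patch mem_setE in_itv/=.
by rewrite ler_pdivrMr// mulrC.
Qed.

Lemma measurable_slice_tail (l : R) :
  measurable_fun `[0%R, l] (fun s : R => slice_tail m (s / 2)).
Proof.
pose f (p : R * R) : \bar R :=
  if [&& p.1 <= l, p.1 <= 2 * p.2 & p.2 <= 1]%R then (slice m p.2)%:E else 0.
have f0 p : 0 <= f p by rewrite /f; case: ifP => // _; rewrite lee_fin slice_ge0.
have mf : measurable_fun setT f.
  have m1 : measurable_fun setT (fun p : R * R => p.1) by exact: measurable_fst.
  have m2 : measurable_fun setT (fun p : R * R => p.2) by exact: measurable_snd.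
  apply: measurable_if_le.
    rewrite (_ : mkset _ = [set p | p.1 <= l]%R `&`
      ([set p | p.1 <= 2 * p.2]%R `&` [set p | p.2 <= 1]%R)); last first.
      by apply/seteqP; split => p /=; [move=> /and3P[]|move=> [? [? ?]]; apply/and3P].
    apply: measurableI; first exact: measurable_le_fun.
    apply: measurableI; last exact: measurable_le_fun.
    by apply: measurable_le_fun => //; exact: measurable_funM.
  exact: (measurableT_comp (@measurable_slice R m) m2).
apply: (eq_measurable_fun (fun s : R => \int[leb]_t f (s, t))).
  move=> s; rewrite inE /= in_itv/= => /andP[s0 sl].
  by rewrite /f /= -slice_tail_if// sl.
apply: measurable_funTS.
exact: (measurable_fun_fubini_tonelli_F (m2 := leb)).
Qed.

(** Exchanging the integrals over z and t, the constraints |z| <= l and |z| <= 2t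
    leave a ball of radius min(l, 2t), of volume V min(l, 2t)^n. *)
Lemma pair_volume_chord (l : R) : (0 < l)%R ->
  (mu \x mu) (close_pairs l) = (2 * kappa * V)%:E * chord_integral l.
Proof.
move=> l0; rewrite close_pairs_section//.
pose f (p : 'rV[R]_n * R) : \bar R :=
  if [&& enorm p.1 <= l, enorm p.1 <= 2 * p.2 & p.2 <= 1]%R
  then (slice m p.2)%:E else 0.
have f0 p : 0 <= f p by rewrite /f; case: ifP => // _; rewrite lee_fin slice_ge0.
have mf : measurable_fun setT f.
  have m1 : measurable_fun setT (fun p : 'rV[R]_n * R => enorm p.1).
    exact: (measurableT_comp (@measurable_enorm R n) measurable_fst).
  have m2 : measurable_fun setT (fun p : 'rV[R]_n * R => p.2).
    exact: measurable_snd.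
  apply: measurable_if_le.
    rewrite (_ : mkset _ = [set p | enorm p.1 <= l]%R `&`
      ([set p | enorm p.1 <= 2 * p.2]%R `&` [set p | p.2 <= 1]%R)); last first.
      by apply/seteqP; split => p /=; [move=> /and3P[]|move=> [? [? ?]]; apply/and3P].
    apply: measurableI; first exact: measurable_le_fun.
    apply: measurableI; last exact: measurable_le_fun.
    by apply: measurable_le_fun => //; exact: measurable_funM.
  exact: (measurableT_comp (@measurable_slice R m) m2).
transitivity (\int[mu]_z ((2 * kappa)%:E * \int[leb]_t f (z, t))).
  apply: eq_integral => z _; rewrite /f /= -slice_tail_if ?enorm_ge0//.
  by case: ifP => // _; rewrite ?mule0// lens_measure.
have k0 : (0 <= kappa)%R by exact: ball_volume_ge0.
rewrite ge0_integralZl//; last 3 first.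
- exact: (measurable_fun_fubini_tonelli_F (m2 := leb)).
- by move=> z _; apply: integral_ge0 => t _.
- by rewrite lee_fin mulr_ge0.
rewrite (fubini_tonelli (m1 := mu) (m2 := leb) f mf f0).
rewrite (EFinM (2 * kappa) V) -muleA; congr (_ * _).
rewrite /chord_integral -ge0_integralZl//; last 3 first.
- apply/measurable_EFinP; apply: measurable_funTS; apply: measurable_funM.
    exact: measurable_slice.
  apply: measurable_funX; apply: measurable_minr => //.
- move=> t; rewrite /= in_itv/= => /andP[t0 _]; rewrite lee_fin mulr_ge0 ?slice_ge0//.
  by rewrite exprn_ge0// le_min (ltW l0)/= mulr_ge0.
- by rewrite lee_fin ball_volume_ge0.
rewrite [RHS]integral_mkcond; apply: eq_integral => t _.
rewrite /patch mem_setE in_itv/= /f /=.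
have [t1|t1] := leP t 1%R; last first.
  by rewrite andbF integral0_eq// => z _; rewrite !andbF.
rewrite andbT; have [t0|t0] := leP 0%R t; last first.
  rewrite integral0_eq// => z _; rewrite andbT; case: andP => // -[_].
  by move=> zt; exfalso; have := enorm_ge0 z; lra.
have lt0 : (0 <= Num.min l (2 * t))%R by rewrite le_min (ltW l0)/= mulr_ge0.
transitivity (\int[mu]_z ((slice m t)%:E * (\1_(eball (Num.min l (2 * t))) z)%:E)).
  apply: eq_integral => z _; rewrite andbT indicE.
  case: ifPn => [/andP[h1 h2]|h].
    by rewrite mem_set ?mule1// /eball/= le_min h1.
  by rewrite memNset ?mule0// /eball/= le_min; apply/negP.
rewrite ge0_integralZl//; last 2 first.
- by apply/measurable_EFinP; apply: measurable_indic; exact: measurable_eball.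
- by rewrite lee_fin slice_ge0.
rewrite integral_indic//; last exact: measurable_eball.
rewrite setIT [X in _ * X](lebesgue_eball_ge0 n lt0) -!EFinM; congr EFin.
by rewrite -/V; ring.
Qed.

Lemma integral_power (x : R) : (0 <= x)%R ->
  \int[leb]_(s in `[0%R, x]) (n%:R * s ^+ m)%:E = (x ^+ n)%:E.
Proof.
rewrite le_eqVlt => /predU1P[<-|x0].
  by rewrite set_itv1 integral_set1 expr0n.
rewrite (continuous_FTC2 (F := fun s => s ^+ n)%R)//.
- by rewrite expr0n/= sube0.
- apply: continuous_subspaceT => s; apply: cvgMl_tmp; apply: cvg_exprn.
  exact: cvg_id.
- split.
  + by move=> s _; exact: exprn_derivable.
  + by apply: cvg_at_right_filter; apply: cvg_exprn; exact: cvg_id.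
  + by apply: cvg_at_left_filter; apply: cvg_exprn; exact: cvg_id.
- by move=> s _; rewrite exp_derive1.
Qed.

(** The same exchange with n s^(n-1) ds in place of the radial part of dz: the
    inner integral over 0 <= s <= min(l, 2t) is min(l, 2t)^n. *)
Lemma chord_integral_density (l : R) : (0 <= l)%R ->
  \int[leb]_(s in `[0%R, l]) ((n%:R * s ^+ m)%:E * slice_tail m (s / 2)) =
  chord_integral l.
Proof.
move=> l0.
pose f (p : R * R) : \bar R :=
  if [&& 0 <= p.1, p.1 <= l, p.1 <= 2 * p.2 & p.2 <= 1]%R
  then (n%:R * p.1 ^+ m * slice m p.2)%:E else 0.
have f0 p : 0 <= f p.
  rewrite /f; case: ifP => // /and4P[h _ _ _].
  by rewrite lee_fin mulr_ge0 ?slice_ge0// mulr_ge0// exprn_ge0.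
have mf : measurable_fun setT f.
  have m1 : measurable_fun setT (fun p : R * R => p.1) by exact: measurable_fst.
  have m2 : measurable_fun setT (fun p : R * R => p.2) by exact: measurable_snd.
  apply: measurable_if_le.
    rewrite (_ : mkset _ = [set p | 0 <= p.1]%R `&` ([set p | p.1 <= l]%R `&`
      ([set p | p.1 <= 2 * p.2]%R `&` [set p | p.2 <= 1]%R))); last first.
      by apply/seteqP; split => p /=; [move=> /and4P[]|
        move=> [? [? [? ?]]]; apply/and4P].
    apply: measurableI; first exact: measurable_le_fun.
    apply: measurableI; first exact: measurable_le_fun.
    apply: measurableI; last exact: measurable_le_fun.
    by apply: measurable_le_fun => //; exact: measurable_funM.
  apply: measurable_funM.
    by apply: measurable_funM => //; exact: measurable_funX.
  exact: (measurableT_comp (@measurable_slice R m) m2).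
transitivity (\int[leb]_s \int[leb]_t f (s, t)).
  rewrite integral_mkcond; apply: eq_integral => s _.
  rewrite /patch mem_setE in_itv/= /f /=.
  have [s0|s0] := leP 0%R s; last by rewrite /= integral0_eq.
  have := slice_tail_if l s0; case: ifPn => sl /= E; last by rewrite integral0_eq.
  rewrite E -ge0_integralZl//.
  - apply: eq_integral => t _; case: ifP => _; by rewrite ?mule0// EFinM.
  - have ml : measurable [set t : R | (s <= 2 * t)%R && (t <= 1)%R].
      rewrite (_ : mkset _ = `[(s / 2)%R, 1%R]%classic)//.
      apply/seteqP; split => t /=; rewrite in_itv/= ler_pdivrMr// mulrC//.
    exact: (measurable_if_le ml (@measurable_slice R m)).
  - by move=> t _; case: ifP => // _; rewrite lee_fin slice_ge0.
  - by rewrite lee_fin mulr_ge0// exprn_ge0.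
rewrite (fubini_tonelli (m1 := leb) (m2 := leb) f mf f0).
rewrite /chord_integral [RHS]integral_mkcond; apply: eq_integral => t _.
rewrite /patch mem_setE in_itv/= /f /=.
have [t1|t1] := leP t 1%R; last first.
  by rewrite andbF integral0_eq// => z _; rewrite !andbF.
rewrite andbT; have [t0|t0] := leP 0%R t; last first.
  rewrite integral0_eq// => s _; case: and4P => // -[s0 _ st _]; exfalso; lra.
have lt0 : (0 <= Num.min l (2 * t))%R by rewrite le_min l0 mulr_ge0.
transitivity ((Num.min l (2 * t) ^+ n)%:E * (slice m t)%:E); last first.
  by rewrite -EFinM mulrC.
rewrite -(integral_power lt0) -ge0_integralZr//; last 3 first.
- by apply/measurable_EFinP; apply: measurable_funTS; apply: measurable_funM => //; exact: measurable_funX.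
- by move=> s; rewrite /= in_itv/= => /andP[s0 _]; rewrite lee_fin mulr_ge0// exprn_ge0.
- by rewrite lee_fin slice_ge0.
rewrite [RHS]integral_mkcond; apply: eq_integral => s _.
rewrite /patch mem_setE in_itv/= andbT le_min.
by case: ifP => _; rewrite ?EFinM.
Qed.

End distance_integrals.

(** * The incomplete beta integral *)

Section beta.
Context {R : realType} (m : nat).
Local Notation leb := (@lebesgue_measure R).

(** The integrand t^(a-1) (1-t)^(b-1) of the beta integral for a = (m+2)/2 and
    b = 1/2, written with square roots. *)
Definition half_beta (t : R) : R := Num.sqrt t ^+ m * (Num.sqrt (1 - t))^-1.

Lemma half_betaE t : 0 <= t <= 1 ->
  t `^ (m.+2%:R / 2 - 1) * (1 - t) `^ (1 / 2 - 1) = half_beta t.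
Proof.
move=> /andP[t0 t1]; rewrite /half_beta.
have -> : m.+2%:R / 2 - 1 = 2^-1 * m%:R :> R by rewrite -natr1 -natr1; field.
have -> : 1 / 2 - 1 = - 2^-1 :> R by field.
rewrite powRrM powR12_sqrt// powR_mulrn ?sqrtr_ge0//.
by rewrite powRN powR12_sqrt// subr_ge0.
Qed.

Lemma half_beta_ge0 t : 0 <= half_beta t.
Proof. by rewrite mulr_ge0 ?exprn_ge0 ?invr_ge0 ?sqrtr_ge0. Qed.

Lemma measurable_half_beta : measurable_fun setT half_beta.
Proof.
have ms : measurable_fun setT (@Num.sqrt R).
  by apply: continuous_measurable_fun; exact: sqrt_continuous.
apply: measurable_funM; first exact: measurable_funX.
rewrite (_ : (fun t => _) = fun t : R => (Num.sqrt (1 - t)) `^ (-1)); last first.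
  by apply/funext => t; rewrite powRN powRr1// sqrtr_ge0.
apply: (measurableT_comp (measurable_powR _)).
by apply: (measurableT_comp ms); exact: measurable_funB.
Qed.

Local Open Scope ereal_scope.

(** Substitute u = 1 - t^2: sqrt(u)^m becomes the slice at t, and
    du / sqrt(1 - u) becomes - 2 dt. For c = 0 the integrand is unbounded at
    u = 1, hence the restriction to c > 0. *)
Lemma half_beta_substitution (c : R) : (0 < c <= 1)%R ->
  \int[leb]_(t in `[0%R, (1 - c ^+ 2)%R]) (half_beta t)%:E =
  2%:E * slice_tail m c.
Proof.
move=> /andP[c0 c1]; pose F (t : R) : R := (1 - t ^+ 2)%R.
have FE : F = (cst 1 - (@GRing.exp R ^~ 2%N))%R by [].
have dF : derive1 F = (fun t => - (2 * t))%R.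
  apply/funext => t; rewrite derive1E FE deriveB; last 2 first.
  - exact: derivable_cst.
  - exact: exprn_derivable.
  by rewrite derive_cst exp_derive expr1 sub0r /GRing.scale /= mulr1.
have cF : continuous F.
  by move=> t; apply: cvgB; [exact: cvg_cst|apply: cvg_exprn; exact: cvg_id].
have cdF : continuous (fun t : R => - (2 * t))%R.
  by move=> t; apply: cvgN; apply: cvgMl_tmp; exact: cvg_id.
rewrite (_ : 0%R = F 1%R); last by rewrite /F expr1n subrr.
rewrite -/(F c) (@integration_by_substitution_decreasing R F half_beta c 1)//.
- rewrite /slice_tail -ge0_integralZl//; last 2 first.
  + by apply/measurable_EFinP; apply: measurable_funTS; exact: measurable_slice.
  + by move=> t _; rewrite lee_fin slice_ge0.
  apply: eq_integral => t; rewrite inE /= in_itv/= => /andP[ct t1].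
  have t0 : (0 < t)%R by exact: lt_le_trans ct.
  rewrite -EFinM dF; congr EFin.
  transitivity (half_beta (1 - t ^+ 2) * (- - (2 * t)))%R => //.
  rewrite /half_beta /slice (_ : 1 - (1 - t ^+ 2) = t ^+ 2)%R; last by ring.
  by rewrite sqrtr_sqr gtr0_norm//; field; rewrite gt_eqF.
- move=> x y; rewrite !in_itv/= => /andP[cx _] /andP[cy _] xy.
  rewrite /F ltrD2l ltrN2 ltrXn2r// ?nnegrE//; lra.
- by move=> t _; rewrite dF; exact: cdF.
- by rewrite dF; apply/cvg_ex; exists (- (2 * c))%R; apply: cvg_at_right_filter; exact: cdF.
- by rewrite dF; apply/cvg_ex; exists (- (2 * 1))%R; apply: cvg_at_left_filter; exact: cdF.
- split.
  + move=> t _; rewrite FE; apply: derivableB; first exact: derivable_cst.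
    exact: exprn_derivable.
  + by apply: cvg_at_right_filter; exact: cF.
  + by apply: cvg_at_left_filter; exact: cF.
- apply: continuous_in_subspaceT => t; rewrite inE /= in_itv/= => /andP[_ t1].
  have Fc : (F c < 1)%R by rewrite /F ltrBlDr ltrDl exprn_gt0.
  apply: cvgM.
    by apply: cvg_exprn; exact: sqrt_continuous.
  apply: cvgV; first by rewrite gt_eqF// sqrtr_gt0 subr_gt0; exact: le_lt_trans Fc.
  apply: (@continuous_comp _ _ _ (fun t : R => 1 - t)%R (@Num.sqrt R)).
    by apply: cvgB; [exact: cvg_cst|exact: cvg_id].
  exact: sqrt_continuous.
Qed.

(** The case c = 0 of the substitution, by monotone convergence along
    c = 1/(k+1). *)
Lemma half_beta_total :
  \int[leb]_(t in `[0%R, 1%R]) (half_beta t)%:E = 2%:E * slice_tail m 0.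
Proof.
pose c (k : nat) : R := (k.+1%:R^-1)%R.
have c0 k : (0 < c k)%R by rewrite invr_gt0.
have c1 k : (c k <= 1)%R by rewrite invf_le1 ?ltr0n// ler1n.
have cdec k l : (k <= l)%N -> (c l <= c k)%R.
  by move=> kl; rewrite lef_pV2 ?posrE ?ltr0n// ler_nat.
have mb (D : set R) : measurable D -> measurable_fun D (fun t => (half_beta t)%:E).
  by move=> mD; apply/measurable_EFinP; apply: measurable_funTS; exact: measurable_half_beta.
have ms (D : set R) : measurable D -> measurable_fun D (fun t => (slice m t)%:E).
  by move=> mD; apply/measurable_EFinP; apply: measurable_funTS; exact: measurable_slice.
pose F k : set R := `[0%R, (1 - c k ^+ 2)%R]%classic.
pose G k : set R := `[c k, 1%R]%classic.
have UF : \bigcup_k F k = `[0%R, 1%R[%classic.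
  apply/seteqP; split => t /=.
    move=> [k _]; rewrite /F /= !in_itv/= => /andP[-> h]/=.
    by apply: (le_lt_trans h); rewrite ltrBlDr ltrDl exprn_gt0.
  rewrite in_itv/= => /andP[t0 t1].
  have [k kt] := @exists_invn_lt R (1 - t)%R ltac:(lra).
  exists k => //; rewrite /F /= in_itv/= t0/=.
  have : (c k ^+ 2 <= c k)%R by rewrite expr2 ler_piMl// ltW.
  rewrite -/(c k) in kt; move: (c k) kt => y yt y2; lra.
have UG : \bigcup_k G k = `]0%R, 1%R]%classic.
  apply/seteqP; split => t /=.
    move=> [k _]; rewrite /G /= !in_itv/= => /andP[h ->].
    by rewrite andbT; exact: lt_le_trans h.
  rewrite in_itv/= => /andP[t0 t1]; have [k kt] := exists_invn_lt t0.
  by exists k => //; rewrite /G /= in_itv/= t1 andbT ltW.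
have limF : \int[leb]_(t in F k) (half_beta t)%:E @[k --> \oo] -->
    \int[leb]_(t in `[0%R, 1%R]) (half_beta t)%:E.
  rewrite -integral_itv_bndo_bndc; last exact: mb.
  rewrite -UF; apply: ge0_nondecreasing_set_cvg_integral => //.
  - move=> k l kl; rewrite subsetEset => t; rewrite /F /= !in_itv/=.
    move=> /andP[-> h]/=; apply: (le_trans h); rewrite lerD2l lerN2.
    by rewrite lerXn2r ?nnegrE ?(ltW (c0 _))//; exact: cdec.
  - by move=> k; exact: measurable_itv.
  - by move=> k; apply: mb; exact: measurable_itv.
  - by move=> k t _; rewrite lee_fin half_beta_ge0.
have limG : \int[leb]_(t in G k) (slice m t)%:E @[k --> \oo] --> slice_tail m 0.
  rewrite /slice_tail -integral_itv_obnd_cbnd; last exact: ms.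
  rewrite -UG; apply: ge0_nondecreasing_set_cvg_integral => //.
  - move=> k l kl; rewrite subsetEset => t; rewrite /G /= !in_itv/=.
    by move=> /andP[h ->]; rewrite andbT; apply: le_trans h; exact: cdec.
  - by move=> k; exact: measurable_itv.
  - by move=> k; apply: ms; exact: measurable_itv.
  - by move=> k t _; rewrite lee_fin slice_ge0.
have limFG : (fun k => \int[leb]_(t in F k) (half_beta t)%:E) =
    (fun k => 2%:E * \int[leb]_(t in G k) (slice m t)%:E).
  by apply/funext => k; apply: half_beta_substitution; rewrite c0 c1.
rewrite limFG in limF.
apply: (cvg_unique _ limF); first exact: ereal_hausdorff.
by apply: cvgeZl.
Qed.

Lemma slice_tail_fin (c : R) : (0 <= c)%R -> slice_tail m c \is a fin_num.
Proof.
move=> c0; apply: integrable_fin_num => //.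
apply: continuous_compact_integrable; first exact: segment_compact.
by apply: continuous_subspaceT; exact: continuous_slice.
Qed.

Lemma inc_beta_slice_tail (s : R) : (0 <= s <= 2)%R ->
  inc_beta (m.+2%:R / 2) (1 / 2) (1 - s ^+ 2 / 4) =
  (2 * fine (slice_tail m (s / 2)))%R.
Proof.
move=> /andP[s0 s2]; rewrite /inc_beta /Rintegral.
have -> : (1 - s ^+ 2 / 4)%R = (1 - (s / 2) ^+ 2)%R by field.
have c0 : (0 <= s / 2)%R by rewrite divr_ge0.
have c1 : (s / 2 <= 1)%R by lra.
transitivity (fine (\int[leb]_(t in `[0%R, (1 - (s / 2) ^+ 2)%R]) (half_beta t)%:E)).
  congr fine; apply: eq_integral => t; rewrite inE /= in_itv/= => /andP[t0 t1].
  rewrite half_betaE// t0 /= (le_trans t1)// gerBl sqr_ge0//.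
have -> : \int[leb]_(t in `[0%R, (1 - (s / 2) ^+ 2)%R]) (half_beta t)%:E =
    2%:E * slice_tail m (s / 2).
  have [->|sn0] := eqVneq s 0%R.
    by rewrite mul0r expr0n subr0 half_beta_total.
  by apply: half_beta_substitution; rewrite c1 andbT divr_gt0// lt0r sn0.
by rewrite fineM//; exact: slice_tail_fin.
Qed.

Lemma chord_integral_fin (l : R) : chord_integral m l \is a fin_num.
Proof.
apply: integrable_fin_num => //.
apply: continuous_compact_integrable; first exact: segment_compact.
apply: continuous_subspaceT => t; apply: cvgM; first exact: continuous_slice.
apply: cvg_exprn.
rewrite -[X in X @ _ --> _]/((cst l) \min (fun t : R => 2 * t))%R.
apply: continuous_min; first exact: cvg_cst.
by apply: cvgMl_tmp; exact: cvg_id.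
Qed.

End beta.

Section density_integral.
Context {R : realType} (m : nat).
Local Notation leb := (@lebesgue_measure R).

(** The normalizations agree: by [ball_volume_slice], V = 2 kappa S0 where S0 is
    the full integral of the slices, so 2 kappa V / V^2 = 1 / S0, while the
    complete beta integral is 2 S0. *)
Lemma distance_density_integral (l : R) : 0 < l <= 2 ->
  \int[leb]_(s in `[0, l]) distance_density m.+1 s =
  @pair_volume R m.+1 l / @ball_volume R m.+1 ^+ 2.
Proof.
move=> /andP[l0 l2].
set V := ball_volume m.+1.
have V0 : 0 < V by exact: ball_volume_gt0.
pose k := @ball_volume R m.
pose S0 := fine (slice_tail m (0 : R)).
have ES0 : slice_tail m (0 : R) = S0%:E by rewrite fineK// slice_tail_fin.
have VE : V = 2 * k * S0.
  by apply/EFin_inj; rewrite EFinM -ES0; exact: ball_volume_slice.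
have S00 : S0 != 0 by apply: contraTneq V0; rewrite VE => ->; rewrite mulr0 ltxx.
have k0 : k != 0 by apply: contraTneq V0; rewrite VE => ->; rewrite mulr0 mul0r ltxx.
have -> : @pair_volume R m.+1 l = 2 * k * V * fine (chord_integral m l).
  by rewrite /pair_volume pair_volume_chord// fineM// chord_integral_fin.
transitivity (S0^-1 * fine (chord_integral m l)); last first.
  by rewrite VE; field; rewrite k0 S00.
rewrite -chord_integral_density ?(ltW l0)// /Rintegral.
have beta1 : inc_beta (m.+2%:R / 2) (1 / 2) 1 = 2 * S0.
  have := @inc_beta_slice_tail R m 0; rewrite expr0n mul0r subr0 mul0r.
  by apply; rewrite lexx/=.
transitivity (fine ((S0^-1)%:E * \int[leb]_(s in `[0%R, l])
    ((m.+1%:R * s ^+ m)%:E * slice_tail m (s / 2)))%E); last first.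
  by rewrite fineM// chord_integral_density ?(ltW l0)// chord_integral_fin.
rewrite -ge0_integralZl//; last 3 first.
- apply: emeasurable_funM; last exact: measurable_slice_tail.
  apply/measurable_EFinP; apply: measurable_funTS.
  by apply: measurable_funM => //; exact: measurable_funX.
- move=> s; rewrite /= in_itv/= => /andP[s0 _]; apply: mule_ge0.
    by rewrite lee_fin mulr_ge0// exprn_ge0.
  by apply: integral_ge0 => t _; rewrite lee_fin slice_ge0.
- by rewrite lee_fin invr_ge0 fine_ge0//; apply: integral_ge0 => t _; rewrite lee_fin slice_ge0.
congr fine; apply: eq_integral => s; rewrite inE /= in_itv/= => /andP[s0 sl].
have s20 : 0 <= s / 2 by rewrite divr_ge0.
rewrite -(fineK (slice_tail_fin m s20)) -!EFinM; congr EFin.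
rewrite /distance_density /reg_inc_beta inc_beta_slice_tail; last first.
  by rewrite s0 (le_trans sl).
by rewrite beta1 /=; field.
Qed.

End density_integral.

(** * Conclusion *)

Section conclusion.
Context {R : realType} {n : nat}.
Variables (P : pred 'rV[int]_n) (T : set 'rV[R]_n).
Hypothesis TE : T = [set map_mx intr v | v in [set v | P v]].
Variable c : R.
Hypotheses (c_gt0 : 0 < c) (n_gt0 : (0 < n)%N).
Hypothesis cell_equid : forall k p,
  window (cell_corner k p : 'rV[R]_n) ->
  equid (@lebesgue_rV R n) (@weight R n c) (points P)
    \1_[set x | cell_index k x = p].

Lemma equidistributed_point_set :
  [/\ angular_condition T,
      radial_condition T &
      forall lambda : R, 0 <= lambda <= 2 ->
        (ncard (close_ball_pairs T lambda r))%:R / (ncard (ball_pairs T r))%:R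
          @[r --> +oo] -->
        \int[lebesgue_measure]_(s in `[0, lambda]) distance_density n s].
Proof.
split.
- exact: (angular_of_equid TE c_gt0 n_gt0 cell_equid).
- exact: (radial_of_equid TE c_gt0 n_gt0 cell_equid).
move=> l /andP[]; rewrite le_eqVlt => /predU1P[<- _|l0 l2].
  rewrite set_itv1 Rintegral_set1.
  exact: (equal_pairs_limit TE c_gt0 n_gt0 cell_equid).
have nE : n = n.-1.+1 by rewrite prednK.
have -> : \int[lebesgue_measure]_(s in `[0, l]) distance_density n s =
    @pair_volume R n l / @ball_volume R n ^+ 2.
  rewrite nE; apply: distance_density_integral.
  by rewrite l0.
exact: (close_pairs_limit TE c_gt0 n_gt0 cell_equid).
Qed.

End conclusion.

Theorem mainTheorem4 (R : realType) (n : nat) (T : set 'rV[R]_n)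
    (hT : (T = lattice_points /\ (1 <= n)%N) \/
          (T = primitive_points /\ (2 <= n)%N)) :
  [/\ angular_condition T,
      radial_condition T &
      forall lambda : R, 0 <= lambda <= 2 ->
        (ncard (close_ball_pairs T lambda r))%:R / (ncard (ball_pairs T r))%:R
          @[r --> +oo] -->
        \int[lebesgue_measure]_(s in `[0, lambda]) distance_density n s].
Proof.
case: hT => -[TE n0].
  apply: (@equidistributed_point_set R n xpredT T _ 1) => //.
    rewrite TE /lattice_points; congr image.
    by apply/seteqP; split.
  exact: lattice_cell_equid.
apply: (@equidistributed_point_set R n primitive T _ (zeta_nat n)).
- rewrite TE /primitive_points; congr image.
  apply/seteqP; split => v /=; rewrite /primitive.
    by move=> [v0 v1]; rewrite v0; exact/eqP.
  by move=> /andP[v0 /eqP].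
- exact: zeta_gt0.
- exact: ltn_trans n0.
- by move=> k p; exact: primitive_cell_equid.
Qed.
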